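(* Let $E$ be an infinite directed graph with finite subgraphs $F_0\subseteq F_1\subseteq\cdots\subseteq E$ such that $\bigcup_n F_n=E$. Let $D=\{u\in E^0 : o^{-1}(u)\text{ is infinite}\}$. Suppose that the following conditions hold. (a1) $D\subseteq F_0^0$. (a2) $F_n$ is irreducible and not a cycle, for all $n\ge 0$. (a3) $o^{-1}(F_n^0)\cap t^{-1}(F_n^0)\cap E^1\subseteq F_n^1$ for all $n\ge0$. (a4) $o^{-1}(F_n^0\setminus D)\subseteq F_n^1$ for all $n\ge 0$. (a5) $t^{-1}(F_n^0)\subseteq F_{n+1}^1$ for all $n\ge0$. (b1) $K_0(\mathcal{O}(E))$ and $K_1(\mathcal{O}(E))$ are finitely generated. (b2) For each $u\in E^0\setminus D$ there exist $v\in F_0^0\setminus D$ and a graph isomorphism $\gamma:o^{-1}(u)\to o^{-1}(v)$ such that $[t(e)]=[t(\gamma(e))]$ in $K_0(\mathcal{O}(E))$ for all $e\in o^{-1}(u)$. Then $\mathcal{O}(E)$ is semiprojective.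
   Context: A directed graph $E$ has vertex set $E^0$, edge set $E^1$ (multiple edges and loops allowed), and origin and terminus maps $o,t:E^1\to E^0$. Subgraphs $F\subseteq E$ have $F^0\subseteq E^0$, $F^1\subseteq E^1$, with the endpoints of edges of $F^1$ in $F^0$. A graph is irreducible if for any two vertices $u,v$ there is a directed path (of positive length) from $u$ to $v$; a graph is a cycle if it consists of a single directed cycle. In (b2), $o^{-1}(w)$ is viewed as the subgraph consisting of the edges with origin $w$ together with their endpoints; in particular $\gamma$ is a bijection from the edges with origin $u$ to the edges with origin $v$. $\mathcal{O}(E)$ is the universal $C^*$-algebra generated by elements denoted by the vertices $u\in E^0$ and edges $e\in E^1$, subject to the following relations, where $D=\{u\in E^0: o^{-1}(u)\text{ infinite}\}$: (o1) the $e\in E^1$ are partial isometries and the $u\in E^0$ are projections; (o2) $uv=0$ if $u\ne v$, $u,v\in E^0$; (o3) $e^*e=t(e)$ for $e\in E^1$; (o4) $o(e)\cdot e=e$ if $o(e)\in D$; (o5) if $e\neq f$ and $o(e)=o(f)\in D$ then $e^*f=0$; (o6) if $u\in E^0\setminus D$ then $u=\sum\{ee^*: e\in o^{-1}(u)\}$. A $C^*$-algebra $A$ is called semiprojective if the following holds: whenever $B$ is a $C^*$-algebra containing a family $\mathcal{L}$ of (closed two-sided) ideals, directed by inclusion, $I=\overline{\bigcup\mathcal{L}}$, and $B/I$ is isomorphic to $A$ (identify $B/I$ with $A$), there are $J\in\mathcal{L}$ and a $*$-homomorphism $\psi:A\to B/J$ with $\pi\circ\psi=\mathrm{id}_A$,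 where $\pi:B/J\to B/I=A$ is the quotient map. *)

(* Defs.v *)
From HB Require Import structures.
From mathcomp Require Import all_boot all_order all_algebra.
From mathcomp Require Import ssrAC generic_quotient complex.
From mathcomp Require Import all_classical all_reals topology normedtype.

Set Implicit Arguments.
Unset Strict Implicit.
Unset Printing Implicit Defensive.

Import Order.TTheory GRing.Theory Num.Theory numFieldNormedType.Exports.

Local Open Scope classical_set_scope.
Local Open Scope ring_scope.
Local Open Scope complex_scope.
Local Open Scope quotient_scope.

(* Library rings are unital, so the product of a possibly non-unital
   C*-algebra is a separate operation [cmul].  The norm of a normed module over
   R[i] takes its values in the nonnegative reals of R[i]. *)
HB.mixin Record isCStarAlgebra (R : realType) A of CompleteNormedModule R[i] A := {
  cmul : A -> A -> A;
  cstar : A -> A;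
  cmulA : associative cmul;
  cmulDl : left_distributive cmul +%R;
  cmulDr : right_distributive cmul +%R;
  cmulZl : forall (c : R[i]) a b, cmul (c *: a) b = c *: cmul a b;
  cmulZr : forall (c : R[i]) a b, cmul a (c *: b) = c *: cmul a b;
  cstarK : involutive cstar;
  cstarD : {morph cstar : a b / a + b};
  cstarZ : forall (c : R[i]) a, cstar (c *: a) = c^* *: cstar a;
  cstarM : forall a b, cstar (cmul a b) = cmul (cstar b) (cstar a);
  cnormM : forall a b, `|cmul a b| <= `|a| * `|b|;
  cnorm_star : forall a, `|cmul (cstar a) a| = `|a| ^+ 2;
}.

#[short(type="cstarAlgType")]
HB.structure Definition CStarAlgebra (R : realType) :=
  { A of CompleteNormedModule R[i] A & isCStarAlgebra R A }.

Section CStarBasics.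
Variables (R : realType) (A : cstarAlgType R).
Implicit Types a b : A.

Lemma cmul0l b : cmul (0 : A) b = 0.
Proof. by have := cmulZl 0 (0 : A) b; rewrite !scale0r. Qed.

Lemma cmul0r a : cmul a (0 : A) = 0.
Proof. by have := cmulZr 0 a (0 : A); rewrite !scale0r. Qed.

Lemma cmulNl a b : cmul (- a) b = - cmul a b.
Proof. by rewrite -scaleN1r cmulZl scaleN1r. Qed.

Lemma cmulNr a b : cmul a (- b) = - cmul a b.
Proof. by rewrite -scaleN1r cmulZr scaleN1r. Qed.

Lemma cstar0 : cstar (0 : A) = 0.
Proof. by apply: (addrI (cstar (0 : A))); rewrite -cstarD !addr0. Qed.

Lemma cstarB a b : cstar (a - b) = cstar a - cstar b.
Proof. by apply: (addIr (cstar b)); rewrite -cstarD !subrK. Qed.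

Lemma cnorm_cstar a : `|cstar a| = `|a|.
Proof.
have le c : `|c : A| <= `|cstar c|.
  have [->|c0] := eqVneq c 0; first by rewrite cstar0.
  by rewrite -(ler_pM2r (_ : 0 < `|c|)) ?normr_gt0// -expr2 -cnorm_star cnormM.
by apply/eqP; rewrite eq_le le -{2}(cstarK a) le.
Qed.

Definition is_projection a := cstar a = a /\ cmul a a = a.

Definition is_partial_isometry a := cmul (cmul a (cstar a)) a = a.

Definition is_star_subalgebra (S : set A) :=
  [/\ S 0, forall (c : R[i]) a b, S a -> S b -> S (c *: a + b),
      forall a b, S a -> S b -> S (cmul a b) & forall a, S a -> S (cstar a)].

Definition generates (X : set A) :=
  forall S, is_star_subalgebra S -> closed S -> X `<=` S -> S = setT.

Definition is_closed_ideal (J : set A) :=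
  [/\ closed J, J 0, forall (c : R[i]) a b, J a -> J b -> J (c *: a + b),
      forall a b, J b -> J (cmul a b) & forall a b, J a -> J (cmul a b)].

Lemma cvg_cmul (T : Type) (F : set_system T) (FF : Filter F) (f g : T -> A) a b :
  f @ F --> a -> g @ F --> b -> (fun x => cmul (f x) (g x)) @ F --> cmul a b.
Proof.
move=> fa gb; apply/cvgrPdist_lt => e e0.
have b1 : 0 < `|b| + 1 by rewrite ltr_wpDl.
have a1 : 0 < `|a| + 1 by rewrite ltr_wpDl.
have e1 : 0 < e / 2 / (`|b| + 1) by rewrite !divr_gt0.
have e2 : 0 < e / 2 / (`|a| + 1) by rewrite !divr_gt0.
move/cvgrPdist_lt : (fa) => /(_ _ e1) Hf.
move/cvgrPdist_lt : (gb) => Hg.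
near=> x.
have -> : cmul a b - cmul (f x) (g x) =
    cmul (a - f x) (g x) + cmul a (b - g x).
  by rewrite cmulDl cmulDr cmulNl cmulNr [RHS]addrC addrA subrK.
have gx1 : `|g x| <= `|b| + 1.
  have : `|b - g x| < 1 by near: x; exact: Hg.
  move=> /ltW h; rewrite -(subKr b (g x)).
  by rewrite (le_trans (ler_normB _ _))// lerD2l.
have h1 : `|a - f x| < e / 2 / (`|b| + 1) by near: x.
have h2 : `|b - g x| < e / 2 / (`|a| + 1) by near: x; exact: Hg.
rewrite (le_lt_trans (ler_normD _ _))// [ltRHS](splitr e) ltr_leD//.
  rewrite (le_lt_trans (cnormM _ _))//.
  rewrite (@le_lt_trans _ _ (`|a - f x| * (`|b| + 1)))//.
    by rewrite ler_wpM2l.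
  by rewrite -ltr_pdivlMr.
rewrite (le_trans (cnormM _ _))//.
rewrite (@le_trans _ _ ((`|a| + 1) * `|b - g x|))//.
  by rewrite ler_wpM2r// lerDl.
by rewrite mulrC -ler_pdivlMr// ltW.
Unshelve. all: by end_near. Qed.

Lemma cvg_cstar (T : Type) (F : set_system T) (FF : Filter F) (f : T -> A) a :
  f @ F --> a -> (fun x => cstar (f x)) @ F --> cstar a.
Proof.
move=> /cvgrPdist_lt fa; apply/cvgrPdist_lt => e /fa; apply: filterS => x.
by rewrite -cstarB cnorm_cstar.
Qed.

End CStarBasics.

Definition is_star_hom (R : realType) (A B : cstarAlgType R) (f : A -> B) :=
  [/\ forall (c : R[i]) a b, f (c *: a + b) = c *: f a + f b,
      {morph f : a b / cmul a b} & {morph f : a / cstar a}].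

(* [q : B -> Q] exhibits the C*-algebra [Q] as the quotient [B/J]. *)
Definition is_quotient (R : realType) (B Q : cstarAlgType R) (J : set B)
    (q : B -> Q) :=
  [/\ is_star_hom q, set_surj setT setT q & q @^-1` [set 0] = J].

Definition directed (T : Type) (L : set (set T)) :=
  L !=set0 /\
  forall J1 J2, L J1 -> L J2 -> exists J3, [/\ L J3, J1 `<=` J3 & J2 `<=` J3].

Definition semiprojective (R : realType) (A : cstarAlgType R) :=
  forall (B : cstarAlgType R) (L : set (set B)),
    (forall J, L J -> is_closed_ideal J) -> directed L ->
  forall q : B -> A, is_quotient (closure (\bigcup_(J in L) J)) q ->
  exists J, L J /\
  exists (Q : cstarAlgType R) (qJ : B -> Q) (pi : Q -> A) (psi : A -> Q),
    [/\ is_quotient J qJ,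
        is_star_hom pi /\ (forall b, pi (qJ b) = q b),
        is_star_hom psi & forall a, pi (psi a) = a].

HB.mixin Record isStarRing S of GRing.NzRing S := {
  star : S -> S;
  starK : involutive star;
  starD : {morph star : x y / x + y};
  starM : forall x y, star (x * y) = star y * star x;
}.

#[short(type="starRingType")]
HB.structure Definition StarRing := { S of GRing.NzRing S & isStarRing S }.

HB.instance Definition _ (R : rcfType) := isStarRing.Build R[i]
  (@conjcK R) (fun x y => rmorphD (@conjc R) x y)
  (fun x y => etrans (rmorphM (@conjc R) x y) (mulrC _ _)).

(* The unitization is always A + C, with a new unit adjoined even when A already
   has one.  The product topology is the topology of its C*-norm. *)
Definition unitization (R : realType) (A : cstarAlgType R) : Type :=
  (A * (R[i] : numFieldType))%type.

Section Unitization.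
Variables (R : realType) (A : cstarAlgType R).
Local Notation U := (unitization A).

HB.instance Definition _ := GRing.Zmodule.copy U (A * (R[i] : numFieldType))%type.
HB.instance Definition _ :=
  Topological.copy U (A * (R[i] : numFieldType))%type.

Definition umul (x y : U) : U :=
  (cmul x.1 y.1 + (x.2 *: y.1 + y.2 *: x.1), x.2 * y.2).

Definition uone : U := (0, 1).

Definition ustar (x : U) : U := (cstar x.1, x.2^*).

Fact umulA : associative umul.
Proof.
move=> [a x] [b y] [c z]; congr pair; rewrite /= ?mulrA//.
rewrite !cmulDl !cmulDr !cmulZl !cmulZr cmulA !scalerDr !scalerA !addrA.
by rewrite (mulrC z x) (mulrC z y) [RHS](ACl (1*3*5*2*4*6*7))%AC.
Qed.

Fact umul1x : left_id uone umul.
Proof.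
by move=> [a x]; congr pair; rewrite /= ?mul1r// cmul0l scale1r scaler0 add0r addr0.
Qed.

Fact umulx1 : right_id uone umul.
Proof.
by move=> [a x]; congr pair; rewrite /= ?mulr1// cmul0r scale1r scaler0 !add0r.
Qed.

Fact umulDl : left_distributive umul +%R.
Proof.
move=> [a x] [b y] [c z]; congr pair; rewrite /= ?mulrDl//.
by rewrite cmulDl scalerDl scalerDr !addrA [LHS](ACl (1*3*5*2*4*6))%AC.
Qed.

Fact umulDr : right_distributive umul +%R.
Proof.
move=> [a x] [b y] [c z]; congr pair; rewrite /= ?mulrDr//.
by rewrite cmulDr scalerDl scalerDr !addrA [LHS](ACl (1*3*5*2*4*6))%AC.
Qed.

Fact uone_neq0 : uone != 0.
Proof. by apply/negP => /eqP[]/eqP; rewrite oner_eq0. Qed.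

HB.instance Definition _ := GRing.Zmodule_isNzRing.Build U
  umulA umul1x umulx1 umulDl umulDr uone_neq0.

Fact ustarK : involutive ustar.
Proof. by move=> [a x]; rewrite /ustar /= cstarK conjcK. Qed.

Fact ustarD : {morph ustar : x y / x + y}.
Proof. by move=> [a x] [b y]; congr pair; rewrite /= ?cstarD// rmorphD. Qed.

Fact ustarM (x y : U) : ustar (x * y) = ustar y * ustar x.
Proof.
case: x y => [a x] [b y]; congr pair => /=; last first.
  by rewrite mulrC; exact: (rmorphM (@conjc R)).
by rewrite !cstarD !cstarZ cstarM (addrC (_ *: cstar b)).
Qed.

HB.instance Definition _ := isStarRing.Build U ustarK ustarD ustarM.

Definition scalar_part (x : U) : R[i] := x.2.

Fact scalar_part_zmod : zmod_morphism scalar_part.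
Proof. by []. Qed.

Fact scalar_part_monoid : monoid_morphism scalar_part.
Proof. by []. Qed.

HB.instance Definition _ :=
  GRing.isZmodMorphism.Build U R[i] scalar_part scalar_part_zmod.
HB.instance Definition _ :=
  GRing.isMonoidMorphism.Build U R[i] scalar_part scalar_part_monoid.

Fact scalar_part_star (x : U) : scalar_part (star x) = star (scalar_part x).
Proof. by []. Qed.

End Unitization.

Section Adjoint.
Variable S : starRingType.

Lemma star0 : star (0 : S) = 0.
Proof. by apply: (addrI (star (0 : S))); rewrite -starD !addr0. Qed.

Lemma star1 : star (1 : S) = 1.
Proof. by rewrite -[LHS]mul1r -{1}(starK (1 : S)) -starM mul1r starK. Qed.

Definition adjmx m n (M : 'M[S]_(m, n)) : 'M[S]_(n, m) := map_mx (@star S) M^T.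

Lemma adjmxK m n (M : 'M[S]_(m, n)) : adjmx (adjmx M) = M.
Proof. by apply/matrixP => i j; rewrite !mxE starK. Qed.

Lemma adjmxM m n k (M : 'M[S]_(m, n)) (N : 'M[S]_(n, k)) :
  adjmx (M *m N) = adjmx N *m adjmx M.
Proof.
apply/matrixP => i j; rewrite !mxE.
rewrite (big_morph (@star S) (@starD S) star0).
by apply: eq_bigr => l _; rewrite !mxE starM.
Qed.

Lemma adjmx0 m n : adjmx (0 : 'M_(m, n)) = 0.
Proof. by apply/matrixP => i j; rewrite !mxE star0. Qed.

Lemma adjmx1 n : adjmx (1%:M : 'M_n) = 1%:M.
Proof.
by apply/matrixP => i j; rewrite !mxE eq_sym; case: eqP; rewrite (star0, star1).
Qed.

Lemma adjmx_block m1 m2 n1 n2 (a : 'M_(m1, n1)) (b : 'M_(m1, n2))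
    (c : 'M_(m2, n1)) (d : 'M_(m2, n2)) :
  adjmx (block_mx a b c d) =
  block_mx (adjmx a) (adjmx c) (adjmx b) (adjmx d).
Proof. by rewrite /adjmx tr_block_mx map_block_mx. Qed.

Definition is_projmx n (p : 'M[S]_n) := adjmx p = p /\ p *m p = p.

(* Murray-von Neumann equivalence; a rectangular [v] lets the sizes differ. *)
Definition mvn m n (p : 'M[S]_m) (q : 'M[S]_n) :=
  exists v : 'M[S]_(m, n), v *m adjmx v = p /\ adjmx v *m v = q.

Lemma mvn_refl n (p : 'M_n) : is_projmx p -> mvn p p.
Proof. by move=> [ps pp]; exists p; rewrite ps. Qed.

Lemma mvn_sym m n (p : 'M_m) (q : 'M_n) : mvn p q -> mvn q p.
Proof. by move=> [v [vp vq]]; exists (adjmx v); rewrite adjmxK. Qed.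

Lemma mvn_trans m n k (p : 'M_m) (q : 'M_n) (r : 'M_k) :
  is_projmx p -> is_projmx r -> mvn p q -> mvn q r -> mvn p r.
Proof.
move=> [_ pp] [_ rr] [v [vp vq]] [w [wq wr]]; exists (v *m w); rewrite adjmxM.
split.
  by rewrite -mulmxA (mulmxA w) wq -vq -mulmxA (mulmxA v) !vp pp.
by rewrite -mulmxA (mulmxA (adjmx v)) vq -wq -mulmxA (mulmxA (adjmx w)) !wr rr.
Qed.

Definition dsum m n (p : 'M[S]_m) (q : 'M[S]_n) : 'M_(m + n) :=
  block_mx p 0 0 q.

Lemma dsum_proj m n (p : 'M_m) (q : 'M_n) :
  is_projmx p -> is_projmx q -> is_projmx (dsum p q).
Proof.
move=> [ps pp] [qs qq]; split; rewrite /dsum.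
  by rewrite adjmx_block ps qs !adjmx0.
by rewrite mulmx_block pp qq !mulmx0 !mul0mx !addr0 !add0r.
Qed.

Lemma dsum_mvn m n m' n' (p : 'M_m) (q : 'M_n) (p' : 'M_m') (q' : 'M_n') :
  mvn p p' -> mvn q q' -> mvn (dsum p q) (dsum p' q').
Proof.
move=> [v [vp vp']] [w [wq wq']]; exists (block_mx v 0 0 w).
by rewrite adjmx_block !adjmx0 !mulmx_block vp vp' wq wq' !mulmx0 !mul0mx
  !addr0 !add0r.
Qed.

Lemma dsumC m n (p : 'M_m) (q : 'M_n) :
  is_projmx p -> is_projmx q -> mvn (dsum p q) (dsum q p).
Proof.
move=> [ps pp] [qs qq]; exists (block_mx 0 p q 0).
by rewrite adjmx_block !adjmx0 ps qs !mulmx_block pp qq !mulmx0 !mul0mx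
  !addr0 !add0r.
Qed.

Lemma mvn_cast m n (e : m = n) (p : 'M_m) :
  is_projmx p -> mvn p (castmx (e, e) p).
Proof. by case: n / e => hp; rewrite castmx_id; exact: mvn_refl. Qed.

Lemma dsumA m n k (p : 'M_m) (q : 'M_n) (r : 'M_k) :
  is_projmx p -> is_projmx q -> is_projmx r ->
  mvn (dsum p (dsum q r)) (dsum (dsum p q) r).
Proof.
move=> hp hq hr.
have -> : dsum (dsum p q) r = castmx (addnA m n k, addnA m n k) (dsum p (dsum q r)).
  have /= := @block_mxA _ _ _ _ _ _ _ p 0 0 0 q 0 0 0 r.
  rewrite !row_mx0 !col_mx0 /dsum => ->.
  by rewrite castmx_comp castmx_id.
by apply: mvn_cast; do !apply: dsum_proj.
Qed.

Lemma dsum0 n (p : 'M_n) :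
  is_projmx p -> mvn (dsum (0 : 'M_0) p) p.
Proof.
move=> [ps pp]; exists (col_mx 0 p); rewrite /adjmx tr_col_mx map_row_mx.
rewrite mul_col_row mul_row_col -/(adjmx p) -/(adjmx 0) adjmx0 ps pp.
by rewrite !mulmx0 !mul0mx add0r.
Qed.

Lemma proj0 n : is_projmx (0 : 'M_n).
Proof. by split; rewrite (adjmx0, mulmx0). Qed.

Record proj := Proj {
  proj_size : nat;
  proj_mx :> 'M[S]_proj_size;
  projP : is_projmx proj_mx
}.

HB.instance Definition _ := gen_eqMixin proj.
HB.instance Definition _ := gen_choiceMixin proj.

Definition mvnb (p q : proj) : bool := `[< mvn p q >].

Fact mvnb_equiv : equiv_class_of mvnb.
Proof.
split=> [p|p q|q p r].
- by apply/asboolP/mvn_refl/projP.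
- by apply/asboolP/asboolP; exact: mvn_sym.
- by move=> /asboolP pq /asboolP qr; apply/asboolP;
    apply: mvn_trans pq qr; exact: projP.
Qed.

Canonical mvn_equiv := EquivRelPack mvnb_equiv.

Definition mvnClass := {eq_quot mvnb}.

HB.instance Definition _ := Choice.on mvnClass.
HB.instance Definition _ := EqQuotient.on mvnClass.

Lemma mvnClassP (p q : proj) : reflect (mvn p q) (\pi_mvnClass p == \pi_mvnClass q).
Proof. by rewrite eqmodE; exact: asboolP. Qed.

Definition proj_sum (p q : proj) := Proj (dsum_proj (projP p) (projP q)).
Definition mvn0 : mvnClass := \pi_mvnClass (Proj (proj0 0)).
Definition mvnD (x y : mvnClass) : mvnClass := \pi_mvnClass (proj_sum (repr x) (repr y)).

Lemma repr_mvn (p : proj) : mvn (repr (\pi_mvnClass p)) p.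
Proof. by apply/mvnClassP; rewrite reprK. Qed.

Lemma mvnDE (p q : proj) : mvnD (\pi_mvnClass p) (\pi_mvnClass q) = \pi_mvnClass (proj_sum p q).
Proof. by apply/eqP/mvnClassP; apply: dsum_mvn; exact: repr_mvn. Qed.

Fact mvnDA : associative mvnD.
Proof.
move=> x y z; elim/quotW: x => x; elim/quotW: y => y; elim/quotW: z => z; rewrite (mvnDE y z) mvnDE (mvnDE x y) mvnDE.
by apply/eqP/mvnClassP; apply: dsumA; exact: projP.
Qed.

Fact mvnDC : commutative mvnD.
Proof.
move=> x y; elim/quotW: x => x; elim/quotW: y => y; rewrite !mvnDE.
by apply/eqP/mvnClassP; apply: dsumC; exact: projP.
Qed.

Fact mvn0D : left_id mvn0 mvnD.
Proof.
move=> x; elim/quotW: x => x; rewrite mvnDE.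
by apply/eqP/mvnClassP; apply: dsum0; exact: projP.
Qed.

HB.instance Definition _ := GRing.isNmodule.Build mvnClass mvnDA mvnDC mvn0D.

Lemma pi_mvnD (p q : proj) :
  \pi_mvnClass p + \pi_mvnClass q = \pi_mvnClass (proj_sum p q).
Proof. exact: mvnDE. Qed.

End Adjoint.

Section Grothendieck.
Variable M : nmodType.

Definition groth_rel (x y : M * M) : bool :=
  `[< exists k, x.1 + y.2 + k = y.1 + x.2 + k >].

Fact groth_equiv_class : equiv_class_of groth_rel.
Proof.
split=> [x|x y|y x z].
- by apply/asboolP; exists 0.
- by apply/asboolP/asboolP => -[k e]; exists k.
- move=> /asboolP[k e] /asboolP[l f]; apply/asboolP; exists (y.1 + y.2 + k + l).
  transitivity ((x.1 + y.2 + k) + (y.1 + z.2 + l)).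
    by rewrite !addrA [LHS](ACl (1*4*5*3*2*6))%AC.
  by rewrite e f !addrA [LHS](ACl (4*2*1*5*3*6))%AC.
Qed.

Canonical groth_equiv := EquivRelPack groth_equiv_class.

Definition grothendieck := {eq_quot groth_rel}.

HB.instance Definition _ := Choice.on grothendieck.
HB.instance Definition _ := EqQuotient.on grothendieck.

Lemma grothP (x y : M * M) :
  reflect (exists k, x.1 + y.2 + k = y.1 + x.2 + k)
          (\pi_grothendieck x == \pi_grothendieck y).
Proof. by rewrite eqmodE; exact: asboolP. Qed.

Definition groth0 : grothendieck := \pi_grothendieck (0, 0).
Definition grothN (x : grothendieck) : grothendieck :=
  \pi_grothendieck ((repr x).2, (repr x).1).
Definition grothD (x y : grothendieck) : grothendieck :=
  \pi_grothendieck ((repr x).1 + (repr y).1, (repr x).2 + (repr y).2).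

Lemma repr_groth (x : M * M) : exists k,
  (repr (\pi_grothendieck x)).1 + x.2 + k =
  x.1 + (repr (\pi_grothendieck x)).2 + k.
Proof. by apply/grothP; rewrite reprK. Qed.

Lemma grothDE (x y : M * M) :
  grothD (\pi_grothendieck x) (\pi_grothendieck y) = \pi_grothendieck (x.1 + y.1, x.2 + y.2).
Proof.
apply/eqP/grothP => /=; have [k e] := repr_groth x; have [l f] := repr_groth y.
exists (k + l); move: e f; set x' := repr _; set y' := repr _ => e f.
transitivity ((x'.1 + x.2 + k) + (y'.1 + y.2 + l)).
  by rewrite !addrA [LHS](ACl (1*3*5*2*4*6))%AC.
by rewrite e f !addrA [LHS](ACl (1*4*2*5*3*6))%AC.
Qed.

Lemma grothNE (x : M * M) : grothN (\pi_grothendieck x) = \pi_grothendieck (x.2, x.1).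
Proof.
apply/eqP/grothP => /=; have [k e] := repr_groth x; exists k.
by rewrite (addrC _ x.1) -e (addrC x.2).
Qed.

Fact grothDA : associative grothD.
Proof.
by move=> x y z; elim/quotW: x => x; elim/quotW: y => y; elim/quotW: z => z; rewrite (grothDE y z) grothDE (grothDE x y) grothDE /= !addrA.
Qed.

Fact grothDC : commutative grothD.
Proof.
move=> x y; elim/quotW: x => x; elim/quotW: y => y; rewrite !grothDE.
by rewrite (addrC x.1) (addrC x.2).
Qed.

Fact groth0D : left_id groth0 grothD.
Proof. by move=> x; elim/quotW: x => x; rewrite grothDE /= !add0r; case: x. Qed.

Fact grothND : left_inverse groth0 grothN grothD.
Proof.
move=> x; elim/quotW: x => x; rewrite grothNE grothDE.
by apply/eqP/grothP; exists 0; rewrite /= !addr0 add0r addrC.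
Qed.

HB.instance Definition _ :=
  GRing.isZmodule.Build grothendieck grothDA grothDC groth0D grothND.

Lemma pi_grothB (x y : M * M) :
  \pi_grothendieck x - \pi_grothendieck y =
  \pi_grothendieck (x.1 + y.2, x.2 + y.1).
Proof. by rewrite [LHS](congr1 (grothD _) (grothNE y)) grothDE. Qed.

End Grothendieck.

Definition K00 (S : starRingType) : zmodType := grothendieck (mvnClass S).

Definition K00_class (S : starRingType) n (p : 'M[S]_n) (hp : is_projmx p) : K00 S :=
  \pi_(grothendieck (mvnClass S)) (\pi_(mvnClass S) (Proj hp), 0).

Section K00Functor.
Variables (S T : starRingType) (f : {rmorphism S -> T}).
Hypothesis f_star : forall x, f (star x) = star (f x).

Lemma map_adjmx m n (M : 'M[S]_(m, n)) : map_mx f (adjmx M) = adjmx (map_mx f M).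
Proof. by apply/matrixP => i j; rewrite !mxE f_star. Qed.

Lemma map_is_projmx n (p : 'M[S]_n) : is_projmx p -> is_projmx (map_mx f p).
Proof. by move=> [ps pp]; split; rewrite -?map_adjmx ?ps// -map_mxM pp. Qed.

Definition map_proj (p : proj S) : proj T := Proj (map_is_projmx (projP p)).

Definition mvn_map (x : mvnClass S) : mvnClass T := \pi_(mvnClass T) (map_proj (repr x)).

Definition K00_map (x : K00 S) : K00 T :=
  \pi_(grothendieck (mvnClass T)) (mvn_map (repr x).1, mvn_map (repr x).2).

Lemma mvn_mapE (p : proj S) : mvn_map (\pi_(mvnClass S) p) = \pi_(mvnClass T) (map_proj p).
Proof.
apply/eqP/mvnClassP; have [v [vp vq]] := repr_mvn p.
by exists (map_mx f v); rewrite -map_adjmx -!map_mxM vp vq.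
Qed.

Lemma mvn_mapD : {morph mvn_map : x y / x + y}.
Proof.
move=> x y; elim/quotW: x => x; elim/quotW: y => y; rewrite pi_mvnD !mvn_mapE pi_mvnD.
apply/eqP/mvnClassP => /=; rewrite /dsum map_block_mx !map_mx0.
by apply: mvn_refl; apply: dsum_proj; apply: map_is_projmx; exact: projP.
Qed.

Lemma K00_mapE (x : mvnClass S * mvnClass S) :
  K00_map (\pi_(grothendieck (mvnClass S)) x) =
  \pi_(grothendieck (mvnClass T)) (mvn_map x.1, mvn_map x.2).
Proof.
apply/eqP/grothP => /=; have [k e] := repr_groth x.
by exists (mvn_map k); rewrite -!mvn_mapD e.
Qed.

Lemma mvn_map0 : mvn_map 0 = 0.
Proof.
rewrite mvn_mapE; apply/eqP/mvnClassP => /=; rewrite map_mx0.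
by apply: mvn_refl; exact: proj0.
Qed.

Fact K00_map_zmod : zmod_morphism K00_map.
Proof.
move=> x y; elim/quotW: x => x; elim/quotW: y => y; rewrite pi_grothB !K00_mapE pi_grothB.
by rewrite !mvn_mapD.
Qed.

End K00Functor.

Section K0.
Variables (R : realType) (A : cstarAlgType R).

Definition K00_scalar : K00 (unitization A) -> K00 R[i] :=
  K00_map (@scalar_part_star R A).

Definition K0_pred : {pred K00 (unitization A)} :=
  fun x => K00_scalar x == 0.

Fact K0_pred_closed : zmod_closed K0_pred.
Proof.
have KB : zmod_morphism K00_scalar := K00_map_zmod _.
have K0 : K00_scalar 0 = 0 by rewrite -(subrr 0) KB subrr.
split=> [|x y]; rewrite /K0_pred !unfold_in ?K0 ?eqxx// => /eqP x0 /eqP y0.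
by rewrite KB x0 y0 subr0.
Qed.

HB.instance Definition _ :=
  GRing.isZmodClosed.Build (K00 (unitization A)) K0_pred K0_pred_closed.

(* The kernel of K_00 of the unitization -> K_00 of the complex numbers. *)
Record K0 := MkK0 { K0_val :> K00 (unitization A); _ : K0_val \in K0_pred }.

HB.instance Definition _ := [isSub for K0_val].
HB.instance Definition _ := [Choice of K0 by <:].
HB.instance Definition _ := [SubChoice_isSubZmodule of K0 by <:].

Lemma is_projmx_unitization (p : A) :
  is_projection p -> is_projmx (((p, 0) : unitization A)%:M : 'M_1).
Proof.
move=> [ps pp]; split.
  apply/matrixP => i j; rewrite !mxE !ord1 /= !mulr1n.
  by congr pair => /=; [exact: ps | exact: conjc0].
rewrite -scalar_mxM; congr (_%:M); congr pair; rewrite /= ?mul0r//.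
by rewrite pp !scale0r !addr0.
Qed.

Fact K0_class_subproof (p : A) (hp : is_projection p) :
  K00_class (is_projmx_unitization hp) \in K0_pred.
Proof.
rewrite unfold_in /K0_pred /K00_scalar /K00_class K00_mapE; apply/eqP/eqP/grothP.
exists 0 => /=; rewrite !addr0 add0r mvn_map0 mvn_mapE.
apply/eqP/mvnClassP => /=; exists 0.
rewrite adjmx0 mulmx0 mul0mx; split=> //.
by apply/matrixP => i j; rewrite !mxE !ord1 eqxx mulr1n.
Qed.

Definition K0_class (p : A) (hp : is_projection p) : K0 :=
  MkK0 (K0_class_subproof hp).

End K0.

Definition zmod_finitely_generated (G : zmodType) :=
  exists s : seq G, forall x : G, exists c : nat -> int,
    x = \sum_(i < size s) s`_i *~ c i.

Section StablePadding.
Variable S : starRingType.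

Definition is_unitary n (u : 'M[S]_n) :=
  adjmx u *m u = 1%:M /\ u *m adjmx u = 1%:M.

(* For n <= k, [pad k u] is the k x k matrix u (+) 1. *)
Definition pad k n (u : 'M[S]_n) : 'M[S]_k :=
  \matrix_(i, j)
    if (insub (val i) : option 'I_n, insub (val j) : option 'I_n) is
      (Some i', Some j') then u i' j' else (i == j)%:R.

Lemma padE d n (u : 'M_n) : pad (n + d) u = block_mx u 0 0 (1%:M : 'M_d).
Proof.
apply/matrixP => i j; rewrite !mxE -(inj_eq val_inj) /=.
case: splitP => i' -> ; rewrite !mxE; case: splitP => j' ->; rewrite ?mxE.
- by rewrite !valK.
- by rewrite valK insubF ?ltnNge ?leq_addr// ltn_eqF// ltn_addr.
- by rewrite insubF ?ltnNge ?leq_addr// gtn_eqF// ltn_addr.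
- by rewrite insubF ?ltnNge ?leq_addr// eqn_add2l.
Qed.

Lemma pad_id n (u : 'M_n) : pad n u = u.
Proof. by apply/matrixP => i j; rewrite !mxE !valK. Qed.

Lemma pad_pad n k l (u : 'M_n) : (n <= k)%N -> pad l (pad k u) = pad l u.
Proof.
move=> nk; apply/matrixP => i j; rewrite !mxE.
have out (x : 'I_l) : (k <= x)%N -> insub (val x) = None :> option 'I_n.
  by move=> /(leq_trans nk) h; rewrite insubF//= ltnNge h.
case: (insubP 'I_k (val i)) => [i' _ /= ei|]; last first.
  by rewrite -leqNgt => /out ->.
case: (insubP 'I_k (val j)) => [j' _ /= ej|]; last first.
  by rewrite -leqNgt => /out ->; case: insub.
by rewrite !mxE /= ei ej -(inj_eq val_inj i' j') /= ei ej.
Qed.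

Lemma padM n k (u v : 'M_n) : (n <= k)%N -> pad k (u *m v) = pad k u *m pad k v.
Proof.
move=> /subnKC <-; rewrite !padE mulmx_block.
by rewrite !mulmx0 !mul0mx mulmx1 !addr0 add0r.
Qed.

Lemma pad1 n k : (n <= k)%N -> pad k (1%:M : 'M_n) = 1%:M.
Proof. by move=> /subnKC <-; rewrite padE -scalar_mx_block. Qed.

Lemma pad_adj n k (u : 'M_n) : (n <= k)%N -> pad k (adjmx u) = adjmx (pad k u).
Proof. by move=> /subnKC <-; rewrite !padE adjmx_block !adjmx0 adjmx1. Qed.

Lemma unitary_pad n k (u : 'M_n) :
  (n <= k)%N -> is_unitary u -> is_unitary (pad k u).
Proof.
by move=> nk [uu uu']; split; rewrite -pad_adj// -padM// (uu, uu') pad1.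
Qed.

Lemma unitary_mul n (u v : 'M_n) :
  is_unitary u -> is_unitary v -> is_unitary (u *m v).
Proof.
move=> [u1 u2] [v1 v2]; split; rewrite adjmxM.
  by rewrite -mulmxA (mulmxA (adjmx u)) u1 mul1mx.
by rewrite -mulmxA (mulmxA v) v2 mul1mx.
Qed.

Lemma unitary_adj n (u : 'M_n) : is_unitary u -> is_unitary (adjmx u).
Proof. by move=> [u1 u2]; split; rewrite adjmxK. Qed.

Lemma unitary1 n : is_unitary (1%:M : 'M_n).
Proof. by split; rewrite adjmx1 mulmx1. Qed.

End StablePadding.

Section K1.
Variables (R : realType) (A : cstarAlgType R).
Local Notation U := (unitization A).

Section Continuity.
Variable T : topologicalType.

Lemma continuousUP (f : T -> U) :
  continuous f <-> continuous (fun t => (f t).1) /\ continuous (fun t => (f t).2).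
Proof.
split=> [cf|[c1 c2] t].
  by split=> t; apply: cvg_comp (cf t) _; [exact: cvg_fst | exact: cvg_snd].
have := cvg_pair (c1 t) (c2 t).
by under eq_fun do rewrite -surjective_pairing; exact.
Qed.

Lemma continuousUM (f g : T -> U) :
  continuous f -> continuous g -> continuous (fun t => f t * g t).
Proof.
move=> /continuousUP[f1 f2] /continuousUP[g1 g2]; apply/continuousUP.
split=> t /=; last by apply: cvgM; [exact: f2 | exact: g2].
apply: cvgD; first by apply: cvg_cmul; [exact: f1 | exact: g1].
by apply: cvgD; apply: cvgZ; [exact: f2 | exact: g1 | exact: g2 | exact: f1].
Qed.

Lemma continuousUD (f g : T -> U) :
  continuous f -> continuous g -> continuous (fun t => f t + g t).
Proof.
move=> /continuousUP[f1 f2] /continuousUP[g1 g2]; apply/continuousUP.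
by split=> t /=; apply: cvgD; [exact: f1|exact: g1|exact: f2|exact: g2].
Qed.

Lemma continuousUstar (f : T -> U) :
  continuous f -> continuous (fun t => star (f t)).
Proof.
move=> /continuousUP[f1 f2]; apply/continuousUP; split=> t /=.
  by apply: cvg_cstar; exact: f1.
apply/cvgrPdist_lt => e e0; have /cvgrPdist_lt/(_ _ e0) := f2 t.
by apply: filterS => x; rewrite -[_^* - _](rmorphB (@conjc R)) normcJ.
Qed.

End Continuity.

Section MatrixContinuity.
Variable T : topologicalType.

Definition mx_continuous m n (h : T -> 'M[U]_(m, n)) :=
  forall i j, continuous (fun t => h t i j).

Lemma mx_continuousM m n k (h : T -> 'M[U]_(m, n)) (g : T -> 'M[U]_(n, k)) :
  mx_continuous h -> mx_continuous g -> mx_continuous (fun t => h t *m g t).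
Proof.
move=> ch cg i j.
have -> : (fun t => (h t *m g t) i j) = (fun t => \sum_l h t i l * g t l j).
  by apply/funext => t; rewrite mxE.
move=> t; apply: cvg_big => [|l _]; last first.
  exact: (continuousUM (ch i l) (cg l j)).
by apply: (@continuousUD (U * U)%type) => x; [exact: cvg_fst | exact: cvg_snd].
Qed.

Lemma mx_continuous_adj m n (h : T -> 'M[U]_(m, n)) :
  mx_continuous h -> mx_continuous (fun t => adjmx (h t)).
Proof.
move=> ch i j.
have -> : (fun t => adjmx (h t) i j) = (fun t => star (h t j i)).
  by apply/funext => t; rewrite !mxE.
exact: continuousUstar.
Qed.

Lemma mx_continuous_cst m n (u : 'M[U]_(m, n)) : mx_continuous (fun=> u).
Proof. by move=> i j t; exact: cvg_cst. Qed.

Lemma mx_continuous_pad n k (h : T -> 'M[U]_n) :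
  mx_continuous h -> mx_continuous (fun t => pad k (h t)).
Proof.
move=> ch i j.
have -> : (fun t => pad k (h t) i j) = (fun t =>
    if (insub (val i) : option 'I_n, insub (val j) : option 'I_n) is
      (Some i', Some j') then h t i' j' else (i == j)%:R).
  by apply/funext => t; rewrite mxE.
case: (insub (val i) : option 'I_n) => [i'|]; last by move=> t; exact: cvg_cst.
case: (insub (val j) : option 'I_n) => [j'|]; last by move=> t; exact: cvg_cst.
exact: ch.
Qed.

End MatrixContinuity.

Definition unit_itv : set R := `[0, 1].

(* u and v lie in the same path component of the unitary group. *)
Definition homotopic n (u v : 'M[U]_n) :=
  exists h : R -> 'M[U]_n,
    [/\ @mx_continuous (subspace unit_itv) n n h,
        forall t, unit_itv t -> is_unitary (h t), h 0 = u & h 1 = v].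

Let itv0 : unit_itv 0. Proof. by rewrite /unit_itv /= in_itv /= lexx ler01. Qed.
Let itv1 : unit_itv 1. Proof. by rewrite /unit_itv /= in_itv /= lexx ler01. Qed.

Lemma homotopic_refl n (u : 'M_n) : is_unitary u -> homotopic u u.
Proof. by exists (fun=> u); split=> //; exact: mx_continuous_cst. Qed.

Lemma homotopic_adj n (u v : 'M_n) :
  homotopic u v -> homotopic (adjmx u) (adjmx v).
Proof.
move=> [h [hc hu <- <-]]; exists (fun t => adjmx (h t)); split; [exact: mx_continuous_adj hc| |reflexivity|reflexivity].
by move=> t /hu; exact: unitary_adj.
Qed.

Lemma homotopic_mul n (u v u' v' : 'M_n) :
  homotopic u v -> homotopic u' v' -> homotopic (u *m u') (v *m v').
Proof.
move=> [h [hc hu <- <-]] [g [gc gu <- <-]].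
exists (fun t => h t *m g t); split; [exact: mx_continuousM hc gc| |reflexivity|reflexivity].
by move=> t ti; apply: unitary_mul; [exact: hu | exact: gu].
Qed.

Lemma homotopic_pad n k (u v : 'M_n) :
  (n <= k)%N -> homotopic u v -> homotopic (pad k u) (pad k v).
Proof.
move=> nk [h [hc hu <- <-]]; exists (fun t => pad k (h t)); split; [exact: mx_continuous_pad hc| |reflexivity|reflexivity].
by move=> t /hu; exact: unitary_pad.
Qed.

Lemma homotopic_unitary n (u v : 'M_n) :
  homotopic u v -> is_unitary u /\ is_unitary v.
Proof. by move=> [h [_ hu <- <-]]; split; apply: hu. Qed.

Lemma homotopic_trans n (u v w : 'M_n) :
  homotopic u v -> homotopic v w -> homotopic u w.
Proof.
move=> uv vw; have [_ hv] := homotopic_unitary uv.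
have := homotopic_mul (homotopic_mul uv (homotopic_refl (unitary_adj hv))) vw.
by case: hv => v1 v2; rewrite -!mulmxA v1 mulmx1 mulmxA v2 mul1mx.
Qed.

Lemma homotopic_sym n (u v : 'M_n) : homotopic u v -> homotopic v u.
Proof.
move=> uv; have [hu hv] := homotopic_unitary uv.
have := homotopic_mul (homotopic_mul (homotopic_refl hu) (homotopic_adj uv))
  (homotopic_refl hv).
case: hu hv => u1 u2 [v1 v2].
by rewrite u2 mul1mx -mulmxA v1 mulmx1.
Qed.

Record unitary := Unitary {
  unitary_size : nat;
  unitary_mx :> 'M[U]_unitary_size;
  unitaryP : is_unitary unitary_mx
}.

HB.instance Definition _ := gen_eqMixin unitary.
HB.instance Definition _ := gen_choiceMixin unitary.

Definition stably_homotopic (u v : unitary) : bool :=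
  `[< exists k, [/\ (unitary_size u <= k)%N, (unitary_size v <= k)%N &
        homotopic (pad k u) (pad k v)] >].

Fact stably_homotopic_equiv : equiv_class_of stably_homotopic.
Proof.
split=> [u|u v|v u w].
- apply/asboolP; exists (unitary_size u); rewrite leqnn; split=> //.
  by apply: homotopic_refl; apply: unitary_pad => //; exact: unitaryP.
- by apply/asboolP/asboolP => -[k [? ? ?]]; exists k; split=> //;
    exact: homotopic_sym.
- move=> /asboolP[k [uk vk uv]] /asboolP[l [vl wl vw]].
  apply/asboolP; exists (maxn k l).
  have kk := leq_maxl k l; have ll := leq_maxr k l.
  split; [exact: leq_trans uk kk | exact: leq_trans wl ll|].
  move: (homotopic_pad kk uv) (homotopic_pad ll vw); rewrite !pad_pad//.
  exact: homotopic_trans.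
Qed.

Canonical stably_homotopic_equivRel := EquivRelPack stably_homotopic_equiv.

(* The direct limit of the groups U_n / (path component of 1), with U_n the
   unitary group of the n x n matrices over the unitization of A. *)
Definition K1 := {eq_quot stably_homotopic}.

HB.instance Definition _ := Choice.on K1.
HB.instance Definition _ := EqQuotient.on K1.

Lemma K1P (u v : unitary) :
  reflect (exists k, [/\ (unitary_size u <= k)%N, (unitary_size v <= k)%N &
             homotopic (pad k u) (pad k v)])
          (\pi_K1 u == \pi_K1 v).
Proof. by rewrite eqmodE; exact: asboolP. Qed.

Definition unitary_prod (u v : unitary) : unitary :=
  Unitary (unitary_mul (unitary_pad (leq_maxl _ (unitary_size v)) (unitaryP u))
                       (unitary_pad (leq_maxr (unitary_size u) _) (unitaryP v))).

Definition K1_one : K1 := \pi_K1 (Unitary (unitary1 U 0)).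
Definition K1_inv (x : K1) : K1 :=
  \pi_K1 (Unitary (unitary_adj (unitaryP (repr x)))).
Definition K1_mul (x y : K1) : K1 := \pi_K1 (unitary_prod (repr x) (repr y)).

Lemma pad_prod k (u v : unitary) :
  (unitary_size u <= k)%N -> (unitary_size v <= k)%N ->
  pad k (unitary_prod u v) = pad k u *m pad k v.
Proof.
by move=> uk vk; rewrite padM ?pad_pad ?geq_max ?uk ?leq_maxl ?leq_maxr.
Qed.

Lemma K1_eq k (u v : unitary) :
  (unitary_size u <= k)%N -> (unitary_size v <= k)%N -> pad k u = pad k v ->
  \pi_K1 u = \pi_K1 v.
Proof.
move=> uk vk e; apply/eqP/K1P; exists k; split=> //; rewrite e.
by apply: homotopic_refl; apply: unitary_pad => //; exact: unitaryP.
Qed.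

Lemma repr_K1 (u : unitary) : exists k,
  [/\ (unitary_size (repr (\pi_K1 u)) <= k)%N, (unitary_size u <= k)%N &
      homotopic (pad k (repr (\pi_K1 u))) (pad k u)].
Proof. by apply/K1P; rewrite reprK. Qed.

Lemma K1_mulE (u v : unitary) :
  K1_mul (\pi_K1 u) (\pi_K1 v) = \pi_K1 (unitary_prod u v).
Proof.
apply/eqP/K1P; have [k [uk uk' hu]] := repr_K1 u.
have [l [vl vl' hv]] := repr_K1 v; exists (maxn k l).
have kk := leq_maxl k l; have ll := leq_maxr k l.
have uk2 := leq_trans uk kk; have uk2' := leq_trans uk' kk.
have vl2 := leq_trans vl ll; have vl2' := leq_trans vl' ll.
split; rewrite ?pad_prod//= ?geq_max ?uk2 ?uk2' ?vl2 ?vl2'//.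
by apply: homotopic_mul; [move: (homotopic_pad kk hu) | move: (homotopic_pad ll hv)];
  rewrite !pad_pad.
Qed.

Lemma K1_invE (u : unitary) :
  K1_inv (\pi_K1 u) = \pi_K1 (Unitary (unitary_adj (unitaryP u))).
Proof.
apply/eqP/K1P; have [k [uk uk' hu]] := repr_K1 u; exists k; split=> //=.
by rewrite !pad_adj//; exact: homotopic_adj.
Qed.

Fact K1_mulA : associative K1_mul.
Proof.
move=> x y z; elim/quotW: x => u; elim/quotW: y => v; elim/quotW: z => w.
rewrite (K1_mulE v w) K1_mulE (K1_mulE u v) K1_mulE.
pose k := maxn (unitary_size u) (maxn (unitary_size v) (unitary_size w)).
have uk : (unitary_size u <= k)%N by rewrite leq_maxl.
have vk : (unitary_size v <= k)%N by rewrite /k leq_max leq_maxl orbT.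
have wk : (unitary_size w <= k)%N by rewrite /k !leq_max leqnn !orbT.
clearbody k; apply: (@K1_eq k); [by rewrite /= !geq_max uk vk wk..|].
by rewrite !(@pad_prod k) ?mulmxA//= ?geq_max ?uk ?vk ?wk.
Qed.

Fact K1_mul1 : left_id K1_one K1_mul.
Proof.
move=> x; elim/quotW: x => u; rewrite K1_mulE.
apply: (@K1_eq (unitary_size u)); rewrite ?pad_prod//= ?max0n//.
by rewrite pad1// mul1mx.
Qed.

Fact K1_1mul : right_id K1_one K1_mul.
Proof.
move=> x; elim/quotW: x => u; rewrite K1_mulE.
apply: (@K1_eq (unitary_size u)); rewrite ?pad_prod//= ?maxn0//.
by rewrite pad1// mulmx1.
Qed.

Fact K1_mulV : left_inverse K1_one K1_inv K1_mul.
Proof.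
move=> x; elim/quotW: x => u; rewrite K1_invE K1_mulE.
apply: (@K1_eq (unitary_size u)); rewrite ?pad_prod//= ?maxnn//.
by rewrite !pad_id pad1//; case: (unitaryP u).
Qed.

Fact K1_mulgV : right_inverse K1_one K1_inv K1_mul.
Proof.
move=> x; elim/quotW: x => u; rewrite K1_invE K1_mulE.
apply: (@K1_eq (unitary_size u)); rewrite ?pad_prod//= ?maxnn//.
by rewrite !pad_id pad1//; case: (unitaryP u).
Qed.

HB.instance Definition _ := isGroup.Build K1
  K1_mulA K1_mul1 K1_1mul K1_mulV K1_mulgV.

End K1.

Definition group_finitely_generated (G : groupType) :=
  exists s : seq G, forall H : set G,
    H 1%g -> (forall x y, H x -> H y -> H (x * y)%g) ->
    (forall x, H x -> H (x^-1)%g) -> (forall x, x \in s -> H x) -> H = setT.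

Record digraph := Digraph {
  vertex : choiceType;
  edge : choiceType;
  origin : edge -> vertex;
  terminus : edge -> vertex
}.

Section Graphs.
Variable E : digraph.

Record subgraph := Subgraph {
  verts : set (vertex E);
  edges : set (edge E);
  origin_verts : forall e, edges e -> verts (origin e);
  terminus_verts : forall e, edges e -> verts (terminus e)
}.

Implicit Types F G : subgraph.

Definition infinite_digraph :=
  infinite_set [set: vertex E] \/ infinite_set [set: edge E].

Definition is_finite F := finite_set (verts F) /\ finite_set (edges F).

Definition is_sub F G := verts F `<=` verts G /\ edges F `<=` edges G.

Fixpoint walk F (u : vertex E) (es : seq (edge E)) (v : vertex E) : Prop :=
  if es is e :: es' then [/\ edges F e, origin e = u & walk F (terminus e) es' v]
  else u = v.

Definition irreducible F := forall u v, verts F u -> verts F v ->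
  exists2 es, es <> [::] & walk F u es v.

Definition is_cycle F := exists u es,
  [/\ es <> [::], walk F u es u, uniq [seq origin e | e <- es],
      edges F = [set e | e \in es] & verts F = [set origin e | e in edges F]].

Definition out_edges (u : vertex E) : set (edge E) := [set e | origin e = u].

Definition infinite_emitters : set (vertex E) :=
  [set u | infinite_set (out_edges u)].

Definition out_subgraph (u : vertex E) : subgraph :=
  @Subgraph ([set origin e | e in out_edges u] `|`
             [set terminus e | e in out_edges u]) (out_edges u)
    (fun e he => or_introl (ex_intro2 _ _ e he erefl))
    (fun e he => or_intror (ex_intro2 _ _ e he erefl)).

(* Only the values of [gv] and [ge] on [F] matter. *)
Definition is_graph_iso F G (gv : vertex E -> vertex E) (ge : edge E -> edge E) :=
  [/\ set_bij (verts F) (verts G) gv, set_bij (edges F) (edges G) ge,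
      forall e, edges F e -> origin (ge e) = gv (origin e) &
      forall e, edges F e -> terminus (ge e) = gv (terminus e)].

End Graphs.

Arguments infinite_emitters E : clear implicits.

Record graph_relations (R : realType) (E : digraph) (A : cstarAlgType R)
    (p : vertex E -> A) (s : edge E -> A) : Prop := GraphRelations {
  edge_partial_isometry : forall e, is_partial_isometry (s e);
  vertex_projection : forall u, is_projection (p u);
  vertex_orthogonal : forall u v, u <> v -> cmul (p u) (p v) = 0;
  edge_source : forall e, cmul (cstar (s e)) (s e) = p (terminus e);
  edge_range : forall e, infinite_emitters E (origin e) ->
    cmul (p (origin e)) (s e) = s e;
  edge_orthogonal : forall e f, e <> f -> origin e = origin f ->
    infinite_emitters E (origin e) -> cmul (cstar (s e)) (s f) = 0;
  vertex_sum : forall u, ~ infinite_emitters E u ->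
    p u = \sum_(e \in out_edges u) cmul (s e) (cstar (s e))
}.

(* O(E), specified by its universal property (hence up to isomorphism). *)
Record graph_algebra (R : realType) (E : digraph) := GraphAlgebra {
  graph_algebra_sort :> cstarAlgType R;
  vertex_elt : vertex E -> graph_algebra_sort;
  edge_elt : edge E -> graph_algebra_sort;
  graph_algebraP : graph_relations vertex_elt edge_elt;
  graph_algebra_generated : generates (range vertex_elt `|` range edge_elt);
  graph_algebra_universal :
    forall (B : cstarAlgType R) (q : vertex E -> B) (r : edge E -> B),
      graph_relations q r ->
      exists f : graph_algebra_sort -> B,
        [/\ is_star_hom f, forall u, f (vertex_elt u) = q u &
            forall e, f (edge_elt e) = r e]
}.

Definition vertex_class (R : realType) (E : digraph) (O : graph_algebra R E)
    (u : vertex E) : K0 O :=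
  K0_class (vertex_projection (graph_algebraP O) u).

(* Main.v *)
From HB Require Import structures.
Require Import Defs.
From mathcomp Require Import all_boot all_order all_algebra.
From mathcomp Require Import generic_quotient complex ring lra zify.
From mathcomp Require Import all_classical all_reals topology normedtype sequences.

(* Finitely many of the relations lift from O(E) to some B/J by perturbation: projections for
   the finite set V0 of base vertices (containing D), edges leaving V0 \ D, equivalences
   between base projections, unitaries representing generators of K_1, and a few spare
   isometries.  Everything else is lifted along the fixed surjection B/J -> O(E), where
   unitaries in the group [lam] generated by Cayley transforms of skew-adjoint elements lift
   for free.  First, a sequence of partial isometries with orthogonal ranges lifts as soon as
   one spare isometry does ([sequence_lift]): rotations in [lam] move the spare room along the
   sequence.  This produces projections for the vertices outside V0 and the edges leaving D.
   Secondly, modulo [lam], a unitary of a vertex corner may be transported along a loop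
   ([absorption]); so these unitaries are generated modulo [lam] by finitely many representing
   generators of K_1, and all of them lift.  By (b2) the edges leaving a vertex outside V0
   differ by such a unitary from a copy of the edges leaving a base vertex.  That equality of
   K_0-classes of vertices implies equivalence of the projections follows from absorbing the
   stabilization into the corner at a vertex. *)

Set Implicit Arguments.
Unset Strict Implicit.
Unset Printing Implicit Defensive.

Import Order.TTheory GRing.Theory Num.Theory numFieldNormedType.Exports.

Local Open Scope classical_set_scope.
Local Open Scope ring_scope.
Local Open Scope complex_scope.
Local Open Scope quotient_scope.

(** The ideal [J] is chosen once, by perturbation arguments that handle finitely many elements only,
    while the graph has infinitely many vertices or edges. So everything infinite has to lift at a
    fixed stage, where a unitary may have no unitary lift at all. Cayley transforms escape this
    because a skew-adjoint element always has a skew-adjoint lift. Two facts make that enough. By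
    (o6) and (b2) the projection of a vertex outside the base is equivalent to that of a base vertex
    ([emitter_isometry]), so the corners of all vertices are copies of finitely many. And an
    infinite emitter exists, so every vertex carries two incomparable loops, hence infinitely many
    isometries with orthogonal ranges into its corner. These absorb matrices of every size ([Phi])
    and the algebra itself ([rho]), which is how information on K_0 and K_1 reaches a single corner.
    The analysis avoids spectral theory: inverses and square roots are fixed points of contractions,
    and Cayley transforms replace exponentials. *)

Lemma ltr0c (R : realType) (k : R) : (0 < k%:C) = (0 < k).
Proof. by rewrite ltcE /= eqxx. Qed.

(** * Real-valued norms and convergence of geometric sequences *)

Section RealNorm.
Variables (R : realType) (V : normedModType R[i]).
Implicit Types x y : V.

(** Norms over [R[i]] take their values in [R[i]]; the real value makes [lra] and [nra]
    applicable. *)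
Definition nm x : R := complex.Re `|x|.

Lemma nmE x : `|x| = (nm x)%:C.
Proof.
rewrite /nm; have := normr_ge0 x; case: `|x| => a b.
by rewrite lecE /= => /andP[/eqP-> _].
Qed.

Lemma nm_ge0 x : 0 <= nm x.
Proof. by rewrite -ler0c -nmE. Qed.

Lemma nm0 : nm 0 = 0.
Proof. by rewrite /nm normr0. Qed.

Lemma nm0_eq0 x : nm x = 0 -> x = 0.
Proof. by move=> x0; apply/normr0_eq0; rewrite nmE x0. Qed.

Lemma nmD x y : nm (x + y) <= nm x + nm y.
Proof. by rewrite -lecR raddfD /= -!nmE ler_normD. Qed.

Lemma nmN x : nm (- x) = nm x.
Proof. by rewrite /nm normrN. Qed.

Lemma nmBC x y : nm (x - y) = nm (y - x).
Proof. by rewrite -nmN opprB. Qed.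

Lemma nmB x y : nm (x - y) <= nm x + nm y.
Proof. by rewrite -[leRHS](congr1 (fun t => nm x + t) (nmN y)) nmD. Qed.

Lemma nmZ (c : R[i]) x : nm (c *: x) = complex.Re `|c| * nm x.
Proof.
by rewrite {1}/nm normrZ nmE normc_def -(rmorphM (real_complex R)).
Qed.

Lemma nmZr (c : R) x : nm (c%:C *: x) = `|c| * nm x.
Proof. by rewrite nmZ normc_def /= expr0n addr0 sqrtr_sqr. Qed.

Lemma nm_eq0P x : (forall e, 0 < e -> nm x <= e) -> x = 0.
Proof.
move=> h; apply: nm0_eq0; apply/eqP; rewrite eq_le nm_ge0 andbT.
by apply/ler_addgt0Pr => e /h; rewrite add0r.
Qed.

Lemma nm_dist_tri z x y : nm (x - y) <= nm (x - z) + nm (z - y).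
Proof. by rewrite (le_trans _ (nmD _ _))// addrA subrK. Qed.

Lemma ler_nm_dist x y : nm x <= nm y + nm (x - y).
Proof. by rewrite (le_trans _ (nmD _ _))// addrC subrK. Qed.

Lemma nm_sum I (r : seq I) (F : I -> V) : nm (\sum_(i <- r) F i) <= \sum_(i <- r) nm (F i).
Proof.
elim: r => [|i r IH]; first by rewrite !big_nil nm0.
by rewrite !big_cons (le_trans (nmD _ _))// lerD2l.
Qed.

Lemma closed_nm (S : set V) x :
  closed S -> (forall e : R, 0 < e -> exists2 y, S y & nm (x - y) < e) -> S x.
Proof.
move=> cS h; apply: cS => B /nbhs_ballP[[e e'] /= he sB].
move: he; rewrite ltcE /= => /andP[/eqP e0 he]; rewrite e0 in sB.
have [y Sy xy] := h _ he; exists y; split=> //; apply: sB.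
by rewrite -ball_normE /= nmE ltcR.
Qed.

Lemma nm_closed (S : set V) :
  (forall x, (forall e : R, 0 < e -> exists2 y, S y & nm (x - y) < e) -> S x) -> closed S.
Proof.
move=> h x cx; apply: h => e e0.
have /cx [y [Sy]] : nbhs x (ball x e%:C) by apply: nbhsx_ballx; rewrite ltr0c.
by rewrite -ball_normE /= nmE ltcR => ?; exists y.
Qed.

Definition nm_lim (u : nat -> V) l :=
  forall e, 0 < e -> exists N, forall n, (N <= n)%N -> nm (l - u n) <= e.

Definition geometric (u : nat -> V) :=
  exists C r : R, [/\ 0 <= r, r < 1 & forall n, nm (u n.+1 - u n) <= C * r ^+ n].

Lemma geometric_dist (u : nat -> V) (C r : R) : 0 <= r -> r < 1 ->
  (forall n, nm (u n.+1 - u n) <= C * r ^+ n) ->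
  forall n m, (n <= m)%N -> nm (u m - u n) <= C / (1 - r) * r ^+ n.
Proof.
move=> r0 r1 h n m lenm; rewrite -(subnKC lenm); set k := (m - n)%N; clearbody k; clear lenm m.
elim: k n => [|k IH] n.
  rewrite addn0 subrr nm0; have C0 : 0 <= C.
    by have := h 0; rewrite expr0 mulr1; apply: le_trans; exact: nm_ge0.
  by rewrite !mulr_ge0 ?invr_ge0 ?subr_ge0 ?(ltW r1)// exprn_ge0.
rewrite -addSnnS (le_trans (nm_dist_tri (u n.+1) _ _))//.
have r1' : 1 - r != 0 by rewrite subr_eq0 eq_sym lt_eqF.
rewrite (le_trans (lerD (IH n.+1) (h n)))//.
by rewrite le_eqVlt exprS; apply/orP/or_introl/eqP; field.
Qed.

Lemma geometric_small (C r : R) : 0 <= r -> r < 1 -> forall e, 0 < e ->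
  exists N, forall n, (N <= n)%N -> C * r ^+ n <= e.
Proof.
move=> r0 r1 e e0.
have /cvgrPdist_le/(_ _ e0) : (C * r ^+ n) @[n --> \oo] --> (0 : R).
  rewrite -(mulr0 C); apply: cvgM; first exact: cvg_cst.
  by apply: cvg_expr; rewrite ger0_norm.
move=> [N _ hN]; exists N => n /hN /=.
by rewrite sub0r normrN; apply: le_trans; rewrite ler_norm.
Qed.

(** A Cauchy filter contains balls of radius [2^-1 ^+ n]; their centres form a geometric sequence,
    whose limit is a limit of the filter. Completeness of the spaces constructed below thus reduces
    to such sequences. *)
Lemma nm_complete : (forall u, geometric u -> exists l, nm_lim u l) ->
  forall F : set_system V, ProperFilter F -> cauchy F -> cvg F.
Proof.
move=> H F FF /cauchyP Fc.
have /choice[u hu] (n : nat) : exists x, F (ball x (2^-1 ^+ n)%:C).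
  by apply: Fc; rewrite ltr0c exprn_gt0// invr_gt0.
have uS n : nm (u n.+1 - u n) <= 2 * 2^-1 ^+ n.
  have [z []] := filter_ex (@filterI _ F _ _ _ (hu n) (hu n.+1)).
  rewrite -!ball_normE /= !nmE !ltcR => h1 h2.
  rewrite (le_trans (nm_dist_tri z _ _))// (nmBC z).
  rewrite exprS in h2; have : 0 < 2^-1 ^+ n :> R by rewrite exprn_gt0// invr_gt0.
  by lra.
have [|l ul] := H u; first by exists 2, 2^-1; split=> //; lra.
apply/cvg_ex; exists l; apply/cvgrPdist_le => -[e e'] he.
move: he; rewrite ltcE /= => /andP[/eqP-> he].
have e2 : 0 < e / 2 by rewrite divr_gt0.
have [N hN] := ul _ e2.
have [||N' hN'] := @geometric_small 1 2^-1 _ _ _ e2; [lra..|].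
have := hu (maxn N N'); apply: filterS => x.
rewrite -ball_normE /= !nmE ltcR lecR => h.
rewrite (le_trans (nm_dist_tri (u (maxn N N')) _ _))//.
have := hN _ (leq_maxl N N'); have := hN' _ (leq_maxr N N').
rewrite mul1r; lra.
Qed.

End RealNorm.

Lemma geometric_cvg (R : realType) (V : completeNormedModType R[i]) (u : nat -> V) :
  geometric u -> exists l, nm_lim u l.
Proof.
move=> [C [r [r0 r1 h]]].
have /cvg_ex[l /cvgrPdist_le ul] : cvg (u @ \oo).
  apply: cauchy_cvg; apply/cauchyP => -[e e'] he.
  move: he; rewrite ltcE /= => /andP[/eqP-> he].
  have e2 : 0 < e / 2 by rewrite divr_gt0.
  have [N hN] := geometric_small (C / (1 - r)) r0 r1 e2.
  exists (u N); exists N => // n /= Nn.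
  rewrite -ball_normE /= nmE ltcR nmBC.
  rewrite (le_lt_trans (geometric_dist r0 r1 h Nn))//.
  by rewrite (le_lt_trans (hN _ (leqnn _)))//; lra.
exists l => e e0.
have [|N _ hN] := ul e%:C; first by rewrite ltr0c.
by exists N => n /hN /=; rewrite nmE lecR.
Qed.

Section CStarNorm.
Variables (R : realType) (A : cstarAlgType R).
Implicit Types a b : A.

Lemma nm_cmul a b : nm (cmul a b) <= nm a * nm b.
Proof. by rewrite -lecR rmorphM /= -!nmE cnormM. Qed.

Lemma nm_cstar a : nm (cstar a) = nm a.
Proof. by rewrite /nm cnorm_cstar. Qed.

Lemma nm_cstar_cmul a : nm (cmul (cstar a) a) = nm a ^+ 2.
Proof. by apply/complexI; rewrite rmorphXn /= -!nmE cnorm_star. Qed.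

End CStarNorm.

Section ComplexModulus.
Variable R : realType.
Implicit Types z w : R[i].

Definition cn z : R := nm (z : R[i]^o).

Lemma cnE z : `|z| = (cn z)%:C. Proof. exact: (@nmE R (R[i]^o) z). Qed.

Lemma cnM z w : cn (z * w) = cn z * cn w.
Proof. by apply/complexI; rewrite rmorphM /= -!cnE normrM. Qed.

Lemma cnJ z : cn z^* = cn z.
Proof. by apply/complexI; rewrite -!cnE normcJ. Qed.

Lemma cn1 : cn 1 = 1.
Proof. by apply/complexI; rewrite -!cnE normr1. Qed.

Lemma cn_ge0 z : 0 <= cn z. Proof. exact: nm_ge0. Qed.

Lemma cn_sqr z : cn z ^+ 2 = complex.Re z ^+ 2 + complex.Im z ^+ 2.
Proof.
by rewrite /cn /nm normc_def /= sqr_sqrtr// addr_ge0// sqr_ge0.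
Qed.

Lemma ler_Re_cn z : `|complex.Re z| <= cn z.
Proof.
rewrite -(@ler_pXn2r _ 2)// ?nnegrE ?cn_ge0// cn_sqr real_normK ?num_real//.
by rewrite lerDl sqr_ge0.
Qed.

Lemma ler_Im_cn z : `|complex.Im z| <= cn z.
Proof.
rewrite -(@ler_pXn2r _ 2)// ?nnegrE ?cn_ge0// cn_sqr real_normK ?num_real//.
by rewrite lerDr sqr_ge0.
Qed.

Lemma ler_cn_ReIm z : cn z <= `|complex.Re z| + `|complex.Im z|.
Proof.
rewrite -(@ler_pXn2r _ 2)// ?nnegrE ?cn_ge0 ?addr_ge0// cn_sqr sqrrD !real_normK ?num_real//.
by rewrite lerD2r lerDl mulrn_wge0// mulr_ge0.
Qed.

Lemma real_cvg (u : nat -> R) (a : nat -> R[i]^o) : geometric a ->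
  (forall m n, `|u m - u n| <= cn (a m - a n)) ->
  exists l, forall e, 0 < e -> exists N, forall n, (N <= n)%N -> `|l - u n| <= e.
Proof.
move=> [C [r [r0 r1 h]]] ua.
have /cvg_ex[l /cvgrPdist_le ul] : cvg (u @ \oo).
  apply: cauchy_cvg; apply/cauchyP => e he.
  have e2 : 0 < e / 2 by rewrite divr_gt0.
  have [N hN] := geometric_small (C / (1 - r)) r0 r1 e2.
  exists (u N); exists N => // n /= Nn.
  rewrite -ball_normE /= distrC (le_lt_trans (ua _ _))//.
  rewrite (le_lt_trans (geometric_dist r0 r1 h Nn))//.
  by rewrite (le_lt_trans (hN _ (leqnn _)))//; lra.
exists l => e e0.
by have [N _ hN] := ul e e0; exists N => n /hN.
Qed.

Lemma complex_cvg (a : nat -> R[i]^o) : geometric a -> exists l, nm_lim a l.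
Proof.
move=> ga.
have [|x hx] := @real_cvg (fun n => complex.Re (a n)) a ga.
  by move=> m n; rewrite -raddfB ler_Re_cn.
have [|y hy] := @real_cvg (fun n => complex.Im (a n)) a ga.
  by move=> m n; rewrite -raddfB ler_Im_cn.
exists (x +i* y) => e e0; have e2 : 0 < e / 2 by rewrite divr_gt0.
have [N hN] := hx _ e2; have [M hM] := hy _ e2; exists (maxn N M) => n.
rewrite geq_max => /andP[/hN h1 /hM h2].
rewrite (le_trans (ler_cn_ReIm _))// [leRHS](splitr e) !raddfB /=.
by rewrite lerD.
Qed.

End ComplexModulus.

(* The same ring as [unitization A], but normed as a C*-algebra: the norm is the larger of
   the modulus of the scalar part and the operator norm on [A]. *)
Definition ucs (R : realType) (A : cstarAlgType R) : Type := unitization A.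

(** * The unitization as a C*-algebra *)

Section Envelope.
Variables (R : realType) (A : cstarAlgType R).
Local Notation X := (ucs A).
HB.instance Definition _ := GRing.NzRing.copy X (unitization A).
Implicit Types (x y z : X) (b : A) (c d : R[i]).

Definition uscale c x : X := (c *: x.1, c * x.2).

Fact uscaleA c d x : uscale c (uscale d x) = uscale (c * d) x.
Proof. by rewrite /uscale /= scalerA mulrA. Qed.
Fact uscale1 : left_id 1 uscale.
Proof. by case=> a l; congr pair; rewrite /= ?scale1r ?mul1r. Qed.
Fact uscaleDr : right_distributive uscale +%R.
Proof. by move=> c [a l] [b m]; congr pair; rewrite /= ?scalerDr ?mulrDr. Qed.
Fact uscaleDl x : {morph uscale^~ x : c d / c + d}.
Proof. by move=> c d; congr pair; rewrite /= ?scalerDl ?mulrDl. Qed.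

HB.instance Definition _ :=
  GRing.Zmodule_isLmodule.Build R[i] X uscaleA uscale1 uscaleDr uscaleDl.

(** The unitization acts on its ideal [A] by left multiplication; [opnm] is the operator norm of
    this action. *)
Definition act x b := cmul x.1 b + x.2 *: b.

Lemma actM x y b : act (x * y) b = act x (act y b).
Proof.
rewrite /act /= !cmulDl !cmulDr !cmulZl !cmulZr cmulA !scalerDr scalerA.
rewrite -!addrA; congr (_ + _); rewrite !addrA; congr (_ + _); exact: addrC.
Qed.

Lemma actD x y b : act (x + y) b = act x b + act y b.
Proof. by rewrite /act /= cmulDl scalerDl addrACA. Qed.

Lemma actZ c x b : act (c *: x) b = c *: act x b.
Proof. by rewrite /act /= cmulZl scalerDr scalerA. Qed.

Lemma actZr c x b : act x (c *: b) = c *: act x b.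
Proof. by rewrite /act cmulZr scalerDr !scalerA mulrC. Qed.

Lemma act_star x b : cmul (cstar (act x b)) (act x b) = cmul (cstar b) (act (ustar x * x) b).
Proof.
rewrite actM; set y := act x b; rewrite {1}/y /act /=; move: y => y.
by rewrite cstarD cstarM cstarZ cmulDl cmulDr cmulZl cmulZr cmulA.
Qed.

Lemma nm_act x b : nm (act x b) <= (nm x.1 + cn x.2) * nm b.
Proof.
rewrite (le_trans (nmD _ _))// mulrDl lerD ?nm_cmul// nmZ; exact: lexx.
Qed.

Definition opset x : set R := [set nm (act x b) | b in [set b | nm b <= 1]].

Lemma opset_sup x : has_sup (opset x).
Proof.
split; first by exists (nm (act x 0)); exists 0 => //=; rewrite nm0.
exists (nm x.1 + cn x.2) => _ [b /= b1 <-]; rewrite (le_trans (nm_act _ _))//.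
by rewrite ler_piMr// addr_ge0// nm_ge0.
Qed.

Definition opnm x : R := sup (opset x).

Lemma opnm_ub x b : nm b <= 1 -> nm (act x b) <= opnm x.
Proof. by move=> b1; apply: (sup_upper_bound (opset_sup x)); exists b. Qed.

Lemma opnm_le x (M : R) : (forall b, nm b <= 1 -> nm (act x b) <= M) -> opnm x <= M.
Proof.
move=> h; apply: ge_sup; first by have [] := opset_sup x.
by move=> _ [b /= /h b1 <-].
Qed.

Lemma opnm_ge0 x : 0 <= opnm x.
Proof. by rewrite (le_trans (nm_ge0 _) (opnm_ub (b := 0) _ _))// nm0. Qed.

Lemma nm_act_opnm x b : nm (act x b) <= opnm x * nm b.
Proof.
have [/nm0_eq0->|b0] := eqVneq (nm b) 0.
  by rewrite /act cmul0r scaler0 addr0 nm0 mulr0.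
have b1 : 0 < nm b by rewrite lt_def b0 nm_ge0.
rewrite -ler_pdivrMr// mulrC -[X in X * _]gtr0_norm ?invr_gt0// -nmZr -actZr.
by apply: opnm_ub; rewrite nmZr gtr0_norm ?invr_gt0// mulVf.
Qed.

Lemma opnmM x y : opnm (x * y) <= opnm x * opnm y.
Proof.
apply: opnm_le => b b1; rewrite actM (le_trans (nm_act_opnm _ _))//.
by rewrite ler_wpM2l ?opnm_ge0// opnm_ub.
Qed.

Lemma opnmD x y : opnm (x + y) <= opnm x + opnm y.
Proof.
by apply: opnm_le => b b1; rewrite actD (le_trans (nmD _ _))// lerD// opnm_ub.
Qed.

Lemma opnmZ_le c x : opnm (c *: x) <= cn c * opnm x.
Proof.
apply: opnm_le => b b1; rewrite actZ nmZ.
by rewrite ler_wpM2l ?cn_ge0// opnm_ub.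
Qed.

(** By [act_star] the square of [nm (act x b)] is the norm of [b^#] times the action of [x^# x] on
    [b]; so the C*-identity of [A] passes to the operator norm. *)
Lemma opnm_star x : opnm x ^+ 2 <= opnm (ustar x * x).
Proof.
rewrite -(@sqr_sqrtr _ (opnm (ustar x * x))) ?opnm_ge0//.
rewrite ler_pXn2r ?nnegrE ?opnm_ge0 ?sqrtr_ge0//.
apply: opnm_le => b b1; rewrite -(@ler_pXn2r _ 2) ?nnegrE ?nm_ge0 ?sqrtr_ge0//.
rewrite sqr_sqrtr ?opnm_ge0// -nm_cstar_cmul act_star.
rewrite (le_trans (nm_cmul _ _))// nm_cstar.
rewrite -[leRHS]mul1r ler_pM ?nm_ge0// opnm_ub//.
Qed.

(** Up to a multiple of [cstar x.1], the action of [x] on [cstar x.1] is the product of [x.1] with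
    its adjoint, of norm [nm x.1 ^+ 2]. *)
Lemma nm_fst_opnm x : nm x.1 <= opnm x + cn x.2.
Proof.
have [->|x0] := eqVneq (nm x.1) 0; first by rewrite addr_ge0 ?opnm_ge0 ?cn_ge0.
have x1 : 0 < nm x.1 by rewrite lt_def x0 nm_ge0.
rewrite -(ler_pM2r x1) -expr2 -[X in X ^+ 2]nm_cstar -nm_cstar_cmul cstarK.
have -> : cmul x.1 (cstar x.1) = act x (cstar x.1) - x.2 *: cstar x.1.
  by rewrite /act addrK.
rewrite (le_trans (nmB _ _))// mulrDl nmZ nm_cstar lerD//.
by rewrite -(nm_cstar x.1) nm_act_opnm.
Qed.

(** If [A] has a unit [e], then [opnm] vanishes at [(- e, 1)]; the modulus of the scalar part
    restores definiteness. *)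
Definition unm x : R := Num.max (cn x.2) (opnm x).

Lemma unm_ge0 x : 0 <= unm x.
Proof. by rewrite le_max cn_ge0. Qed.

Lemma unmM x y : unm (x * y) <= unm x * unm y.
Proof.
rewrite ge_max; apply/andP; split.
  by rewrite /= cnM ler_pM ?cn_ge0// le_max lexx.
by rewrite (le_trans (opnmM _ _))// ler_pM ?opnm_ge0// le_max lexx orbT.
Qed.

Lemma unmD x y : unm (x + y) <= unm x + unm y.
Proof.
rewrite ge_max; apply/andP; split.
  by rewrite (le_trans (nmD _ _))// lerD// le_max lexx.
by rewrite (le_trans (opnmD _ _))// lerD// le_max lexx orbT.
Qed.

Lemma unmZ c x : unm (c *: x) = cn c * unm x.
Proof.
have le (d : R[i]) y : unm (d *: y) <= cn d * unm y.
  rewrite ge_max; apply/andP; split.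
    by rewrite /= cnM ler_wpM2l ?cn_ge0// le_max lexx.
  by rewrite (le_trans (opnmZ_le _ _))// ler_wpM2l ?cn_ge0// le_max lexx orbT.
apply/eqP; rewrite eq_le le /=.
have [->|c0] := eqVneq c 0; first by rewrite /cn nm0 mul0r unm_ge0.
have cc : cn c * cn c^-1 = 1 by rewrite -cnM mulfV// cn1.
rewrite -{1}(scale1r x) -(mulVf c0) -scalerA.
by rewrite (le_trans (ler_wpM2l (cn_ge0 _) (le _ _)))// mulrA cc mul1r.
Qed.

Lemma unm_eq0 x : unm x = 0 -> x = 0.
Proof.
move=> x0; have h1 : cn x.2 <= 0 by rewrite -x0 le_max lexx.
have h2 : opnm x <= 0 by rewrite -x0 le_max lexx orbT.
have := nm_fst_opnm x => h3; have h4 := nm_ge0 x.1; have h5 := cn_ge0 x.2.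
have x1 : x.1 = 0 by apply/nm0_eq0; lra.
have x2 : x.2 = 0 by apply/(@nm0_eq0 _ (R[i]^o)); change (cn x.2 = 0); lra.
by rewrite (surjective_pairing x) x1 x2.
Qed.

Lemma nm_fst_unm x : nm x.1 <= 2 * unm x.
Proof.
rewrite (le_trans (nm_fst_opnm _))// mulr_natl mulr2n lerD// le_max lexx ?orbT//.
Qed.

Lemma unm_le x : unm x <= nm x.1 + cn x.2.
Proof.
rewrite ge_max lerDr nm_ge0 /=; apply: opnm_le => b b1.
by rewrite (le_trans (nm_act _ _))// ler_piMr// addr_ge0// nm_ge0.
Qed.

Lemma unm_star_le x : unm x ^+ 2 <= unm (ustar x * x).
Proof.
rewrite {1}/unm; case: (leP (cn x.2) (opnm x)) => _.
  by rewrite (le_trans (opnm_star _))// le_max lexx orbT.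
by rewrite le_max /= cnM cnJ expr2 lexx.
Qed.

Lemma unm_ustar x : unm (ustar x) = unm x.
Proof.
have le y : unm y <= unm (ustar y).
  have [->|y0] := eqVneq (unm y) 0; first exact: unm_ge0.
  have y1 : 0 < unm y by rewrite lt_def y0 unm_ge0.
  by rewrite -(ler_pM2r y1) -expr2 (le_trans (unm_star_le _))// unmM.
by apply/eqP; rewrite eq_le le -{2}(ustarK x) le.
Qed.

Lemma unm_star x : unm (ustar x * x) = unm x ^+ 2.
Proof.
by apply/eqP; rewrite eq_le unm_star_le expr2 (le_trans (unmM _ _))// unm_ustar.
Qed.

Fact unormD x y : (unm (x + y))%:C <= (unm x)%:C + (unm y)%:C.
Proof. by rewrite -raddfD lecR unmD. Qed.
Fact unormZ c x : (unm (c *: x))%:C = `|c| * (unm x)%:C.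
Proof. by rewrite unmZ rmorphM cnE. Qed.
Fact unorm_eq0 x : (unm x)%:C = 0 -> x = 0.
Proof. by move=> [] /unm_eq0. Qed.

HB.instance Definition _ := Lmodule_isNormed.Build R[i] X unormD unormZ unorm_eq0.

Lemma nm_unm x : nm x = unm x.
Proof. by []. Qed.

Fact ucs_complete (F : set_system X) : ProperFilter F -> cauchy F -> cvg F.
Proof.
apply: nm_complete => u [C [r [r0 r1 h]]].
have [|a ha] := @geometric_cvg _ A (fun n => (u n).1).
  exists (2 * C), r; split=> // n; have := nm_fst_unm (u n.+1 - u n) => /= /le_trans-> //.
  by rewrite -mulrA ler_wpM2l// -nm_unm.
have [|l hl] := @complex_cvg _ (fun n => (u n).2).
  exists C, r; split=> // n; rewrite (le_trans _ (h n))// nm_unm le_max lexx//.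
exists (a, l) => e e0; have e2 : 0 < e / 2 by rewrite divr_gt0.
have [N hN] := ha _ e2; have [M hM] := hl _ e2; exists (maxn N M) => n.
rewrite geq_max => /andP[/hN h1 /hM h2].
by rewrite nm_unm (le_trans (unm_le _))//= [leRHS](splitr e) lerD.
Qed.

HB.instance Definition _ := Uniform_isComplete.Build X ucs_complete.

Fact umulZl c x y : (c *: x : X) * y = c *: (x * y).
Proof.
congr pair => /=; last by rewrite mulrA.
by rewrite cmulZl !scalerDr !scalerA (mulrC y.2).
Qed.
Fact umulZr c x y : x * (c *: y) = c *: (x * y).
Proof.
congr pair => /=; last by rewrite mulrCA.
by rewrite cmulZr !scalerDr !scalerA (mulrC x.2).
Qed.
Fact ustarZ c x : ustar (c *: x) = c^* *: (ustar x : X).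
Proof. by congr pair => /=; [exact: cstarZ | exact: rmorphM]. Qed.
Fact unormM x y : `|x * y : X| <= `|x| * `|y|.
Proof. by rewrite !nmE -rmorphM lecR unmM. Qed.
Fact unorm_star x : `|ustar x * x : X| = `|x| ^+ 2.
Proof. by rewrite !nmE -rmorphXn; congr (_%:C); exact: unm_star. Qed.

HB.instance Definition _ := isCStarAlgebra.Build R X (@mulrA X) (@mulrDl X)
  (@mulrDr X) umulZl umulZr (@ustarK R A) (@ustarD R A) ustarZ (@ustarM R A) unormM unorm_star.

End Envelope.

(** * A reflexive decision procedure for identities in noncommutative rings *)

Inductive ncexp := NcVar of nat | Nc0 | Nc1 | NcAdd of ncexp & ncexp | NcOpp of ncexp
  | NcMul of ncexp & ncexp.

Section NcRing.
Variable T : pzRingType.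
Implicit Types (env : seq T) (e : ncexp) (l : seq (bool * seq nat)).

Fixpoint nceval env e : T :=
  match e with
  | NcVar i => nth 0 env i
  | Nc0 => 0
  | Nc1 => 1
  | NcAdd a b => nceval env a + nceval env b
  | NcOpp a => - nceval env a
  | NcMul a b => nceval env a * nceval env b
  end.

Fixpoint ncnorm e : seq (bool * seq nat) :=
  match e with
  | NcVar i => [:: (false, [:: i])]
  | Nc0 => [::]
  | Nc1 => [:: (false, [::])]
  | NcAdd a b => ncnorm a ++ ncnorm b
  | NcOpp a => [seq (~~ m.1, m.2) | m <- ncnorm a]
  | NcMul a b => [seq (x.1 (+) y.1, x.2 ++ y.2) | x <- ncnorm a, y <- ncnorm b]
  end.

(** [n] is fuel, for which the size of the list is enough. Only soundness matters: each removed pair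
    is a monomial and its opposite. *)
Fixpoint nccancel n l :=
  if n is n'.+1 then
    if l is (s, m) :: l' then
      if (~~ s, m) \in l' then nccancel n' (rem (~~ s, m) l')
      else (s, m) :: nccancel n' l'
    else l
  else l.

Definition ncmono env (m : bool * seq nat) : T := (-1) ^+ m.1 * \prod_(i <- m.2) nth 0 env i.
Definition ncpoly env l : T := \sum_(m <- l) ncmono env m.

Lemma ncpoly_norm env e : ncpoly env (ncnorm e) = nceval env e.
Proof.
elim: e => [i|||a IHa b IHb|a IHa|a IHa b IHb] /=.
- by rewrite /ncpoly big_seq1 /ncmono big_seq1 expr0 mul1r.
- by rewrite /ncpoly big_nil.
- by rewrite /ncpoly big_seq1 /ncmono big_nil expr0 mul1r.
- by rewrite /ncpoly big_cat -IHa -IHb.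
- rewrite -IHa /ncpoly big_map -sumrN; apply: eq_bigr => m _.
  by rewrite /ncmono /= signrN mulNr.
- rewrite -IHa -IHb /ncpoly big_allpairs_dep /= mulr_suml; apply: eq_bigr => x _.
  rewrite mulr_sumr; apply: eq_bigr => y _.
  rewrite /ncmono /= big_cat /= signr_addb -!mulrA; congr (_ * _).
  by rewrite [RHS]mulrA [in RHS]commr_sign mulrA.
Qed.

Lemma ncpoly_cancel env n l : ncpoly env (nccancel n l) = ncpoly env l.
Proof.
elim: n l => [//|n IH] [//|[s m] l] /=; case: ifP => [h|_]; rewrite ?IH.
  rewrite {2}/ncpoly big_cons (perm_big _ (perm_to_rem h)) big_cons /= addrA.
  by rewrite /ncmono /= signrN mulNr subrr add0r.
by rewrite /ncpoly !big_cons; congr (_ + _); exact: IH.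
Qed.

Lemma ncringP env e1 e2 :
  (let l := ncnorm (NcAdd e1 (NcOpp e2)) in nilp (nccancel (size l) l)) ->
  nceval env e1 = nceval env e2.
Proof.
set l := ncnorm _ => /nilP h; apply/subr0_eq.
rewrite -[LHS]/(nceval env (NcAdd e1 (NcOpp e2))) -ncpoly_norm -/l.
by rewrite -(ncpoly_cancel env (size l)) h /ncpoly big_nil.
Qed.

End NcRing.

Ltac nc_mem x env :=
  lazymatch env with
  | nil => constr:(false)
  | ?y :: ?env' =>
    match goal with
    | _ => let _ := match goal with _ => unify x y end in constr:(true)
    | _ => nc_mem x env'
    end
  end.

Ltac nc_env x env :=
  lazymatch x with
  | (?a + ?b)%R => let env := nc_env a env in nc_env b env
  | (?a * ?b)%R => let env := nc_env a env in nc_env b env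
  | (- ?a)%R => nc_env a env
  | 0%R => env
  | 1%R => env
  | _ => lazymatch nc_mem x env with true => env | false => constr:(x :: env) end
  end.

Ltac nc_index x env :=
  lazymatch env with
  | ?y :: ?env' =>
    match goal with
    | _ => let _ := match goal with _ => unify x y end in constr:(0%N)
    | _ => let n := nc_index x env' in constr:(n.+1)
    end
  end.

Ltac nc_reify x env :=
  lazymatch x with
  | (?a + ?b)%R => let a := nc_reify a env in let b := nc_reify b env in constr:(NcAdd a b)
  | (?a * ?b)%R => let a := nc_reify a env in let b := nc_reify b env in constr:(NcMul a b)
  | (- ?a)%R => let a := nc_reify a env in constr:(NcOpp a)
  | 0%R => constr:(Nc0)
  | 1%R => constr:(Nc1)
  | _ => let n := nc_index x env in constr:(NcVar n)
  end.

(* Decides identities of noncommutative rings with integer coefficients given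
   by repeated sums. *)
Ltac ncring :=
  lazymatch goal with
  | |- @eq ?T ?x ?y =>
    let env := nc_env x (@nil T) in let env := nc_env y env in
    let e1 := nc_reify x env in let e2 := nc_reify y env in
    apply: (@ncringP _ env e1 e2); vm_compute; reflexivity
  end.

Notation "x ^#" := (cstar x) : ring_scope.

(** * Consequences of the C*-identity, fixed points and inverses *)

Section UnitalCStarBasics.
Variables (R : realType) (A : cstarAlgType R).
Local Notation X := (ucs A).
Implicit Types x y z : X.

Lemma cmulE x y : cmul x y = x * y.
Proof. by []. Qed.

Lemma csM x y : (x * y)^# = y^# * x^#.
Proof. by rewrite -!cmulE cstarM. Qed.

Lemma cs1 : (1 : X)^# = 1.
Proof. by rewrite -[LHS]mul1r -{1}(cstarK (1 : X)) -csM mul1r cstarK. Qed.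

Lemma csN x : (- x)^# = - x^#.
Proof. by rewrite -sub0r cstarB cstar0 sub0r. Qed.

Definition csE := (@cstarD R (ucs A), csN, csM, cs1, @cstar0 R (ucs A), @cstarK R (ucs A)).

Lemma csZr (c : R) x : (c%:C *: x)^# = c%:C *: x^#.
Proof. by rewrite cstarZ; congr (_ *: _); apply/eqP; rewrite eq_complex /= oppr0 !eqxx. Qed.

Lemma csclAl (c : R[i]) x y : c *: x * y = c *: (x * y).
Proof. by rewrite -!cmulE cmulZl. Qed.

Lemma csclAr (c : R[i]) x y : x * (c *: y) = c *: (x * y).
Proof. by rewrite -!cmulE cmulZr. Qed.

Lemma cs_sum I (r : seq I) (P : pred I) (F : I -> X) :
  (\sum_(i <- r | P i) F i)^# = \sum_(i <- r | P i) (F i)^#.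
Proof. by apply: (big_morph _ (@cstarD R (ucs A))); exact: cstar0. Qed.

Lemma nmM x y : nm (x * y) <= nm x * nm y.
Proof. by rewrite -cmulE nm_cmul. Qed.

Lemma nm_cs x : nm x^# = nm x.
Proof. exact: nm_cstar. Qed.

Lemma nm_csM x : nm (x^# * x) = nm x ^+ 2.
Proof. by rewrite -cmulE nm_cstar_cmul. Qed.

Lemma nm_Mcs x : nm (x * x^#) = nm x ^+ 2.
Proof. by rewrite -[in LHS](cstarK x) cstarK -{1}(cstarK x) nm_csM nm_cs. Qed.

Lemma nm1 : nm (1 : X) = 1.
Proof.
have n0 : nm (1 : X) != 0 by apply/eqP => /nm0_eq0/eqP; rewrite oner_eq0.
by apply: (mulfI n0); rewrite mulr1 -expr2 -nm_csM cs1 mulr1.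
Qed.

Lemma nm_isometry x : x^# * x = 1 -> nm x = 1.
Proof.
move=> x1; apply/eqP; rewrite -(@eqrXn2 _ 2) ?nm_ge0//.
by rewrite -nm_csM x1 nm1 expr1n.
Qed.

Definition proj_elt x := x^# = x /\ x * x = x.

Lemma nm_proj x : proj_elt x -> nm x <= 1.
Proof.
move=> [xs xx]; rewrite -(@ler_pXn2r _ 2)// ?nnegrE ?nm_ge0// expr1n -nm_csM xs xx.
have [->|x0] := eqVneq (nm x) 0; first exact: ler01.
have : nm x = nm x ^+ 2 by rewrite -nm_csM xs xx.
by move/eqP; rewrite expr2 -{1}[nm x]mulr1 (inj_eq (mulfI x0)) => /eqP<-.
Qed.

Lemma nm_piso x p : proj_elt p -> x^# * x = p -> nm x <= 1.
Proof.
move=> hp xp; rewrite -(@ler_pXn2r _ 2)// ?nnegrE ?nm_ge0// expr1n -nm_csM xp.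
exact: nm_proj.
Qed.

Lemma proj_lt1 x : proj_elt x -> nm x < 1 -> x = 0.
Proof.
move=> [xs xx] x1; apply: nm0_eq0; apply/eqP; apply/negPn/negP => x0.
have : nm x = nm x ^+ 2 by rewrite -nm_csM xs xx.
move/eqP; rewrite expr2 -{1}[nm x]mulr1 (inj_eq (mulfI x0)) => /eqP h.
by rewrite -h ltxx in x1.
Qed.

(** By the C*-identity: [(x p - x)^# (x p - x)] expands to [p - p - p + p]. *)
Lemma piso_mul x p : proj_elt p -> x^# * x = p -> x * p = x.
Proof.
move=> [ps pp] xp; apply/subr0_eq/nm0_eq0/eqP; rewrite -sqrf_eq0 -nm_csM.
have -> : (x * p - x)^# * (x * p - x) = 0; last by rewrite nm0.
rewrite !csE ps !(mulrBl, mulrBr, mulrDl, mulNr, mulrN) !mulrA.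
by rewrite -!(mulrA p x^#) -!mulrA xp !(mulrA _ x) xp !mulrA !pp; ncring.
Qed.

Lemma cs_eq0 x : x^# * x = 0 -> x = 0.
Proof.
by move=> x0; apply/nm0_eq0/eqP; rewrite -sqrf_eq0 -nm_csM x0 nm0.
Qed.

Lemma closed_mul_eq (a b : X) : closed [set x | a * x = x * b].
Proof.
apply: nm_closed => x h; apply/subr0_eq; apply: nm_eq0P => e e0.
have d0 : 0 < e / (nm a + nm b + 1).
  by rewrite divr_gt0// ltr_wpDl// addr_ge0// nm_ge0.
have [y /= yab xy] := h _ d0.
have -> : a * x - x * b = a * (x - y) - (x - y) * b.
  by rewrite mulrBr mulrBl yab; ncring.
rewrite (le_trans (nmB _ _))//.
rewrite (le_trans (lerD (nmM _ _) (nmM _ _)))//.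
have ab1 : 0 < nm a + nm b + 1 by rewrite ltr_wpDl// addr_ge0// nm_ge0.
move: xy; rewrite ltr_pdivlMr// => xy; have := nm_ge0 (x - y); nra.
Qed.

Lemma closed_sa : closed [set x : X | x^# = x].
Proof.
apply: nm_closed => x h; apply/subr0_eq; apply: nm_eq0P => e e0.
have [y /= ys xy] := h (e / 2) (divr_gt0 e0 (ltr0Sn _ 1)).
have -> : x^# - x = (x - y)^# - (x - y) by rewrite cstarB ys; ncring.
by rewrite (le_trans (nmB _ _))// nm_cs; lra.
Qed.

End UnitalCStarBasics.

Lemma closed_ball_nm (R : realType) (V : normedModType R[i]) (r : R) :
  closed [set x : V | nm x <= r].
Proof.
apply: nm_closed => x h; apply/ler_addgt0Pr => e e0.
have [y /= ys xy] := h e e0.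
by rewrite (le_trans (ler_nm_dist x y))// lerD// ltW.
Qed.

(** The closed invariant set [S] carries properties of the iterates, such as commutation or
    self-adjointness, over to the fixed point. *)
Lemma contraction_fixpoint (R : realType) (V : completeNormedModType R[i])
    (T : V -> V) (S : set V) (r : R) x0 :
  0 <= r -> r < 1 -> closed S -> S x0 -> (forall x, S x -> S (T x)) ->
  (forall x y, S x -> S y -> nm (T x - T y) <= r * nm (x - y)) ->
  exists2 x, S x & T x = x.
Proof.
move=> r0 r1 cS Sx0 ST Tr.
pose u n := iter n T x0.
have Su n : S (u n) by elim: n => [|n IH] //=; exact: ST.
have [|l ul] := @geometric_cvg R V u.
  exists (nm (u 1 - u 0)), r; split=> //; elim=> [|n IH]; first by rewrite expr0 mulr1.
  by rewrite (le_trans (Tr _ _ (Su n.+1) (Su n)))// exprS mulrCA ler_wpM2l.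
have Sl : S l.
  apply: (closed_nm cS) => e e0.
  have [N /(_ _ (leqnn N)) h] := ul _ (divr_gt0 e0 (ltr0Sn _ 1)).
  by exists (u N) => //; rewrite (le_lt_trans h)//; lra.
exists l => //; apply/subr0_eq; apply: nm_eq0P => e e0.
have [N hN] := ul _ (divr_gt0 e0 (ltr0Sn _ 1)).
rewrite (le_trans (nm_dist_tri (u N.+1) _ _))// (nmBC (u _)).
have := Tr _ _ Sl (Su N); have := hN _ (leqnn N); have := hN _ (leqW (leqnn N)).
rewrite -[T (u N)]/(u N.+1); have := nm_ge0 (l - u N); nra.
Qed.

Section Inverse.
Variables (R : realType) (A : cstarAlgType R).
Local Notation X := (ucs A).
Implicit Types x y z e k g : X.

Definition inverse_of x g := g * x = 1 /\ x * g = 1.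

Lemma inverse_uniq x g g' : inverse_of x g -> inverse_of x g' -> g = g'.
Proof. by move=> [h1 _] [_ h2]; rewrite -[g]mulr1 -h2 mulrA h1 mul1r. Qed.

Lemma inverse_cs x g : inverse_of x g -> inverse_of x^# g^#.
Proof. by move=> [h1 h2]; split; rewrite -csM ?h1 ?h2 cs1. Qed.

Lemma inverseM x y g h : inverse_of x g -> inverse_of y h -> inverse_of (x * y) (h * g).
Proof.
move=> [h1 h2] [h3 h4]; split.
  by rewrite mulrA -(mulrA h) h1 mulr1 h3.
by rewrite mulrA -(mulrA x) h4 mulr1 h2.
Qed.

Lemma inverse_comm x g y : inverse_of x g -> x * y = y * x -> g * y = y * g.
Proof.
move=> [h1 h2] xy.
by rewrite -[LHS]mulr1 -h2 -!mulrA (mulrA y) -xy -!mulrA (mulrA g x) h1 mul1r.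
Qed.

(** A fixed point of [g -> 1 + e g] is a right inverse; within the invariant set of elements
    commuting with [e] it is two-sided. *)
Lemma neumann e : nm e < 1 -> exists2 g, inverse_of (1 - e) g & nm g <= (1 - nm e)^-1.
Proof.
move=> e1; pose S := [set g : X | e * g = g * e].
have [||||||g Sg Tg] := @contraction_fixpoint R X (fun g => 1 + e * g) S (nm e) 0.
- exact: nm_ge0.
- by [].
- exact: closed_mul_eq.
- by rewrite /S /= mulr0 mul0r.
- by rewrite /S /= => x ex; rewrite mulrDr mulrDl mulr1 mul1r -{1}mulrA -ex.
- move=> x y _ _; have -> : 1 + e * x - (1 + e * y) = e * (x - y) by ncring.
  exact: nmM.
exists g.
  split; last by rewrite mulrBl mul1r -{1}Tg addrK.
  by rewrite mulrBr mulr1 -Sg -{1}Tg addrK.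
have h : nm g <= 1 + nm e * nm g.
  by rewrite -{1}Tg (le_trans (nmD _ _))// nm1 lerD2l nmM.
have d : 0 < 1 - nm e by rewrite subr_gt0.
by rewrite -[leRHS]mul1r ler_pdivlMr//; lra.
Qed.

Lemma skew_inverse_bound k g : k^# = - k -> inverse_of (1 - k) g ->
  ((1 + k) * g)^# * ((1 + k) * g) = 1 /\ ((1 + k) * g) * ((1 + k) * g)^# = 1.
Proof.
move=> ks hg; have hg' : inverse_of (1 + k) g^#.
  by have := inverse_cs hg; rewrite cstarB cs1 ks opprK.
have c1 : (1 + k) * g = g * (1 + k).
  by apply/esym; apply: (inverse_comm hg); ncring.
have c2 : g^# * (1 - k) = (1 - k) * g^#.
  by apply: (inverse_comm hg'); ncring.
rewrite csM cstarD cs1 ks; split.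
  by rewrite c2 mulrA -(mulrA (1 - k)) hg'.1 mulr1 hg.2.
by rewrite c1 mulrA -(mulrA g) hg'.2 mulr1 hg.1.
Qed.

(** With the unitary [u = (1 + k) g] one has [2 g = 1 + u] and [2 k g = u - 1]. *)
Lemma skew_inverse_nm k g : k^# = - k -> inverse_of (1 - k) g ->
  nm g <= 1 /\ nm (k * g) <= 1.
Proof.
move=> ks hg; have [/nm_isometry u1 _] := skew_inverse_bound ks hg.
have g2 : g + g = 1 + (1 + k) * g by rewrite -{1}hg.2; ncring.
have kg2 : k * g + k * g = (1 + k) * g - 1 by rewrite -[X in _ - X]hg.2; ncring.
have half y : nm (y + y) <= 2 -> nm y <= 1.
  have -> : y + y = (2%:R : R)%:C *: y by rewrite -mulr2n rmorph_nat scaler_nat.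
  by rewrite nmZr ger0_norm//; lra.
by split; apply: half; rewrite ?g2 ?kg2;
  [rewrite (le_trans (nmD _ _))// | rewrite (le_trans (nmB _ _))//]; rewrite u1 nm1; lra.
Qed.

(** Write [k = N d] with [d] small and pass from [1 - n d] to [1 - (n + 1) d]. The inverse [g] of
    the former has norm at most 1 whatever [n] is, so [1 - g d] can be inverted by [neumann] at
    every step. *)
Lemma skew_inverse k : k^# = - k -> exists g, inverse_of (1 - k) g.
Proof.
move=> ks.
have [N N0 kN] : exists2 N : nat, (0 < N)%N & nm k < N%:R.
  exists (Num.truncn (nm k)).+1 => //; exact: Num.Theory.truncnS_gt.
pose d := ((N%:R : R)^-1)%:C *: k.
have N0' : (0 : R) < N%:R by rewrite ltr0n.
have ds : d^# = - d by rewrite /d csZr ks scalerN.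
have d1 : nm d < 1.
  by rewrite /d nmZr gtr0_norm ?invr_gt0// mulrC ltr_pdivrMr// mul1r.
have -> : k = d *+ N.
  rewrite /d -scaler_nat scalerA -(rmorph_nat (real_complex R)) -rmorphM mulfV ?scale1r//.
  by rewrite gt_eqF.
elim: N {N0 kN N0' d ds d1} (d) ds d1 => [|N IH] d ds d1.
  by exists 1; rewrite mulr0n subr0; split; rewrite mulr1.
have [g hg] := IH d ds d1.
have sk : (d *+ N)^# = - (d *+ N).
  by elim: N {IH hg g} => [|n IHn]; rewrite ?mulr0n ?cstar0 ?oppr0// !mulrS cstarD IHn ds opprD.
have [g1 _] := skew_inverse_nm sk hg.
have gd1 : nm (g * d) < 1 by rewrite (le_lt_trans (nmM _ _))//; have := nm_ge0 d; nra.
have [h hh _] := neumann gd1.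
exists (h * g).
have -> : 1 - d *+ N.+1 = (1 - d *+ N) * (1 - g * d).
  rewrite mulrBr mulr1 mulrA hg.2 mul1r mulrSr; ncring.
exact: inverseM.
Qed.

End Inverse.

(** * Star homomorphisms, square roots and contractivity *)

Section StarHom.
Variables (R : realType) (A B : cstarAlgType R) (f : A -> B).
Hypothesis hf : is_star_hom f.

Lemma shD a b : f (a + b) = f a + f b.
Proof. by have [h _ _] := hf; rewrite -(scale1r a) h !scale1r. Qed.

Lemma sh0 : f 0 = 0.
Proof. by apply: (addrI (f 0)); rewrite -shD !addr0. Qed.

Lemma shZ c a : f (c *: a) = c *: f a.
Proof. by have [h _ _] := hf; rewrite -[c *: a]addr0 h sh0 addr0. Qed.

Lemma shN a : f (- a) = - f a.
Proof. by rewrite -scaleN1r shZ scaleN1r. Qed.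

Lemma shB a b : f (a - b) = f a - f b.
Proof. by rewrite shD shN. Qed.

Lemma shcM a b : f (cmul a b) = cmul (f a) (f b).
Proof. by have [_ h _] := hf. Qed.

Lemma shS a : f (cstar a) = cstar (f a).
Proof. by have [_ _ h] := hf. Qed.

Lemma sh_sum I (r : seq I) (P : pred I) (F : I -> A) :
  f (\sum_(i <- r | P i) F i) = \sum_(i <- r | P i) f (F i).
Proof. by apply: (big_morph f shD sh0). Qed.

End StarHom.

Lemma shM (R : realType) (A B : cstarAlgType R) (f : ucs A -> ucs B) x y :
  is_star_hom f -> f (x * y) = f x * f y.
Proof. by move=> hf; exact: shcM hf x y. Qed.

Lemma is_star_hom_comp (R : realType) (A B C : cstarAlgType R) (f : A -> B) (g : B -> C) :
  is_star_hom f -> is_star_hom g -> is_star_hom (g \o f).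
Proof.
move=> hf hg; split=> [c a b|a b|a] /=.
- by rewrite (shD hf) (shD hg) (shZ hf) (shZ hg).
- by rewrite (shcM hf) (shcM hg).
- by rewrite (shS hf) (shS hg).
Qed.

Definition unital_hom (R : realType) (A B : cstarAlgType R) (f : ucs A -> ucs B) :=
  is_star_hom f /\ f 1 = 1.

Lemma nm_half (R : realType) (V : normedModType R[i]) (x : V) (M : R) :
  nm (x + x) <= 2 * M -> nm x <= M.
Proof.
have -> : x + x = (2%:R : R)%:C *: x by rewrite -mulr2n rmorph_nat scaler_nat.
by rewrite nmZr ger0_norm//; lra.
Qed.

Section SquareRoot.
Variables (R : realType) (A : cstarAlgType R).
Local Notation X := (ucs A).
Implicit Types x y z e k p q v : X.

(** [e = 1 - sqrt (1 - k)] solves [2 e = k + e^2], and halving [k + e^2] is a contraction of the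
    ball of radius [nm k]. The remaining conclusions are built into the invariant set. *)
Lemma sqrt_one_sub k : k^# = k -> nm k < 1 -> exists e,
  [/\ e^# = e, nm e <= nm k, (1 - e) * (1 - e) = 1 - k &
      forall y, k * y = y * k -> e * y = y * e].
Proof.
move=> ks k1.
pose S := [set e : X | [/\ e^# = e, nm e <= nm k & forall y, k * y = y * k -> e * y = y * e]].
pose T e : X := ((2 : R)^-1)%:C *: (k + e * e).
have half (x : X) : nm (((2 : R)^-1)%:C *: x) = nm x / 2.
  by rewrite nmZr ger0_norm ?invr_ge0// mulrC.
have [||||||e [es ek ec] Te] := @contraction_fixpoint R X T S (nm k) 0.
- exact: nm_ge0.
- by [].
- apply: nm_closed => x h; split.
  + by apply: (closed_nm (@closed_sa R A)) => e /h[y []]; exists y.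
  + by apply: (closed_nm (@closed_ball_nm R X (nm k))) => e /h[y []]; exists y.
  + move=> y ky; apply/esym; apply: (closed_nm (@closed_mul_eq R A y y)) => e /h[z [_ _ hz] xz].
    by exists z => //=; rewrite hz.
- by split; rewrite ?cstar0 ?nm0 ?nm_ge0// => y _; rewrite mul0r mulr0.
- move=> e [es ek ec]; split.
  + by rewrite /T csZr cstarD csM ks es.
  + rewrite half; have := nmD k (e * e); have := nmM e e; have := nm_ge0 e; nra.
  + move=> y ky; rewrite /T csclAl csclAr mulrDl mulrDr ky -mulrA (ec _ ky).
    by rewrite !mulrA (ec _ ky).
- move=> x y [_ xk _] [_ yk _]; rewrite /T -scalerBr half.
  have -> : k + x * x - (k + y * y) = x * (x - y) + (x - y) * y by ncring.
  rewrite ler_pdivrMr// (le_trans (nmD _ _))//.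
  have := nmM x (x - y); have := nmM (x - y) y; have := nm_ge0 (x - y); nra.
exists e; split=> //.
have ee : e + e = k + e * e.
  rewrite -{1 2}Te -scalerDl -rmorphD (_ : _ + _ = 1 :> R) ?scale1r//; lra.
have -> : (1 - e) * (1 - e) = 1 - (e + e) + e * e by ncring.
by rewrite ee; ncring.
Qed.

End SquareRoot.

Section Contractive.
Variables (R : realType) (A B : cstarAlgType R).

(** [h] is the mean of the unitaries [h + i w] and [h - i w] with [w = sqrt (1 - h^2)], and a unital
    homomorphism maps unitaries to unitaries, which have norm 1. *)
Lemma unital_hom_sa1 (f : ucs A -> ucs B) h : unital_hom f -> h^# = h -> nm h < 1 ->
  nm (f h) <= 1.
Proof.
move=> [hf f1] hs h1; have k1 : nm (h * h) < 1.
  by rewrite (le_lt_trans (nmM _ _))//; have := nm_ge0 h; nra.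
have [|e [es _ ee ec]] := sqrt_one_sub _ k1; first by rewrite csM hs.
set a := f h; set w : ucs B := 1 - f e.
have as_ : a^# = a by rewrite /a -(shS hf) hs.
have ws : w^# = w by rewrite /w cstarB cs1 -(shS hf) es.
have aw : a * w = w * a.
  by rewrite /w mulrBl mulrBr mulr1 mul1r -!(shM _ _ hf) ec// mulrA.
have ww : a * a + w * w = 1.
  have := congr1 f ee; rewrite (shM _ _ hf) !(shB hf) f1 (shM _ _ hf) => ->.
  by rewrite -/a; ncring.
pose j : ucs B := 'i%C *: (1 : ucs B).
have jc y : j * y = y * j by rewrite /j csclAl csclAr mul1r mulr1.
have jj : j * j = - 1 by rewrite /j csclAl mul1r scalerA -expr2 sqr_i scaleN1r.
have js : j^# = - j.
  rewrite /j cstarZ cs1 -scaleNr; congr (_ *: _).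
  by apply/eqP; rewrite eq_complex /= oppr0 !eqxx.
clearbody w j a.
have u1 : (a + w * j)^# = a - w * j by rewrite cstarD csM as_ ws js mulNr jc.
have u2 : (a + w * j) * (a - w * j) = 1.
  rewrite -ww mulrBr !mulrDl; have -> : w * j * (w * j) = - (w * w).
    by rewrite -mulrA (mulrA j) jc -!mulrA jj; ncring.
  by rewrite -(mulrA w j a) jc !mulrA aw; ncring.
have u3 : (a - w * j) * (a + w * j) = 1.
  rewrite -ww mulrDr !mulrBl; have -> : w * j * (w * j) = - (w * w).
    by rewrite -mulrA (mulrA j) jc -!mulrA jj; ncring.
  by rewrite -(mulrA w j a) jc !mulrA aw; ncring.
have n1 : nm (a + w * j) = 1 by apply: nm_isometry; rewrite u1.
have n2 : nm (a - w * j) = 1 by rewrite -u1 nm_cs.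
apply: nm_half; have -> : a + a = (a + w * j) + (a - w * j) by ncring.
by rewrite (le_trans (nmD _ _))// n1 n2; lra.
Qed.

Lemma unital_hom_nm (f : ucs A -> ucs B) x : unital_hom f -> nm (f x) <= nm x.
Proof.
move=> uf; have [hf f1] := uf.
have sa h : h^# = h -> nm (f h) <= nm h.
  move=> hs; apply/ler_addgt0Pr => e e0.
  have t0 : 0 < nm h + e by rewrite ltr_wpDl// nm_ge0.
  have tn (V : normedModType R[i]) (y : V) :
      nm ((nm h + e)^-1%:C *: y) = nm y / (nm h + e).
    by rewrite nmZr gtr0_norm ?invr_gt0// mulrC.
  have := @unital_hom_sa1 f ((nm h + e)^-1%:C *: h) uf.
  rewrite csZr hs (shZ hf) !tn ltr_pdivrMr// ler_pdivrMr// !mul1r ltrDl.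
  by move=> H; exact: H.
rewrite -(@ler_pXn2r _ 2) ?nnegrE ?nm_ge0// -!nm_csM -(shS hf) -(shM _ _ hf).
by apply: sa; rewrite csM cstarK.
Qed.

Definition uhom (f : A -> B) (x : ucs A) : ucs B := (f x.1, x.2).

Lemma unital_uhom f : is_star_hom f -> unital_hom (uhom f).
Proof.
move=> hf; split; last by congr pair; exact: sh0 hf.
split=> [c a b|a b|a]; congr pair => /=.
- by rewrite (shD hf) (shZ hf).
- by rewrite !(shD hf) !(shZ hf) (shcM hf).
- exact: (shS hf).
Qed.

Definition emb (a : A) : ucs A := (a, 0).

Lemma emb_hom : is_star_hom emb.
Proof.
split=> [c a b|a b|a]; congr pair => /=; rewrite ?mulr0 ?addr0//.
  by rewrite !scale0r !addr0.
by rewrite oppr0.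
Qed.

Lemma nm_emb a : nm (emb a) = nm a.
Proof.
apply/eqP; rewrite eq_le; apply/andP; split.
  rewrite nm_unm (le_trans (unm_le _))//= [cn _](_ : _ = 0) ?addr0//.
  by rewrite /cn nm0.
rewrite (le_trans (nm_fst_opnm (emb a)))// [cn _](_ : _ = 0) ?addr0 /=; last by rewrite /cn nm0.
by rewrite nm_unm le_max lexx orbT.
Qed.

Lemma emb_inj : injective emb.
Proof. by move=> a b []. Qed.

End Contractive.

Lemma star_hom_nm (R : realType) (A B : cstarAlgType R) (f : A -> B) a :
  is_star_hom f -> nm (f a) <= nm a.
Proof.
move=> hf; rewrite -(nm_emb a) -(nm_emb (f a)).
exact: (@unital_hom_nm R A B _ (emb a) (unital_uhom hf)).
Qed.

Lemma mulKeq (T : pzRingType) (a b c : T) : a * b = c -> forall x, x * a * b = x * c.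
Proof. by move=> <- x; rewrite mulrA. Qed.

(** * Perturbing approximate projections and partial isometries to exact ones *)

Section Perturbation.
Variables (R : realType) (A : cstarAlgType R).
Local Notation X := (ucs A).
Implicit Types x y z e k g p q v c : X.

(** [c] is the inverse of the square root [1 - e] from [sqrt_one_sub]. If [f k = 0], then
    [2 f e = (f e)^2] with [nm (f e) < 1], which forces [f e = 0] and so [f c = 1]. *)
Lemma inv_sqrt k : k^# = k -> nm k < 1 -> exists c,
  [/\ c^# = c, (1 - k) * (c * c) = 1, forall y, k * y = y * k -> c * y = y * c,
      nm (c - 1) <= nm k / (1 - nm k) &
      forall (B : cstarAlgType R) (f : ucs A -> ucs B), unital_hom f -> f k = 0 -> f c = 1].
Proof.
move=> ks k1; have [e [es ek ee ec]] := sqrt_one_sub ks k1.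
have e1 : nm e < 1 by exact: le_lt_trans ek k1.
have [c ci cn] := neumann e1.
have cc y : k * y = y * k -> c * y = y * c.
  move=> /ec ey; apply: (inverse_comm ci); rewrite mulrBl mulrBr ey; ncring.
exists c; split=> //.
- by apply: (inverse_uniq _ ci); have := inverse_cs ci; rewrite cstarB cs1 es.
- by rewrite -ee -mulrA [(1 - e) * (c * c)]mulrA ci.2 mul1r ci.2.
- have -> : c - 1 = e * c by rewrite -ci.2; ncring.
  have d1 : 0 < 1 - nm k by rewrite subr_gt0.
  have d2 : 0 < 1 - nm e by rewrite subr_gt0.
  rewrite (le_trans (nmM _ _))// ler_pM ?nm_ge0// (le_trans cn)//.
  by rewrite lef_pV2 ?posrE// lerB.
move=> B f [hf f1] fk.
have fe2 : f e + f e = f e * f e.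
  have := congr1 f ee; rewrite (shM _ _ hf) !(shB hf) f1 fk subr0 => H.
  have -> : f e + f e = f e * f e + (1 - (1 - f e) * (1 - f e)) by ncring.
  by rewrite H subrr addr0.
have fe1 : nm (f e) < 1 by rewrite (le_lt_trans (unital_hom_nm _ (conj hf f1))).
have fe : f e = 0.
  apply: nm0_eq0; have := nmM (f e) (f e); rewrite -fe2.
  have -> : nm (f e + f e) = 2 * nm (f e).
    have -> : f e + f e = (2%:R : R)%:C *: f e by rewrite -mulr2n rmorph_nat scaler_nat.
    by rewrite nmZr ger0_norm.
  have := nm_ge0 (f e); nra.
by have := congr1 f ci.1; rewrite (shM _ _ hf) (shB hf) f1 fe subr0 mulr1.
Qed.

(** Polar decomposition: for [k = p - x^# x] one has [x^# x = p (1 - k)], so [c = (1 - k)^(-1/2)]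
    corrects [x]. The last clause allows a lift to be corrected without changing its image. *)
Lemma isometry_perturb p x : proj_elt p -> x * p = x -> nm (p - x^# * x) <= 4^-1 ->
  exists c, [/\ (x * c)^# * (x * c) = p, nm (x * c - x) <= 3 * nm (p - x^# * x) &
    forall (B : cstarAlgType R) (f : ucs A -> ucs B), unital_hom f ->
      f x^# * f x = f p -> f c = 1].
Proof.
move=> hp xp k4; have [ps pp] := hp.
have px : p * x^# = x^# by rewrite -{1}ps -csM xp.
set k := p - x^# * x in k4 *.
have ks : k^# = k by rewrite /k cstarB csM cstarK ps.
have k1 : nm k < 1 by rewrite (le_lt_trans k4)// invf_lt1// ltr1n.
have kp : k * p = p * k by rewrite /k mulrBl mulrBr pp mulrA px -mulrA xp.
have pk : p - k = p * (1 - k).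
  by rewrite mulrBr mulr1 /k !mulrBr pp mulrA px; ncring.
have [c [cs cc comm cn cf]] := inv_sqrt ks k1.
have cp := comm _ kp; have ck := comm k erefl.
exists c; split.
- have xx : x^# * x = p - k by rewrite /k; ncring.
  rewrite csM cs -mulrA (mulrA x^#) xx pk.
  have c1k : c * (1 - k) = (1 - k) * c by rewrite mulrBr mulrBl ck mulr1 mul1r.
  rewrite -[RHS]mulr1 -[X in _ = _ * X]cc !mulrA cp -!mulrA; congr (p * _).
  by rewrite !mulrA c1k.
- have x2 : nm x <= 2.
    rewrite -(@ler_pXn2r _ 2)// ?nnegrE ?nm_ge0// -nm_csM.
    have -> : x^# * x = p - k by rewrite /k; ncring.
    rewrite (le_trans (nmB _ _))//; have := nm_proj hp; lra.
  have -> : x * c - x = x * (c - 1) by ncring.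
  have c3 : nm (c - 1) <= 4 / 3 * nm k.
    rewrite (le_trans cn)// mulrC ler_wpM2r ?nm_ge0//.
    by rewrite -[leRHS]invrK lef_pV2 ?posrE ?invr_gt0 ?invf_div; lra.
  rewrite (le_trans (nmM _ _))//.
  have := nm_ge0 k; have := nm_ge0 (c - 1); have := nm_ge0 x; nra.
move=> B f uf fx; apply: (cf _ _ uf); have [hf _] := uf.
by rewrite /k (shB hf) (shM _ _ hf) fx subrr.
Qed.

(** [q - v v^#] is a projection, and projections of norm below 1 vanish. *)
Lemma range_eq p q v : proj_elt p -> proj_elt q -> v^# * v = p -> q * v = v ->
  nm (q - v * v^#) < 1 -> v * v^# = q.
Proof.
move=> hp [qs qq] vp qv h; have vq : v^# * q = v^# by rewrite -{1}qs -csM qv.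
apply/esym/subr0_eq; apply: proj_lt1 h; split.
  by rewrite cstarB csM cstarK qs.
rewrite mulrBl !mulrBr qq !mulrA qv -(mulrA v) vq -(mulrA v) vp (piso_mul hp vp).
by ncring.
Qed.

(** For [v = x c] the defect [q - v v^#] has norm at most [1/4 + (2 + 1) 3/16 < 1], so [range_eq]
    applies. *)
Lemma piso_perturb p q x : proj_elt p -> proj_elt q -> x * p = x -> q * x = x ->
  nm (p - x^# * x) <= 16^-1 -> nm (q - x * x^#) <= 4^-1 ->
  exists c, [/\ (x * c)^# * (x * c) = p, (x * c) * (x * c)^# = q,
    nm (x * c - x) <= 3 * nm (p - x^# * x) &
    forall (B : cstarAlgType R) (f : ucs A -> ucs B), unital_hom f ->
      f x^# * f x = f p -> f c = 1].
Proof.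
move=> hp hq xp qx h1 h2.
have [|c [vp vx cf]] := isometry_perturb hp xp.
  by rewrite (le_trans h1)// lef_pV2 ?posrE// ler_nat.
exists c; split=> //; set v := x * c in vp vx *.
have nv : nm v <= 1 := nm_piso hp vp.
have nx : nm x <= 2.
  by rewrite (le_trans (ler_nm_dist x v))// nmBC; lra.
apply: (range_eq hp hq vp); first by rewrite /v mulrA qx.
rewrite (le_lt_trans (nm_dist_tri (x * x^#) _ _))//.
have -> : x * x^# - v * v^# = x * (x - v)^# + (x - v) * v^#.
  by rewrite cstarB; ncring.
have := nmD (x * (x - v)^#) ((x - v) * v^#); have := nmM x (x - v)^#.
rewrite nmBC in vx; have := nmM (x - v) v^#; rewrite !nm_cs.
have := nm_ge0 (x - v); have := nm_ge0 x; have := nm_ge0 v; nra.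
Qed.

(** [y = 2 x - 1] has [1 - y^2 = - 4 (x^2 - x)], of norm at most 1/2. Its sign [y c], with
    [c = (y^2)^(-1/2)], is a self-adjoint unitary, and [p = (1 + y c) / 2]. *)
Lemma proj_perturb x : x^# = x -> nm (x * x - x) <= 8^-1 -> exists p,
  [/\ proj_elt p, forall y, x * y = y * x -> p * y = y * p &
   forall (B : cstarAlgType R) (f : ucs A -> ucs B), unital_hom f ->
      f x * f x = f x -> f p = f x].
Proof.
move=> xs hx; pose y := x + x - 1; pose k := 1 - y * y.
have ys : y^# = y by rewrite /y cstarB cstarD cs1 xs.
have kE : k = - ((x * x - x) + (x * x - x) + ((x * x - x) + (x * x - x))).
  by rewrite /k /y; ncring.
have k1 : nm k < 1.
  rewrite kE nmN; have := nmD (x * x - x) (x * x - x).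
  have := nmD (x * x - x + (x * x - x)) (x * x - x + (x * x - x)); lra.
have ks : k^# = k by rewrite /k cstarB cs1 csM ys.
have [c [cs cc comm _ cf]] := inv_sqrt ks k1.
have yy : 1 - k = y * y by rewrite /k; ncring.
have kcomm z : x * z = z * x -> k * z = z * k.
  have e1 : x * x * z = x * (x * z) by rewrite mulrA.
  move=> xz; rewrite kE.
  have e2 : x * x * z = z * x * x by rewrite e1 xz mulrA xz.
  by rewrite !(mulrDl, mulrDr, mulNr, mulrN) e2 xz !mulrA.
have yc : c * y = y * c.
  by apply/comm/kcomm; rewrite /y; ncring.
pose h : R[i] := (2^-1 : R)%:C.
have hh z : h *: z + h *: z = z.
  by rewrite -scalerDl -rmorphD (_ : _ + _ = 1 :> R) ?scale1r//; lra.
have scc : (y * c) * (y * c) = 1.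
  by rewrite -mulrA (mulrA c) yc -(mulrA y) !mulrA -yy -mulrA.
exists (h *: (1 + y * c)); split.
- split; first by rewrite csZr cstarD cs1 csM ys cs yc.
  rewrite csclAl csclAr -[RHS]hh -[in RHS]scalerDr; congr (_ *: _).
  rewrite -scalerDr; have -> : (1 + y * c) * (1 + y * c) = (1 + y * c) + (1 + y * c).
    by rewrite mulrDl !mulrDr scc; ncring.
  by rewrite scalerDr hh.
- move=> z xz; rewrite csclAl csclAr; congr (_ *: _).
  rewrite mulrDl mulrDr mul1r mulr1; congr (_ + _).
  rewrite -mulrA (comm _ (kcomm _ xz)) !mulrA; congr (_ * c).
  by rewrite /y mulrBl mulrDl mulrBr mulrDr xz; ncring.
move=> B f uf fx; have [hf f1] := uf.
have fk : f k = 0.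
  by rewrite kE (shN hf) !(shD hf) !(shN hf) (shM _ _ hf) fx; ncring.
rewrite (shZ hf) (shD hf) f1 (shM _ _ hf) (cf _ _ uf fk) mulr1.
rewrite /y (shB hf) (shD hf) f1.
have -> : 1 + (f x + f x - 1) = f x + f x by ncring.
by rewrite scalerDr -scalerDl -rmorphD (_ : _ + _ = 1 :> R) ?scale1r//; lra.
Qed.

End Perturbation.

(** * Closed ideals and quotient C*-algebras *)

Section IdealRegularization.
Variables (R : realType) (B : cstarAlgType R) (J : set B).
Hypothesis hJ : is_closed_ideal J.
Implicit Types (b j : B) (x y z g : ucs B).

Lemma ideal0 : J 0. Proof. by case: hJ. Qed.

Lemma idealD a b : J a -> J b -> J (a + b).
Proof. by case: hJ => _ _ h _ _ Ja Jb; rewrite -(scale1r a); exact: h. Qed.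

Lemma idealZ c a : J a -> J (c *: a).
Proof. by case: hJ => _ J0 h _ _ Ja; rewrite -[_ *: _]addr0; exact: h. Qed.

Lemma idealN a : J a -> J (- a).
Proof. by rewrite -scaleN1r; exact: idealZ. Qed.

Lemma idealB a b : J a -> J b -> J (a - b).
Proof. by move=> Ja /idealN; exact: idealD. Qed.

Lemma idealMl a b : J b -> J (cmul a b).
Proof. by case: hJ => _ _ _ h _; exact: h. Qed.

Lemma idealMr a b : J a -> J (cmul a b).
Proof. by case: hJ => _ _ _ _ h; exact: h. Qed.

Definition ideal_env : set (ucs B) := [set x | x.2 = 0 /\ J x.1].

Lemma ideal_envMl x y : ideal_env y -> ideal_env (x * y).
Proof.
move=> [y2 Jy]; split => /=; first by rewrite y2 mulr0.
by apply: idealD; [exact: idealMl | apply: idealD; [exact: idealZ | rewrite y2 scale0r; exact: ideal0]].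
Qed.

Lemma ideal_envMr x y : ideal_env x -> ideal_env (x * y).
Proof.
move=> [x2 Jx]; split => /=; first by rewrite x2 mul0r.
by apply: idealD; [exact: idealMr | apply: idealD; [rewrite x2 scale0r; exact: ideal0 | exact: idealZ]].
Qed.

Lemma emb_of_scalar0 x : x.2 = 0 -> x = emb x.1.
Proof. by case: x => a l /= ->. Qed.

(* [1 - g] is an approximate unit for the self-adjoint element [j] of the ideal
   as [n] grows; [g] is the resolvent of [j] at an imaginary point. *)
Lemma ideal_regularizer j (n : nat) : J j -> cstar j = j -> exists g : ucs B,
  [/\ nm g <= 1, n%:R * nm (emb j * g) <= 1, n%:R * nm (g * emb j) <= 1,
      forall x, ideal_env (x * g - x) & forall x, ideal_env (g * x - x)].
Proof.
move=> Jj js; pose w : R[i] := 0 +i* n%:R; pose k : ucs B := w *: emb j.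
have ks : k^# = - k.
  rewrite /k cstarZ -(shS (@emb_hom R B)) js -scaleNr; congr (_ *: _).
  by apply/eqP; rewrite eq_complex /= !oppr0 !eqxx.
have [g hg] := skew_inverse ks; have [g1 kg1] := skew_inverse_nm ks hg.
have gk : g * k = k * g by apply: (inverse_comm hg); ncring.
have kn (y : ucs B) : nm (w *: y) = n%:R * nm y.
  rewrite nmZ (_ : complex.Re `|w| = cn w)//; congr (_ * _).
  by apply/eqP; rewrite -(@eqrXn2 _ 2) ?cn_ge0// cn_sqr /= expr0n add0r.
have envk x y : ideal_env (x * k * y).
  apply/ideal_envMr/ideal_envMl; split=> /=; first by rewrite mulr0.
  exact: idealZ.
exists g; split=> // [||x|x].
- by rewrite -kn -csclAl.
- by rewrite -kn -csclAr -/k gk.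
- have -> : x * g - x = x * k * g by rewrite -mulrA -{2}[x]mulr1 -hg.2; ncring.
  exact: envk.
have -> : g * x - x = 1 * k * (g * x).
  by rewrite mul1r mulrA -{2}[x]mul1r -hg.2; ncring.
exact: envk.
Qed.

Lemma ideal_nat_small (e : R) : 0 < e -> exists2 n : nat, (0 < n)%N & 1 < n%:R * e.
Proof.
move=> e0; exists (Num.truncn e^-1).+1 => //.
by rewrite -ltr_pdivrMr// mul1r; exact: Num.Theory.truncnS_gt.
Qed.

(** For [g] regularizing [a^# a], the element [a^# - g a^#] lies in [J], and [nm (g a^#) ^+ 2 = nm
    (g a^# a g^#) <= 1 / n]. So [a^#] is a limit of elements of [J]. *)
Lemma ideal_star a : J a -> J (cstar a).
Proof.
move=> Ja; have [cJ _ _ _ _] := hJ; apply: (closed_nm cJ) => e e0.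
have [n n0 hn] := ideal_nat_small (exprn_gt0 2 e0).
have [|g [g1 _ gj _ hg]] := @ideal_regularizer (cmul (cstar a) a) n (idealMl _ Ja).
  by rewrite cstarM cstarK.
pose y := emb (cstar a) - g * emb (cstar a).
have [y2 Jy] : ideal_env y.
  have [h2 h1] := hg (emb (cstar a)).
  split; first by rewrite /y -opprB; rewrite -[RHS]oppr0 -h2.
  by rewrite /y -opprB; apply: (@idealN (_ - _)).
exists y.1 => //; rewrite -nm_emb.
have -> : emb (cstar a - y.1) = g * emb (cstar a).
  by rewrite (shB (@emb_hom R B)) -emb_of_scalar0// /y; ncring.
rewrite -(@ltr_pXn2r _ 2)// ?nnegrE ?nm_ge0 ?ltW// -nm_Mcs csM (shS (@emb_hom R B)) cstarK.
have -> : g * (emb a)^# * (emb a * g^#) = g * emb (cmul (cstar a) a) * g^#.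
  by rewrite (shcM (@emb_hom R B)) (shS (@emb_hom R B)) cmulE !mulrA.
set t := g * _ in gj *; have := nmM t g^#; rewrite nm_cs.
have n0' : (0 : R) < n%:R by rewrite ltr0n.
have := nm_ge0 t; have := nm_ge0 g => h1 h2 h3.
have h4 : nm (t * g^#) <= nm t by nra.
by rewrite (le_lt_trans h4)// -(ltr_pM2l n0') (le_lt_trans gj).
Qed.

End IdealRegularization.

Section Quotient.
Variables (R : realType) (B : cstarAlgType R) (J : set B).
Hypothesis hJ : is_closed_ideal J.
Implicit Types a b : B.

Definition ideal_rel a b : bool := `[< J (a - b) >].

Fact ideal_rel_equiv : equiv_class_of ideal_rel.
Proof.
split=> [a|a b|b a c].
- by apply/asboolP; rewrite subrr; exact: ideal0.
- by apply/asboolP/asboolP => /(idealN hJ); rewrite opprB.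
- move=> /asboolP h1 /asboolP h2; apply/asboolP.
  by have := idealD hJ h1 h2; rewrite addrA subrK.
Qed.

Canonical ideal_equiv := EquivRelPack ideal_rel_equiv.

Definition quo := {eq_quot ideal_rel}.
HB.instance Definition _ := Choice.on quo.
HB.instance Definition _ := EqQuotient.on quo.

Definition qpi a : quo := \pi_quo a.

Lemma qpi_eq a b : qpi a = qpi b <-> J (a - b).
Proof.
split=> [/eqP|h]; first by rewrite eqmodE => /asboolP.
by apply/eqP; rewrite eqmodE; exact/asboolP.
Qed.

Lemma qpiK x : qpi (repr x) = x. Proof. exact: reprK. Qed.

Lemma J_repr a : J (repr (qpi a) - a).
Proof. by apply/qpi_eq; rewrite qpiK. Qed.

Definition qadd (x y : quo) : quo := qpi (repr x + repr y).
Definition qopp (x : quo) : quo := qpi (- repr x).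
Definition qscale (c : R[i]) (x : quo) : quo := qpi (c *: repr x).
Definition qmul (x y : quo) : quo := qpi (cmul (repr x) (repr y)).
Definition qstar (x : quo) : quo := qpi (cstar (repr x)).

Lemma qaddE a b : qadd (qpi a) (qpi b) = qpi (a + b).
Proof.
apply/qpi_eq; rewrite opprD addrACA.
exact: idealD (J_repr a) (J_repr b).
Qed.
Lemma qoppE a : qopp (qpi a) = qpi (- a).
Proof. by apply/qpi_eq; rewrite -opprD; exact: (idealN hJ (J_repr _)). Qed.
Lemma qscaleE c a : qscale c (qpi a) = qpi (c *: a).
Proof. by apply/qpi_eq; rewrite -scalerBr; exact: (idealZ hJ _ (J_repr _)). Qed.
Lemma qmulE a b : qmul (qpi a) (qpi b) = qpi (cmul a b).
Proof.
apply/qpi_eq; set a' := repr _; set b' := repr _.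
have -> : cmul a' b' - cmul a b = cmul (a' - a) b' + cmul a (b' - b).
  by rewrite cmulDl cmulDr cmulNl cmulNr addrA subrK.
by apply: (idealD hJ); [exact: (idealMr hJ _ (J_repr _)) | exact: (idealMl hJ _ (J_repr _))].
Qed.
Lemma qstarE a : qstar (qpi a) = qpi (cstar a).
Proof. by apply/qpi_eq; rewrite -cstarB; exact: (ideal_star hJ (J_repr _)). Qed.

Lemma qW (P : quo -> Prop) : (forall a, P (qpi a)) -> forall x, P x.
Proof. by move=> h x; rewrite -(qpiK x). Qed.

Fact qaddA : associative qadd.
Proof. by elim/qW=> a; elim/qW=> b; elim/qW=> c; rewrite !qaddE addrA. Qed.
Fact qaddC : commutative qadd.
Proof. by elim/qW=> a; elim/qW=> b; rewrite !qaddE addrC. Qed.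
Fact qadd0 : left_id (qpi 0) qadd.
Proof. by elim/qW=> a; rewrite qaddE add0r. Qed.
Fact qaddN : left_inverse (qpi 0) qopp qadd.
Proof. by elim/qW=> a; rewrite qoppE qaddE addNr. Qed.
HB.instance Definition _ := GRing.isZmodule.Build quo qaddA qaddC qadd0 qaddN.

Fact qscaleA c d x : qscale c (qscale d x) = qscale (c * d) x.
Proof. by elim/qW: x => a; rewrite !qscaleE scalerA. Qed.
Fact qscale1 : left_id 1 qscale.
Proof. by elim/qW=> a; rewrite qscaleE scale1r. Qed.
Fact qscaleDr : right_distributive qscale +%R.
Proof.
by move=> c; elim/qW=> a; elim/qW=> b; rewrite -[qpi a + qpi b]/(qadd _ _) -[RHS]/(qadd _ _) 
  qaddE !qscaleE qaddE scalerDr.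
Qed.
Fact qscaleDl x : {morph qscale^~ x : c d / c + d}.
Proof. by elim/qW: x => a c d; rewrite -[RHS]/(qadd _ _) !qscaleE qaddE scalerDl. Qed.
HB.instance Definition _ :=
  GRing.Zmodule_isLmodule.Build R[i] quo qscaleA qscale1 qscaleDr qscaleDl.

Lemma qpiD a b : qpi (a + b) = qpi a + qpi b. Proof. by rewrite -qaddE. Qed.
Lemma qpiN a : qpi (- a) = - qpi a. Proof. by rewrite -qoppE. Qed.
Lemma qpiB a b : qpi (a - b) = qpi a - qpi b. Proof. by rewrite qpiD qpiN. Qed.
Lemma qpiZ c a : qpi (c *: a) = c *: qpi a. Proof. by rewrite -qscaleE. Qed.

Definition qset (x : quo) : set R := [set nm b | b in [set b | qpi b = x]].
Definition qnm (x : quo) : R := inf (qset x).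

Lemma qset_inf x : has_inf (qset x).
Proof.
split; first by exists (nm (repr x)); exists (repr x) => //=; exact: qpiK.
by exists 0 => _ [b _ <-]; exact: nm_ge0.
Qed.

Lemma qnm_le b : qnm (qpi b) <= nm b.
Proof. by apply: (ge_inf (qset_inf _).2); exists b. Qed.

Lemma qnm_ge0 x : 0 <= qnm x.
Proof. by apply: (lb_le_inf (qset_inf x).1) => _ [b _ <-]; exact: nm_ge0. Qed.

Lemma qnm_lift x (e : R) : 0 < e -> exists2 b, qpi b = x & nm b < qnm x + e.
Proof. by move=> /(inf_adherent)/(_ (qset_inf x))[_ [b bx <-] h]; exists b. Qed.

Lemma qnmD x y : qnm (x + y) <= qnm x + qnm y.
Proof.
apply/ler_addgt0Pr => e e0; have e2 : 0 < e / 2 by rewrite divr_gt0.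
have [a <- ha] := qnm_lift x e2; have [b <- hb] := qnm_lift y e2.
rewrite -qpiD (le_trans (qnm_le _))// (le_trans (nmD _ _))//; lra.
Qed.

Lemma qnmZ c x : qnm (c *: x) = cn c * qnm x.
Proof.
have le (d : R[i]) y : qnm (d *: y) <= cn d * qnm y.
  apply/ler_addgt0Pr => e e0.
  have d1 : 0 < cn d + 1 by rewrite ltr_wpDl// cn_ge0.
  have [a <- ha] := qnm_lift y (divr_gt0 e0 d1).
  rewrite -qpiZ (le_trans (qnm_le _))// nmZ.
  have -> : complex.Re `|d| = cn d by [].
  have := cn_ge0 d; set q := qnm _ in ha *; set n := cn d in d1 ha * => n0.
  rewrite (le_trans (ler_wpM2l n0 (ltW ha)))// mulrDr lerD2l mulrCA.
  by rewrite ler_piMr ?(ltW e0)// ler_pdivrMr// mul1r lerDl.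
apply/eqP; rewrite eq_le le /=.
have [->|c0] := eqVneq c 0; first by rewrite /cn nm0 mul0r qnm_ge0.
have cc : cn c * cn c^-1 = 1 by rewrite -cnM mulfV// cn1.
rewrite -{1}(scale1r x) -(mulVf c0) -scalerA.
by rewrite (le_trans (ler_wpM2l (cn_ge0 _) (le _ _)))// mulrA cc mul1r.
Qed.

Lemma qnm_eq0 x : qnm x = 0 -> x = 0.
Proof.
elim/qW: x => b b0; apply/qpi_eq; rewrite subr0; have [cJ _ _ _ _] := hJ.
apply: (closed_nm cJ) => e e0; have [a /qpi_eq ab ha] := qnm_lift (qpi b) e0.
exists (b - a); first by rewrite -opprB; exact: idealN.
by rewrite opprB addrC subrK -[e]add0r -{1}b0.
Qed.

Fact qnormD x y : (qnm (x + y))%:C <= (qnm x)%:C + (qnm y)%:C.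
Proof. by rewrite -raddfD lecR qnmD. Qed.
Fact qnormZ c x : (qnm (c *: x))%:C = `|c| * (qnm x)%:C.
Proof. by rewrite qnmZ rmorphM cnE. Qed.
Fact qnorm_eq0 x : (qnm x)%:C = 0 -> x = 0.
Proof. by move=> [] /qnm_eq0. Qed.

HB.instance Definition _ := Lmodule_isNormed.Build R[i] quo qnormD qnormZ qnorm_eq0.

Lemma nm_qnm x : nm x = qnm x.
Proof. by []. Qed.

Fact quo_complete (F : set_system quo) : ProperFilter F -> cauchy F -> cvg F.
Proof.
apply: nm_complete => u [C [r [r0 r1 h]]].
(* [r] may be 0; [t] is positive, so each difference has a lift exceeding its norm by at most
   [t ^+ n]. *)
pose t : R := Num.max r 2^-1.
have t0 : 0 < t by rewrite lt_max invr_gt0 ltr0n orbT.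
have t1 : t < 1 by rewrite gt_max r1 invf_lt1// ltr1n.
have /choice[d hd] n : exists d, qpi d = u n.+1 - u n /\ nm d <= (`|C| + 1) * t ^+ n.
  have [d du hd] := qnm_lift (u n.+1 - u n) (exprn_gt0 n t0).
  exists d; split=> //; rewrite (le_trans (ltW hd))// mulrDl mul1r lerD2r.
  rewrite -nm_qnm (le_trans (h n))// (le_trans (ler_wpM2r _ (ler_norm C))) ?exprn_ge0//.
  by rewrite ler_wpM2l// lerXn2r ?nnegrE ?(ltW t0)// le_max lexx.
pose b := fix b n := if n is n'.+1 then b n' + d n' else repr (u 0%N).
have bu n : qpi (b n) = u n.
  elim: n => [|n IH] /=; first exact: qpiK.
  by rewrite qpiD IH (hd n).1 addrC subrK.
have [|l bl] := @geometric_cvg R B b.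
  exists (`|C| + 1), t; split=> //; first exact: ltW.
  by move=> n /=; rewrite addrC addKr (hd n).2.
exists (qpi l) => e /bl[N hN]; exists N => n /hN.
by rewrite -bu -qpiB; apply: le_trans; rewrite nm_qnm qnm_le.
Qed.

HB.instance Definition _ := Uniform_isComplete.Build quo quo_complete.

Fact qmulA : associative qmul.
Proof. by elim/qW=> a; elim/qW=> b; elim/qW=> c; rewrite !qmulE cmulA. Qed.
Fact qmulDl : left_distributive qmul +%R.
Proof. by elim/qW=> a; elim/qW=> b; elim/qW=> c; rewrite -qpiD !qmulE -qpiD cmulDl. Qed.
Fact qmulDr : right_distributive qmul +%R.
Proof. by elim/qW=> a; elim/qW=> b; elim/qW=> c; rewrite -qpiD !qmulE -qpiD cmulDr. Qed.
Fact qmulZl c x y : qmul (c *: x) y = c *: qmul x y.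
Proof. by elim/qW: x => a; elim/qW: y => b; rewrite -qpiZ !qmulE -qpiZ cmulZl. Qed.
Fact qmulZr c x y : qmul x (c *: y) = c *: qmul x y.
Proof. by elim/qW: x => a; elim/qW: y => b; rewrite -qpiZ !qmulE -qpiZ cmulZr. Qed.
Fact qstarK : involutive qstar.
Proof. by elim/qW=> a; rewrite !qstarE cstarK. Qed.
Fact qstarD : {morph qstar : x y / x + y}.
Proof. by elim/qW=> a; elim/qW=> b; rewrite -qpiD !qstarE -qpiD cstarD. Qed.
Fact qstarZ c x : qstar (c *: x) = c^* *: qstar x.
Proof. by elim/qW: x => a; rewrite -qpiZ !qstarE -qpiZ cstarZ. Qed.
Fact qstarM x y : qstar (qmul x y) = qmul (qstar y) (qstar x).
Proof. by elim/qW: x => a; elim/qW: y => b; rewrite !(qmulE, qstarE) cstarM. Qed.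

Lemma qnmM x y : qnm (qmul x y) <= qnm x * qnm y.
Proof.
apply/ler_addgt0Pr => e e0; pose M := qnm x + qnm y + 1.
have x0 := qnm_ge0 x; have y0 := qnm_ge0 y.
have M0 : 0 < M by rewrite ltr_wpDl// addr_ge0.
pose d := Num.min 1 (e / M).
have d0 : 0 < d by rewrite lt_min ltr01 divr_gt0.
have d1 : d <= 1 by rewrite ge_min lexx.
have dM : d * M <= e by rewrite -ler_pdivlMr// ge_min lexx orbT.
have [a ax ha] := qnm_lift x d0; have [b b_y hb] := qnm_lift y d0.
rewrite -{1}ax -{1}b_y qmulE (le_trans (qnm_le _))// (le_trans (nm_cmul _ _))//.
have := nm_ge0 a; have := nm_ge0 b; rewrite /M in dM; nra.
Qed.

Lemma qnm_qstar x : qnm (qstar x) = qnm x.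
Proof.
have le y : qnm (qstar y) <= qnm y.
  apply/ler_addgt0Pr => e e0; have [a <- ha] := qnm_lift y e0.
  by rewrite qstarE (le_trans (qnm_le _))// nm_cstar ltW.
by apply/eqP; rewrite eq_le le -{1}(qstarK x) le.
Qed.

(** Let [y] be a nearly minimal self-adjoint lift of the class of [b^# b] and [j = b^# b - y], an
    element of [J]. The lift [b g] of the class of [b] satisfies
    [(b g)^# (b g) = g^# y g + g^# j g], and the regularizer [g] makes the last term small. *)
Lemma qnm_star_ge x : qnm x ^+ 2 <= qnm (qmul (qstar x) x).
Proof.
elim/qW: x => b; rewrite qstarE qmulE; apply/ler_addgt0Pr => e e0.
have e2 : 0 < e / 2 by rewrite divr_gt0.
have [z /qpi_eq zb hz] := qnm_lift (qpi (cmul (cstar b) b)) e2.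
pose h : R[i] := (2^-1 : R)%:C.
have hh (a : B) : h *: a + h *: a = a.
  by rewrite -scalerDl -rmorphD (_ : _ + _ = 1 :> R) ?scale1r//; lra.
have hs (a : B) : cstar (h *: a) = h *: cstar a.
  by rewrite cstarZ; congr (_ *: _); apply/eqP; rewrite eq_complex /= oppr0 !eqxx.
pose y := h *: (z + cstar z); pose j := cmul (cstar b) b - y.
have ys : cstar y = y by rewrite /y hs cstarD cstarK addrC.
have js : cstar j = j by rewrite /j cstarB ys cstarM cstarK.
have Jj : J j.
  have -> : j = h *: (- (z - cmul (cstar b) b) - cstar (z - cmul (cstar b) b)).
    rewrite /j -{1}(hh (cmul _ _)) /y cstarB cstarM cstarK -scalerDr -scalerBr.
    by rewrite opprB opprD !opprB addrACA; congr (_ *: _); rewrite opprD.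
  by apply: (idealZ hJ); apply: (idealB hJ); [exact: idealN | exact: ideal_star].
have yz : nm y <= nm z.
  rewrite /y nmZr ger0_norm ?invr_ge0// mulrC ler_pdivrMr//.
  by rewrite (le_trans (nmD _ _))// nm_cstar; lra.
have [n n0 hn] := ideal_nat_small e2.
have [g [g1 jg _ Jg _]] := ideal_regularizer hJ n Jj js.
have [g2 Jbg] := Jg (emb b).
have s2 : (emb b * g).2 = 0 by move: g2; rewrite /= !mul0r subr0.
have -> : qpi b = qpi (emb b * g).1.
  by apply/qpi_eq; rewrite -opprB; exact: (idealN hJ Jbg).
rewrite (le_trans (_ : _ <= nm (emb (emb b * g).1) ^+ 2))//.
  by rewrite ler_pXn2r ?nnegrE ?qnm_ge0 ?nm_ge0// nm_emb qnm_le.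
rewrite -emb_of_scalar0// -nm_csM csM.
have -> : g^# * (emb b)^# * (emb b * g) = g^# * emb y * g + g^# * (emb j * g).
  have he := @emb_hom R B.
  rewrite /j (shB he) (shcM he) (shS he) cmulE; ncring.
rewrite (le_trans (nmD _ _))//.
have n0' : (0 : R) < n%:R by rewrite ltr0n.
have h1 := nmM (g^# * emb y) g; have h2 := nmM g^# (emb y).
have h3 := nmM g^# (emb j * g); rewrite nm_cs nm_emb in h2 h3.
have h4 : nm (emb j * g) <= e / 2.
  rewrite -(ler_pM2l n0'); exact: le_trans jg (ltW hn).
have := nm_ge0 g; have := nm_ge0 (emb j * g); have := nm_ge0 y; have := nm_ge0 (g^# * emb y).
nra.
Qed.

Fact qnormM x y : `|qmul x y| <= `|x| * `|y|.
Proof. by rewrite !nmE -rmorphM lecR qnmM. Qed.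
Fact qnorm_star x : `|qmul (qstar x) x| = `|x| ^+ 2.
Proof.
rewrite !nmE -rmorphXn; congr (_%:C); apply/eqP; rewrite eq_le qnm_star_ge andbT.
by rewrite nm_qnm (le_trans (qnmM _ _))// qnm_qstar expr2.
Qed.

HB.instance Definition _ := isCStarAlgebra.Build R quo qmulA qmulDl qmulDr qmulZl qmulZr
  qstarK qstarD qstarZ qstarM qnormM qnorm_star.

Lemma qpi_hom : is_star_hom qpi.
Proof.
split=> [c a b|a b|a]; first by rewrite qpiD qpiZ.
  exact: (esym (qmulE a b)).
exact: (esym (qstarE a)).
Qed.

Lemma qpi_quotient : is_quotient J qpi.
Proof.
split; first exact: qpi_hom; first by move=> x _; exists (repr x) => //; exact: qpiK.
by apply/seteqP; split=> b /=; rewrite -[0](_ : qpi 0 = 0)// qpi_eq subr0.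
Qed.

Lemma nm_qpi b : nm (qpi b) <= nm b.
Proof. exact: qnm_le. Qed.

Section Factor.
Variables (A : cstarAlgType R) (f : B -> A).
Hypotheses (hf : is_star_hom f) (fJ : forall b, J b -> f b = 0).

Definition qfactor (x : quo) : A := f (repr x).

Lemma qfactorE b : qfactor (qpi b) = f b.
Proof. by apply/subr0_eq; rewrite -(shB hf); apply/fJ/J_repr. Qed.

Lemma qfactor_hom : is_star_hom qfactor.
Proof.
have hq := qpi_hom; split=> [c|| ].
- by elim/qW=> a; elim/qW=> b; rewrite -(shZ hq) -(shD hq) !qfactorE (shD hf) (shZ hf).
- by elim/qW=> a; elim/qW=> b; rewrite -(shcM hq) !qfactorE (shcM hf).
- by elim/qW=> a; rewrite -(shS hq) !qfactorE (shS hf).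
Qed.

End Factor.
End Quotient.

(** * Unitaries of corners and the group generated by Cayley transforms *)

Section CayleyGroup.
Variables (R : realType) (A : cstarAlgType R).
Local Notation X := (ucs A).
Implicit Types (x y z k m p q c w Y Z L : X).

Definition in_corner p x := p * x = x /\ x * p = x.

(** A unitary [y] of the corner is represented by [1 - p + y], a unitary of the whole algebra, so
    that unitaries of different corners can be compared. *)
Definition corner_unitary p Y :=
  [/\ Y^# * Y = 1, Y * Y^# = 1 & in_corner p (Y - 1)].

(** The equation [c = (1 + k) (1 - k)^-1], stated without the inverse, which exists by
    [skew_inverse]. *)
Definition cayley_elt p c := [/\ c^# * c = 1, c * c^# = 1 &
  exists k, [/\ k^# = - k, in_corner p k & c * (1 - k) = 1 + k]].

(* The subgroup generated by the Cayley transforms of the skew-adjoint elements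
   of the corner [pXp]. *)
Inductive lam p : X -> Prop :=
| Lam1 : lam p 1
| LamM c Y : cayley_elt p c -> lam p Y -> lam p (c * Y).

Lemma in_cornerS p x : p^# = p -> in_corner p x -> in_corner p x^#.
Proof. by move=> ps [h1 h2]; split; rewrite -{1}ps -csM ?h1 ?h2. Qed.

Lemma in_corner0 p : in_corner p 0.
Proof. by split; rewrite ?mulr0 ?mul0r. Qed.

Lemma in_cornerD p x y : in_corner p x -> in_corner p y -> in_corner p (x + y).
Proof. by move=> [h1 h2] [h3 h4]; split; rewrite ?mulrDr ?mulrDl ?h1 ?h2 ?h3 ?h4. Qed.

Lemma in_cornerN p x : in_corner p x -> in_corner p (- x).
Proof. by move=> [h1 h2]; split; rewrite ?mulrN ?mulNr ?h1 ?h2. Qed.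

Lemma in_cornerM p x y z : p * x = x -> z * p = z -> in_corner p (x * y * z).
Proof. by move=> h1 h2; split; rewrite ?mulrA ?h1 -?mulrA ?h2. Qed.

Lemma in_cornerMM p x z : p * x = x -> z * p = z -> in_corner p (x * z).
Proof. by move=> h1 h2; split; rewrite ?mulrA ?h1 -?mulrA ?h2. Qed.

Lemma in_corner_sub p q x : p * q = q -> q * p = q -> in_corner q x -> in_corner p x.
Proof.
by move=> h1 h2 [h3 h4]; split; [rewrite -h3 mulrA h1 | rewrite -h4 -mulrA h2].
Qed.

Lemma corner_unitary1 p : corner_unitary p 1.
Proof. by rewrite /corner_unitary cs1 mulr1 subrr; split=> //; exact: in_corner0. Qed.

Lemma corner_unitaryM p Y Z :
  corner_unitary p Y -> corner_unitary p Z -> corner_unitary p (Y * Z).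
Proof.
move=> [h1 h2 h3] [h4 h5 h6]; split.
- by rewrite csM -mulrA (mulrA Y^#) h1 mul1r.
- by rewrite csM -mulrA (mulrA Z) h5 mul1r.
have -> : Y * Z - 1 = (Y - 1) * (Z - 1) + ((Y - 1) + (Z - 1)) by ncring.
apply: in_cornerD; last exact: in_cornerD.
by apply: in_cornerMM; [exact: h3.1 | exact: h6.2].
Qed.

Lemma corner_unitaryS p Y : p^# = p -> corner_unitary p Y -> corner_unitary p Y^#.
Proof.
move=> ps [h1 h2 h3]; split; rewrite ?cstarK//.
by have := in_cornerS ps h3; rewrite cstarB cs1.
Qed.

Lemma corner_unitary_comm p Y : corner_unitary p Y -> Y * p = p * Y.
Proof.
case=> _ _ [h1 h2].
by rewrite -{1}[Y](subrK 1) -{2}[Y](subrK 1) mulrDl mulrDr h1 h2 mulr1 mul1r.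
Qed.

Lemma corner_unitary_sub p q Y : p * q = q -> q * p = q ->
  corner_unitary q Y -> corner_unitary p Y.
Proof. by move=> h1 h2 [h3 h4 h5]; split=> //; exact: in_corner_sub h5. Qed.

Lemma cayley_unitary p c : p^# = p -> cayley_elt p c -> corner_unitary p c.
Proof.
move=> ps [h1 h2 [k [ks [pk kp] hc]]]; split=> //.
have aux d l : l^# = - l -> p * l = l -> l * p = l -> d * (1 - l) = 1 + l -> p * (d - 1) = d - 1.
  move=> ls pl lp hd; have [g hg] := skew_inverse ls.
  have -> : d - 1 = (l + l) * g.
    have -> : d = (1 + l) * g by rewrite -hd -mulrA hg.2 mulr1.
    by rewrite -[X in _ - X]hg.2; ncring.
  by rewrite mulrA mulrDr pl.
split; first exact: aux ks pk kp hc.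
have hc' : c^# * (1 - - k) = 1 + - k.
  by rewrite opprK -hc mulrA h1 mul1r.
have := @aux c^# (- k); rewrite csN ks !mulrN mulNr pk kp => /(_ erefl erefl erefl hc') h.
by rewrite -[LHS]cstarK csM ps cstarB cs1 h cstarB cs1 cstarK.
Qed.

Lemma lam_unitary p Y : p^# = p -> lam p Y -> corner_unitary p Y.
Proof.
move=> ps; elim=> [|c {}Y hc _ IH]; first exact: corner_unitary1.
by apply: corner_unitaryM => //; exact: cayley_unitary.
Qed.

Lemma lam_cayley p c : cayley_elt p c -> lam p c.
Proof. by move=> hc; rewrite -[c]mulr1; apply: LamM => //; exact: Lam1. Qed.

Lemma lamMM p Y Z : lam p Y -> lam p Z -> lam p (Y * Z).
Proof.
by move=> hY hZ; elim: hY => [|c {}Y hc _ IH]; rewrite ?mul1r// -mulrA; exact: LamM.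
Qed.

Lemma lamS p Y : lam p Y -> lam p Y^#.
Proof.
elim=> [|c {}Y [h1 h2 [k [ks hk hc]]] _ IH]; first by rewrite cs1; exact: Lam1.
rewrite csM; apply: lamMM => //; apply: lam_cayley; split; rewrite ?cstarK//.
exists (- k); split; first by rewrite csN ks.
  exact: in_cornerN.
by rewrite opprK -hc mulrA h1 mul1r.
Qed.

Lemma lam_sub p q Y : p * q = q -> q * p = q -> lam q Y -> lam p Y.
Proof.
move=> h1 h2; elim=> [|c {}Y [h3 h4 [k [ks hk hc]]] _ IH]; first exact: Lam1.
apply: LamM => //; split=> //; exists k; split=> //; exact: in_corner_sub hk.
Qed.

Lemma conj_corner w p Y Z : w^# * w = p -> in_corner p (Y - 1) -> in_corner p (Z - 1) ->
  (1 + w * (Y - 1) * w^#) * (1 + w * (Z - 1) * w^#) = 1 + w * (Y * Z - 1) * w^#.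
Proof.
move=> hw [_ yp] _.
have -> a b : (1 + a) * (1 + b) = 1 + (a + b + a * b) :> X by ncring.
have -> : w * (Y - 1) * w^# * (w * (Z - 1) * w^#) = w * (Y - 1) * (Z - 1) * w^#.
  by rewrite !mulrA -(mulrA _ w^# w) hw -(mulrA w _ p) yp.
ncring.
Qed.

Lemma lam_conj w p q Y : proj_elt p -> w^# * w = p -> w * w^# = q -> lam p Y ->
  lam q (1 + w * (Y - 1) * w^#).
Proof.
move=> hp hw hq; have wp := piso_mul hp hw; have [ps pp] := hp.
have pw : p * w^# = w^# by rewrite -{1}ps -csM wp.
have qw : q * w = w by rewrite -hq -mulrA hw.
have wq : w^# * q = w^# by rewrite -hq mulrA hw.
elim=> [|c {}Y hc hY IH]; first by rewrite subrr mulr0 mul0r addr0; exact: Lam1.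
have [h1 h2 [k [ks [pk kp] hk]]] := hc.
have [_ _ cp] := cayley_unitary ps hc; have [_ _ yp] := lam_unitary ps hY.
have [_ _ csp] := corner_unitaryS ps (cayley_unitary ps hc).
rewrite -(conj_corner hw cp yp); apply: LamM => //.
have S d : (1 + w * (d - 1) * w^#)^# = 1 + w * (d^# - 1) * w^#.
  by rewrite cstarD cs1 !csM cstarK cstarB cs1 mulrA.
split.
- by rewrite S (conj_corner hw csp cp) h1 subrr mulr0 mul0r addr0.
- by rewrite S (conj_corner hw cp csp) h2 subrr mulr0 mul0r addr0.
exists (w * k * w^#); split.
- by rewrite !csM cstarK ks mulNr mulrN mulrA.
- exact: in_cornerM.
have -> a b : (1 + a) * (1 - b) = 1 + (a - b - a * b) :> X by ncring.
have -> : w * (c - 1) * w^# * (w * k * w^#) = w * ((c - 1) * k) * w^#.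
  by rewrite !mulrA -(mulrA _ w^# w) hw -(mulrA w _ p) cp.2.
have ck : (c - 1) * k = c - 1 - k - k.
  have -> : (c - 1) * k = c - k - c * (1 - k) by ncring.
  by rewrite hk; ncring.
rewrite ck; ncring.
Qed.

Lemma lam_normal p Y Z : proj_elt p -> corner_unitary p Z -> lam p Y -> lam p (Z * Y * Z^#).
Proof.
move=> hp hZ hY; have [ps pp] := hp; have [z1 z2 z3] := hZ.
have zp := corner_unitary_comm hZ.
have zps : (Z * p)^# = p * Z^# by rewrite csM ps.
have w1 : (Z * p)^# * (Z * p) = p by rewrite zps !mulrA -(mulrA p) z1 mulr1 pp.
have w2 : (Z * p) * (Z * p)^# = p.
  by rewrite zps mulrA -(mulrA Z) pp zp -mulrA z2 mulr1.
have [_ _ [h1 h2]] := lam_unitary ps hY.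
suff -> : Z * Y * Z^# = 1 + (Z * p) * (Y - 1) * (Z * p)^# by exact: lam_conj hp w1 w2 hY.
rewrite zps -(mulrA Z p) h1 mulrA -(mulrA Z _ p) h2 mulrBr mulr1 mulrBl z2; ncring.
Qed.

(** [1 + Y] is twice [1 + (Y - 1) / 2], hence invertible, and [Y] is the Cayley transform of
    [(Y - 1) (1 + Y)^-1]. *)
Lemma lam_near p Y : corner_unitary p Y -> nm (Y - 1) < 1 -> lam p Y.
Proof.
move=> [y1 y2 [py yp]] h; apply: lam_cayley; split=> //.
pose hf : R[i] := (2^-1 : R)%:C.
have hh z : hf *: z + hf *: z = z.
  by rewrite -scalerDl -rmorphD (_ : _ + _ = 1 :> R) ?scale1r//; lra.
have [|g0 [g1 g2] _] := @neumann R A (- (hf *: (Y - 1))).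
  rewrite nmN nmZr ger0_norm ?invr_ge0//; have := nm_ge0 (Y - 1); lra.
pose g := hf *: g0.
have E : 1 - - (hf *: (Y - 1)) = hf *: (1 + Y).
  by rewrite opprK -{1}(hh 1) -!scalerDr; congr (_ *: _); ncring.
have hg : inverse_of (1 + Y) g.
  by rewrite E csclAr in g1; rewrite E csclAl in g2; split; rewrite /g ?csclAl ?csclAr.
have gY : g * Y = Y * g by apply: (inverse_comm hg); ncring.
pose k := (Y - 1) * g; have ky : k = g * (Y - 1) by rewrite /k mulrBl mulrBr gY; ncring.
have e1 : 1 - k = g + g by rewrite -hg.2 /k; ncring.
have e2 : 1 + k = Y * g + Y * g by rewrite -{1}hg.2 /k; ncring.
exists k; split; last by rewrite e1 e2; ncring.
- have hgs : inverse_of (1 + Y)^# g^# := inverse_cs hg.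
  have E2 : Y * (1 + Y)^# = 1 + Y by rewrite cstarD cs1 mulrDr mulr1 y2 addrC.
  have g3 : g^# = Y * g.
    have : inverse_of (1 + Y)^# (Y * g).
      split; first by rewrite -gY -mulrA E2 hg.1.
      by rewrite mulrA cstarD cs1 mulrDl mul1r y1 addrC hg.2.
    exact: inverse_uniq.
  rewrite ky csM g3 cstarB cs1 mulrA mulrBl y1 mul1r -ky /k -mulNr.
  by congr (_ * _); ncring.
- by split; [rewrite /k mulrA py | rewrite ky -mulrA yp].
Qed.

(** For a partial isometry [m] with [m^2 = 0], the element [k = m - m^#] has [k^3 = - k], so
    [(1 + k + k^2) (1 - k) = 1 + k] and this is the Cayley transform of [k]. It is a quarter turn
    from the initial space of [m] to its range, and the identity off both. *)
Definition rot m := 1 + (m - m^#) + (m - m^#) * (m - m^#).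

Lemma lam_rot p m : p^# = p -> in_corner p m -> m * m^# * m = m -> m * m = 0 -> lam p (rot m).
Proof.
move=> ps pm m3 m2; apply: lam_cayley.
have m2s : m^# * m^# = 0 by rewrite -csM m2 cstar0.
have m3s : m^# * m * m^# = m^# by rewrite -[RHS](congr1 cstar m3) !csM cstarK mulrA.
rewrite /rot; set k := m - m^#.
have ks : k^# = - k by rewrite /k cstarB cstarK opprB.
have k3 : k * k * k = - k.
  rewrite /k !(mulrBl, mulrBr) !(m3, m3s, m2, m2s, mulKeq m2, mulKeq m2s, mul0r, mulr0).
  ncring.
have pk : in_corner p k by apply: in_cornerD => //; apply/in_cornerN/in_cornerS.
clearbody k.
split; last exists k; last split=> //.
- rewrite !cstarD cs1 csM ks.
  transitivity (1 + k * k + k * k * k * k); first ncring.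
  by rewrite k3; ncring.
- rewrite !cstarD cs1 csM ks.
  transitivity (1 + k * k + k * k * k * k); first ncring.
  by rewrite k3; ncring.
have -> : (1 + k + k * k) * (1 - k) = 1 - k * k * k by ncring.
by rewrite k3 opprK.
Qed.

Lemma rot_mul m x : m * m = 0 -> m^# * m * x = x -> rot m * x = m * x.
Proof.
move=> m2 mx; have m2s : m^# * m^# = 0 by rewrite -csM m2 cstar0.
have mx0 : m^# * x = 0 by rewrite -mx !mulrA m2s !mul0r.
have kx : (m - m^#) * x = m * x by rewrite mulrBl mx0 subr0.
have kkx : (m - m^#) * (m - m^#) * x = - x.
  by rewrite -mulrA kx mulrBl !mulrA m2 mx mul0r sub0r.
rewrite /rot mulrDl kkx mulrDl mul1r kx; ncring.
Qed.

(** Take [rot m] for [m = z1 y1^# + z2 y2^#]; [m^2 = 0] because sources and targets are orthogonal.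
    Two pairs are moved at once since [sequence_lift] has to place a new partial isometry together
    with a new reserve. *)
Lemma lam_transport p y1 y2 z1 z2 : proj_elt p ->
  proj_elt (y1^# * y1) -> proj_elt (y2^# * y2) ->
  z1^# * z1 = y1^# * y1 -> z2^# * z2 = y2^# * y2 ->
  y1^# * y2 = 0 -> z1^# * z2 = 0 ->
  y1^# * z1 = 0 -> y1^# * z2 = 0 -> y2^# * z1 = 0 -> y2^# * z2 = 0 ->
  p * y1 = y1 -> p * y2 = y2 -> p * z1 = z1 -> p * z2 = z2 ->
  exists L, [/\ lam p L, L * y1 = z1 & L * y2 = z2].
Proof.
move=> [ps pp] hp1 hp2 zy1 zy2 y12 z12 yz11 yz12 yz21 yz22 py1 py2 pz1 pz2.
have S (a b : X) : a^# * b = 0 -> b^# * a = 0.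
  by move=> /(congr1 cstar); rewrite csM cstarK cstar0.
pose m := z1 * y1^# + z2 * y2^#.
have ys1 : y1 * (y1^# * y1) = y1 := piso_mul hp1 erefl.
have ys2 : y2 * (y2^# * y2) = y2 := piso_mul hp2 erefl.
have zs1 : z1 * (y1^# * y1) = z1 := piso_mul hp1 zy1.
have zs2 : z2 * (y2^# * y2) = z2 := piso_mul hp2 zy2.
have ms : m^# = y1 * z1^# + y2 * z2^# by rewrite /m cstarD !csM !cstarK.
have my1 : m * y1 = z1 by rewrite /m mulrDl -!mulrA zs1 (S _ _ y12) mulr0 addr0.
have my2 : m * y2 = z2 by rewrite /m mulrDl -!mulrA zs2 y12 mulr0 add0r.
have mz1 : m^# * z1 = y1 by rewrite ms mulrDl -!mulrA zy1 ys1 (S _ _ z12) mulr0 addr0.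
have mz2 : m^# * z2 = y2 by rewrite ms mulrDl -!mulrA zy2 ys2 z12 mulr0 add0r.
have m2 : m * m = 0.
  have h1 : m * z1 = 0 by rewrite /m mulrDl -!mulrA yz11 yz21 !mulr0 addr0.
  have h2 : m * z2 = 0 by rewrite /m mulrDl -!mulrA yz12 yz22 !mulr0 addr0.
  by rewrite {2}/m mulrDr !mulrA h1 h2 !mul0r addr0.
exists (rot m); split.
- apply: lam_rot => //.
  + by apply: in_cornerD; apply: in_cornerMM => //; rewrite -{1}ps -csM ?py1 ?py2.
  + by rewrite {3}/m mulrDr !mulrA -(mulrA m _ z1) -(mulrA m _ z2) mz1 mz2 my1 my2.
- by rewrite rot_mul ?my1// -mulrA my1 mz1.
- by rewrite rot_mul ?my2// -mulrA my2 mz2.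
Qed.

Definition lam_eq p Y Z := lam p (Y * Z^#).

Lemma lam_eq_refl p Y : corner_unitary p Y -> lam_eq p Y Y.
Proof. by case=> _ h _; rewrite /lam_eq h; exact: Lam1. Qed.

Lemma lam_eq_sym p Y Z : lam_eq p Y Z -> lam_eq p Z Y.
Proof. by move=> /lamS; rewrite csM cstarK. Qed.

Lemma lam_eq_trans p Y Z W : corner_unitary p Z -> lam_eq p Y Z -> lam_eq p Z W -> lam_eq p Y W.
Proof.
move=> [h _ _] h1 h2; have := lamMM h1 h2.
by rewrite -mulrA (mulrA Z^#) h mul1r.
Qed.

Lemma lam_eq_near p Y Z : p^# = p -> corner_unitary p Y -> corner_unitary p Z ->
  nm (Y - Z) < 1 -> lam_eq p Y Z.
Proof.
move=> ps hY hZ h; apply: lam_near; first by apply: corner_unitaryM => //; exact: corner_unitaryS.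
have [z1 z2 _] := hZ.
rewrite -z2 -mulrBl (le_lt_trans (nmM _ _))//.
by rewrite nm_cs (nm_isometry z1) mulr1.
Qed.

Lemma lam_eq_conj p L Y : proj_elt p -> lam p L -> corner_unitary p Y -> lam_eq p (L * Y * L^#) Y.
Proof.
by move=> hp hL hY; rewrite /lam_eq -!mulrA; apply: lamMM => //; rewrite mulrA;
  apply: lam_normal => //; exact: lamS.
Qed.

Lemma lam_eq_mull p L Y : lam p L -> corner_unitary p Y -> lam_eq p (L * Y) Y.
Proof. by move=> hL [_ h _]; rewrite /lam_eq -mulrA h mulr1. Qed.

End CayleyGroup.

(** * Lifting [lam] and sequences of partial isometries along a surjection *)

Section Lifting.
Variables (R : realType) (B A : cstarAlgType R) (f : ucs B -> ucs A).
Hypotheses (uf : unital_hom f) (fsurj : forall x, exists y, f y = x).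

(** The generators lift one by one: for any preimage [h0] of [k], the element [p (h0 - h0^#) p / 2]
    is skew-adjoint, lies in the corner and still maps to [k]; its Cayley transform maps to [c]. *)
Lemma lam_lift (p : ucs B) Y : proj_elt p -> lam (f p) Y ->
  exists2 Z, corner_unitary p Z & f Z = Y.
Proof.
have [hf f1] := uf; move=> [ps pp].
elim=> [|c {}Y [c1 c2 [k [ks [pk kp] ck]]] _ [Z hZ fZ]].
  by exists 1 => //; exact: corner_unitary1.
have [h0 fh0] := fsurj k.
pose hf2 : R[i] := (2^-1 : R)%:C.
have hh (z : ucs A) : hf2 *: z + hf2 *: z = z.
  by rewrite -scalerDl -rmorphD (_ : _ + _ = 1 :> R) ?scale1r//; lra.
pose h := hf2 *: (p * (h0 - h0^#) * p).
have hs : h^# = - h.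
  rewrite /h csZr !csM ps cstarB cstarK mulrA -scalerN; congr (_ *: _).
  by rewrite -mulNr -mulrN opprB.
have hp : in_corner p h.
  split; first by rewrite /h csclAr !mulrA pp.
  by rewrite /h csclAl -mulrA pp.
have fh : f h = k.
  rewrite /h (shZ hf) !(shM _ _ hf) (shB hf) (shS hf) fh0 ks opprK.
  by rewrite mulrDr mulrDl pk kp scalerDr hh.
have [g hg] := skew_inverse hs; have [u1 u2] := skew_inverse_bound hs hg.
exists ((1 + h) * g * Z).
  apply: corner_unitaryM => //; apply: (cayley_unitary ps); split=> //.
  by exists h; split=> //; rewrite -mulrA hg.1 mulr1.
rewrite (shM _ _ hf) fZ; congr (_ * Y).
have [g' hg'] := skew_inverse ks.
have fg : inverse_of (1 - k) (f g).
  by rewrite -fh -f1 -(shB hf); split; rewrite -(shM _ _ hf) ?hg.1 ?hg.2.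
by rewrite (shM _ _ hf) (shD hf) f1 fh -ck -mulrA fg.2 mulr1.
Qed.

Variables (G o r : ucs B) (v al : nat -> ucs B) (be : ucs B).
Variables (w ka : nat -> ucs A).
Hypotheses (hG : proj_elt G) (ho : proj_elt o) (hv : forall n, proj_elt (v n)).
Hypotheses (al_iso : forall n, (al n)^# * al n = v n) (oal : forall n, o * al n = al n).
Hypotheses (be_iso : be^# * be = o) (obe : o * be = be).
Hypothesis be_al : forall n, be^# * al n = 0.
Hypotheses (r_iso : r^# * r = o) (Gr : G * r = r) (fr : f r = w 0 * ka 0).
Hypotheses (w_iso : forall n, (w n)^# * w n = f (v n)) (Gw : forall n, f G * w n = w n).
Hypothesis w_orth : forall n m, n <> m -> (w n)^# * w m = 0.
Hypotheses (ka_iso : forall n, (ka n)^# * ka n = f o) (vka : forall n, f (v n) * ka n = ka n).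

(* After [n] steps, [x.1] is the part of [G] not yet used and the reserve [x.2] lifts
   [w n * ka n].  A unitary in [lam x.1] moves the two orthogonal pieces [x.2 * al n] and
   [x.2 * be] first far out, onto ranges beyond those in use, and then onto lifts of [w n] and
   [w n.+1 * ka n.+1]. *)
Let state n (x : ucs B * ucs B) :=
  [/\ proj_elt x.1, forall k, (n <= k)%N -> f x.1 * w k = w k,
      x.2^# * x.2 = o, x.1 * x.2 = x.2 & f x.2 = w n * ka n].

Let fproj x : proj_elt x -> proj_elt (f x).
Proof.
have [hf _] := uf; move=> [h1 h2].
by split; rewrite -?(shS hf) -?(shM _ _ hf) ?h1 ?h2.
Qed.

Let orth_absorb (x y z t : ucs A) : (x^# * y = 0) -> (x * z)^# * (y * t) = 0.
Proof. by move=> h; rewrite csM -mulrA (mulrA x^#) h mul0r mulr0. Qed.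

Let step n x : state n x -> exists (w' : ucs B) (y : ucs B * ucs B), [/\ state n.+1 y,
  w'^# * w' = v n, x.1 * w' = w', f w' = w n & y.1 = x.1 - w' * w'^#].
Proof.
case: x => g s [/= hg gw s_iso gs fs]; have [hf f1] := uf; have [gsa gg] := hg.
pose a k := w k * ka k.
have a_iso k : (a k)^# * a k = f o.
  by rewrite /a csM -mulrA (mulrA _ (w k)) w_iso vka ka_iso.
have a_orth k l (y z : ucs A) : k <> l -> (a k * y)^# * (a l * z) = 0.
  by move=> kl; apply/orth_absorb/orth_absorb/w_orth.
have ga k y : (n <= k)%N -> f g * (a k * y) = a k * y.
  by move=> nk; rewrite /a !mulrA gw.
have aal k : (a k * f (al n))^# * (a k * f (al n)) = f (v n).
  rewrite csM -mulrA (mulrA _ (a k)) a_iso -(shM _ _ hf) oal -(shS hf).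
  by rewrite -(shM _ _ hf) al_iso.
have abe k : (a k * f be)^# * (a k * f be) = f o.
  rewrite csM -mulrA (mulrA _ (a k)) a_iso -(shM _ _ hf) obe -(shS hf).
  by rewrite -(shM _ _ hf) be_iso.
have aalbe k : (a k * f (al n))^# * (a k * f be) = 0.
  rewrite csM -mulrA (mulrA _ (a k)) a_iso -(shM _ _ hf) obe -(shS hf).
  rewrite -(shM _ _ hf) -[X in f X]cstarK csM cstarK be_al cstar0; exact: sh0 hf.
have fv : proj_elt (f (v n)) := fproj (hv n).
have fo : proj_elt (f o) := fproj ho.
have wn k y : (n <> k) -> (w n)^# * (a k * y) = 0.
  by move=> nk; rewrite /a !mulrA w_orth// !mul0r.
have wn' k y : (n <> k) -> (a k * y)^# * w n = 0.
  by move=> nk; rewrite -[LHS]cstarK csM cstarK wn// cstar0.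
have aE k : w k * ka k = a k by [].
clearbody a.
(* A direct move onto [w n] is impossible: [lam_transport] wants sources orthogonal to targets, and
   [a n] lies under the range of [w n]. The indices [n.+2] and [n.+3] avoid both the sources and the
   final targets. *)
have [||||||||||||||L1 [hL1 L1a L1b]] := @lam_transport R A (f g)
    (a n * f (al n)) (a n * f be) (a n.+2 * f (al n)) (a n.+3 * 1) (fproj hg).
- by rewrite aal.
- by rewrite abe.
- by rewrite !aal.
- by rewrite mulr1 a_iso abe.
- exact: aalbe.
- by apply: a_orth; lia.
- by apply: a_orth; lia.
- by apply: a_orth; lia.
- by apply: a_orth; lia.
- by apply: a_orth; lia.
- exact: ga.
- exact: ga.
- by apply: ga; lia.
- by apply: ga; lia.
have [||||||||||||||L2 [hL2 L2a L2b]] := @lam_transport R A (f g)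
    (a n.+2 * f (al n)) (a n.+3 * 1) (w n) (a n.+1 * 1) (fproj hg).
- by rewrite aal.
- by rewrite mulr1 a_iso.
- by rewrite aal w_iso.
- by rewrite !mulr1 !a_iso.
- by apply: a_orth; lia.
- by apply: wn; lia.
- by apply: wn'; lia.
- by apply: a_orth; lia.
- by apply: wn'; lia.
- by apply: a_orth; lia.
- by apply: ga; lia.
- by apply: ga; lia.
- exact: gw.
- by apply: ga; lia.
have [L hL fL] := lam_lift hg (lamMM hL2 hL1).
have [Lu1 Lu2 _] := hL; have Lg := corner_unitary_comm hL.
pose w' := L * s * al n; pose s' := L * s * be.
have gw' : g * w' = w' by rewrite /w' !mulrA -Lg -(mulrA L) gs.
have gs' : g * s' = s' by rewrite /s' !mulrA -Lg -(mulrA L) gs.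
have iso y z : (L * s * y)^# * (L * s * z) = y^# * (o * z).
  rewrite csM csM -!mulrA; congr (_ * _); rewrite !mulrA -(mulrA _ L^#) Lu1 mulr1.
  by rewrite s_iso.
have w'_iso : w'^# * w' = v n by rewrite iso oal al_iso.
have w's' : w'^# * s' = 0.
  by rewrite iso obe -[LHS]cstarK csM cstarK be_al cstar0.
have fw' : f w' = w n.
  by rewrite /w' !(shM _ _ hf) fL fs aE -!mulrA L1a L2a.
have fs' : f s' = a n.+1.
  by rewrite /s' !(shM _ _ hf) fL fs aE -!mulrA L1b L2b mulr1.
have s'_iso : s'^# * s' = o by rewrite iso obe be_iso.
clearbody w' s'.
have w'g : w'^# * g = w'^# by rewrite -{1}gsa -csM gw'.
exists w', (g - w' * w'^#, s'); split=> //; split=> //=.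
- split; first by rewrite cstarB csM cstarK gsa.
  rewrite mulrBl !mulrBr gg !mulrA gw' -(mulrA w') w'g -(mulrA w') w'_iso.
  by rewrite (piso_mul (hv n) w'_iso); ncring.
- move=> k nk; rewrite (shB hf) mulrBl gw; last lia.
  rewrite (shM _ _ hf) (shS hf) fw' -mulrA w_orth ?mulr0 ?subr0//; lia.
- by rewrite mulrBl gs' -mulrA w's' mulr0 subr0.
- by rewrite fs' aE.
Qed.

Lemma sequence_lift : exists w' : nat -> ucs B,
  [/\ forall n, (w' n)^# * w' n = v n, forall n, G * w' n = w' n,
      forall n m, n <> m -> (w' n)^# * w' m = 0 & forall n, f (w' n) = w n].
Proof.
(* [F] has to be total for the recursion below; it takes the value zero where [state] fails. *)
have /choice[F hF] (x : nat * (ucs B * ucs B)) : exists wy : ucs B * (ucs B * ucs B),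
    state x.1 x.2 -> [/\ state x.1.+1 wy.2,
      wy.1^# * wy.1 = v x.1, x.2.1 * wy.1 = wy.1, f wy.1 = w x.1 &
      wy.2.1 = x.2.1 - wy.1 * wy.1^#].
  case: (pselect (state x.1 x.2)) => [/step[w' [y h]]|h]; last by exists (0, (0, 0)).
  by exists (w', y).
pose st := fix st n := if n is n'.+1 then (F (n', st n')).2 else (G, r).
have hst n : state n (st n).
  by elim: n => [|n IH] /=; [split=> //= k _; exact: Gw | have [] := hF (n, st n) IH].
pose w' n := (F (n, st n)).1.
have [hf _] := uf.
have hw n := hF (n, st n) (hst n).
have sub n m : (n <= m)%N -> (st n).1 * (st m).1 = (st m).1.
  move=> /subnKC <-; elim: (m - n)%N => [|k IH].
    by rewrite addn0; have [[_ ->]] := hst n.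
  have [_ _ h3 _ h4] := hw (n + k)%N; rewrite addnS /= h4 mulrBr IH mulrA.
  by rewrite -[in LHS]h3 /= mulrA IH h3.
have gw n : (st n).1 * w' n = w' n by have [_ _ h _ _] := hw n.
have orth n m : (n < m)%N -> (w' n)^# * w' m = 0.
  move=> nm; have [_ h2 h3 _ h4] := hw n; rewrite -/(w' n) /= in h2 h3 h4.
  have [[gs _] _ _ _ _] := hst n.
  have wg : (w' n)^# * (st n).1 = (w' n)^# by rewrite -[in LHS]gs -csM h3.
  have vw : v n * (w' n)^# = (w' n)^#.
    by have [vs _] := hv n; rewrite -{1}vs -csM (piso_mul (hv n) h2).
  have : (w' n)^# * (st n.+1).1 = 0 by rewrite /= h4 mulrBr wg mulrA h2 vw subrr.
  by rewrite -(gw m) -(sub _ _ nm) !mulrA => ->; rewrite !mul0r.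
exists w'; split.
- by move=> n; have [_ h _ _ _] := hw n.
- by move=> n; rewrite -(gw n) mulrA (sub 0%N).
- move=> n m; case: (ltngtP n m) => // [/orth//|/orth h _].
  by rewrite -[LHS]cstarK csM cstarK h cstar0.
- by move=> n; have [_ _ _ h _] := hw n.
Qed.

End Lifting.

(** * Projections as extreme points, and projections adding up to a projection *)

Section Extremality.
Variables (R : realType) (A : cstarAlgType R).
Local Notation X := (ucs A).
Implicit Types z a b p : X.

Let cube z b : z * z = z -> z * b = b -> b * z = b -> (z + b) * (z + b) * (z + b) =
  z + (b + b + b) + (b * b + b * b + b * b) + b * b * b.
Proof.
move=> zz zb bz; have -> : (z + b) * (z + b) = z + b + b + b * b.
  by rewrite mulrDl !mulrDr zz zb bz; ncring.
by rewrite !(mulrDl, mulrDr) zz zb bz -(mulrA b b z) bz; ncring.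
Qed.

Let nm_cube (x : X) : nm x <= 1 -> nm (x * x * x) <= 1.
Proof.
move=> h; have := nmM (x * x) x; have := nmM x x.
have := nm_ge0 x; have := nm_ge0 (x * x); nra.
Qed.

Let unit_pm z a := [/\ a^# = a, z * a = a, a * z = a, nm (z + a) <= 1 & nm (z - a) <= 1].

Let unit_pm_nm z a : unit_pm z a -> nm a <= 1.
Proof.
move=> [_ _ _ h1 h2]; apply: nm_half; have -> : a + a = (z + a) - (z - a) by ncring.
by rewrite (le_trans (nmB _ _))//; lra.
Qed.

(* Averaging [(z + t a)^3], of norm at most 1, over the fourth roots of unity [t]
   with weights 2, 1, 0, 1 gives [z + (3 a + a^3) / 2]. *)
Let unit_pm_grow z a : proj_elt z -> unit_pm z a ->
  exists2 a', unit_pm z a' & 4 / 3 * nm a <= nm a'.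
Proof.
move=> [zs zz] ha; have a1 := unit_pm_nm ha; have [as_ za az h1 h2] := ha.
pose j : X := 'i%C *: (1 : X).
have jc y : j * y = y * j by rewrite /j csclAl csclAr mul1r mulr1.
have jj : j * j = - 1 by rewrite /j csclAl mul1r scalerA -expr2 sqr_i scaleN1r.
have js : j^# = - j.
  rewrite /j cstarZ cs1 -scaleNr; congr (_ *: _).
  by apply/eqP; rewrite eq_complex /= oppr0 !eqxx.
pose b := a * j.
have bb : b * b = - (a * a) by rewrite /b -mulrA (mulrA j) jc -!mulrA jj; ncring.
have zb : z * b = b by rewrite /b mulrA za.
have bz : b * z = b by rewrite /b -mulrA jc mulrA az.
have bs : b^# = - b by rewrite /b csM js as_ mulNr jc.
clearbody b.
have zaa : nm (z + a * a) <= 1.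
  apply: nm_half; have -> : z + a * a + (z + a * a) = (z + a) * (z + a) + (z - a) * (z - a).
    by rewrite mulrBl !mulrBr mulrDl !mulrDr zz za az; ncring.
  have := nmD ((z + a) * (z + a)) ((z - a) * (z - a)).
  have := nmM (z + a) (z + a); have := nmM (z - a) (z - a).
  have := nm_ge0 (z + a); have := nm_ge0 (z - a); nra.
have zb1 : nm (z + b) <= 1.
  rewrite -(@ler_pXn2r _ 2)// ?nnegrE ?nm_ge0// expr1n -nm_csM cstarD zs bs.
  suff -> : (z + - b) * (z + b) = z + a * a by [].
  by rewrite mulrDl !mulrDr zz zb mulNr bz mulNr bb; ncring.
have zb2 : nm (z - b) <= 1.
  have -> : z - b = (z + b)^# by rewrite cstarD zs bs.
  by rewrite nm_cs.
have zN c : z * c = c -> z * - c = - c by rewrite mulrN => ->.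
have Nz c : c * z = c -> - c * z = - c by rewrite mulNr => ->.
have ca := cube zz za az; have caN := cube zz (zN _ za) (Nz _ az).
have cb := cube zz zb bz; have cbN := cube zz (zN _ zb) (Nz _ bz).
have na := nm_cube h1; have naN := nm_cube h2; have nb := nm_cube zb1; have nbN := nm_cube zb2.
rewrite ca in na; rewrite caN in naN; rewrite cb in nb; rewrite cbN in nbN.
have bbb : b * b * b = - (a * a * b) by rewrite bb mulNr.
(* The cubes at the roots 1 and -1 minus those at the two imaginary roots leave [12 a^2], of norm at
   most 4. *)
have aa3 : nm (a * a) <= 3^-1.
  have h : nm ((a * a + a * a + a * a) *+ 4) <= 4.
    have -> : (a * a + a * a + a * a) *+ 4 =
        (z + (a + a + a) + (a * a + a * a + a * a) + a * a * a) +
        (z + (- a + - a + - a) + (- a * - a + - a * - a + - a * - a) + - a * - a * - a) -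
        ((z + (b + b + b) + (b * b + b * b + b * b) + b * b * b) +
        (z + (- b + - b + - b) + (- b * - b + - b * - b + - b * - b) + - b * - b * - b)).
      have -> : - b * - b = b * b by ncring.
      by rewrite bb !mulrSr mulr0n; ncring.
    rewrite (le_trans (nmB _ _))// (_ : 4 = (1 + 1) + (1 + 1)); last by ring.
    by rewrite lerD// (le_trans (nmD _ _))// lerD.
  move: h; have -> : (a * a + a * a + a * a) *+ 4 = (12%:R : R)%:C *: (a * a).
    by rewrite rmorph_nat scaler_nat -mulr2n -mulrSr -mulrnA.
  by rewrite nmZr ger0_norm//; lra.
pose h : R[i] := (2^-1 : R)%:C.
have hh x : h *: x + h *: x = x.
  by rewrite -scalerDl -rmorphD (_ : _ + _ = 1 :> R) ?scale1r//; lra.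
pose t := a + a + a + a * a * a; pose a' := h *: t.
have a't : a' + a' = t by exact: hh.
have zt : z * t = t by rewrite /t !mulrDr !mulrA za.
have tz : t * z = t by rewrite /t !mulrDl -!mulrA az.
exists a'; first split.
- by rewrite /a' csZr; congr (_ *: _); rewrite /t !cstarD !csM as_ mulrA.
- by rewrite /a' csclAr zt.
- by rewrite /a' csclAl tz.
- apply: nm_half; apply: nm_half.
  have -> : z + a' + (z + a') + (z + a' + (z + a')) =
      (z + (a + a + a) + (a * a + a * a + a * a) + a * a * a) +
      (z + (a + a + a) + (a * a + a * a + a * a) + a * a * a) +
      ((z + (b + b + b) + (b * b + b * b + b * b) + b * b * b) +
       (z + (- b + - b + - b) + (- b * - b + - b * - b + - b * - b) + - b * - b * - b)).
    transitivity (z + z + z + z + (a' + a') + (a' + a')); first ncring.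
    have -> : - b * - b = b * b by ncring.
    by rewrite a't bb /t; ncring.
  rewrite (_ : 2 * (2 * 1) = (1 + 1) + (1 + 1)); last by ring.
  by rewrite (le_trans (nmD _ _))// lerD// (le_trans (nmD _ _))// lerD.
- apply: nm_half; apply: nm_half.
  have -> : z - a' + (z - a') + (z - a' + (z - a')) =
      (z + (- a + - a + - a) + (- a * - a + - a * - a + - a * - a) + - a * - a * - a) +
      (z + (- a + - a + - a) + (- a * - a + - a * - a + - a * - a) + - a * - a * - a) +
      ((z + (b + b + b) + (b * b + b * b + b * b) + b * b * b) +
       (z + (- b + - b + - b) + (- b * - b + - b * - b + - b * - b) + - b * - b * - b)).
    transitivity (z + z + z + z - (a' + a') - (a' + a')); first ncring.
    have -> : - b * - b = b * b by ncring.
    by rewrite a't bb /t; ncring.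
  rewrite (_ : 2 * (2 * 1) = (1 + 1) + (1 + 1)); last by ring.
  by rewrite (le_trans (nmD _ _))// lerD// (le_trans (nmD _ _))// lerD.
(* From [3 a = 2 a' - a^3] and [nm (a^2) <= 1/3] follows [3 nm a <= 2 nm a' + nm a / 3], whence the
   factor 4/3. *)
have e3 : nm ((3%:R : R)%:C *: a) <= nm a' + nm a' + nm (a * a) * nm a.
  have -> : (3%:R : R)%:C *: a = (a' + a') - a * a * a.
    by rewrite rmorph_nat scaler_nat a't /t !mulrSr mulr0n; ncring.
  by rewrite (le_trans (nmB _ _))// lerD ?nmM// nmD.
move: e3; rewrite nmZr ger0_norm//; have := nm_ge0 a; nra.
Qed.

(** A projection is extreme in the unit ball of its corner, here for self-adjoint displacements:
    iterating [unit_pm_grow] on a nonzero [a] would produce elements of norm above 1. *)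
Lemma unit_pm_eq0 z a : proj_elt z -> a^# = a -> z * a = a -> a * z = a ->
  nm (z + a) <= 1 -> nm (z - a) <= 1 -> a = 0.
Proof.
move=> hz as_ za az h1 h2; have ha : unit_pm z a by split.
apply: nm0_eq0; apply/eqP/negPn/negP => a0.
have a1 : 0 < nm a by rewrite lt_def a0 nm_ge0.
have pow n : exists2 b, unit_pm z b & (4 / 3) ^+ n * nm a <= nm b.
  elim: n => [|n [b hb h]]; first by exists a; rewrite ?expr0 ?mul1r.
  have [b' hb' h'] := unit_pm_grow hz hb; exists b' => //.
  by rewrite exprS -mulrA (le_trans _ h')// ler_wpM2l// divr_ge0.
have r0 : (0 : R) <= 3 / 4 by lra.
have r1 : (3 / 4 : R) < 1 by lra.
have [N hN] := geometric_small 1 r0 r1 (divr_gt0 a1 (ltr0Sn _ 1)).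
have [b /unit_pm_nm b1 h] := pow N.
have := hN N (leqnn N); rewrite mul1r => h3.
have h4 : (3 / 4) ^+ N * (4 / 3) ^+ N = 1 :> R.
  by rewrite -exprMn (_ : _ * _ = 1) ?expr1n//; field.
have h5 : (0 : R) <= (3 / 4) ^+ N by rewrite exprn_ge0// divr_ge0.
have := ler_wpM2l h5 (le_trans h b1); rewrite mulrA h4 mul1r mulr1 => h6.
by move: (le_trans h6 h3) a1; lra.
Qed.

(** Stands in for positivity, by which a vanishing sum of positive elements has vanishing terms. Let
    [N] be the length of [l]. As the elements [z] and [z - a k] have norm at most 1 and the [a k]
    add up to 0, both [N z + a i] and [N z - a i] are sums of [N] such elements; [unit_pm_eq0] then
    kills [a i / N]. *)
Lemma sum_corner_eq0 (I : eqType) (l : seq I) (p : I -> X) z : proj_elt z ->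
  (forall i, proj_elt (p i)) -> uniq l -> \sum_(i <- l) z * p i * z = 0 ->
  forall i, i \in l -> p i * z = 0.
Proof.
move=> hz hp ul s0 i il; have [zs zz] := hz; have [ps pp] := hp i.
pose a k := z * p k * z.
suff ai0 : a i = 0.
  by apply: cs_eq0; rewrite csM zs ps mulrA -(mulrA z) pp.
have zpm k : nm (z - a k) <= 1.
  have [ks kk] := hp k.
  have -> : z - a k = z * (1 - p k) * z by rewrite /a mulrBr mulrBl mulr1 zz.
  have h : nm (1 - p k) <= 1.
    apply: nm_proj; split; first by rewrite cstarB cs1 ks.
    by rewrite mulrBl !mulrBr kk; ncring.
  rewrite (le_trans (nmM _ _))//; have := nmM z (1 - p k); have := nm_proj hz.
  have := nm_ge0 z; have := nm_ge0 (1 - p k); have := nm_ge0 (z * (1 - p k)); nra.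
have N0 : (0 < size l)%N by case: l il {ul s0}.
have N1 : (0 : R) < (size l)%:R by rewrite ltr0n.
have sumN (F : I -> X) : (forall k, nm (F k) <= 1) -> nm (\sum_(k <- l) F k) <= (size l)%:R.
  move=> hF; rewrite (le_trans (nm_sum _ _))//.
  by elim: l {il ul s0 N0 N1} => [|k l IH] /=; rewrite ?big_nil ?big_cons// mulrS lerD.
have sz : \sum_(k <- l) z = z *+ size l by rewrite big_const_seq count_predT iter_addr_0.
pose c : R[i] := ((size l)%:R^-1 : R)%:C.
have cz : c *: (z *+ size l) = z.
  rewrite -scaler_nat scalerA -(rmorph_nat (real_complex R)) -rmorphM mulVf ?scale1r//.
  by rewrite gt_eqF.
have cle x : nm x <= (size l)%:R -> nm (c *: x) <= 1.
  by move=> h; rewrite nmZr gtr0_norm ?invr_gt0// mulrC ler_pdivrMr// mul1r.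
have h1 : nm (z *+ size l + a i) <= (size l)%:R.
  have -> : z *+ size l + a i = \sum_(k <- l) (if k == i then z else z - a k).
    rewrite (eq_bigr (fun k => (z - a k) + (if k == i then a k else 0))); last first.
      by move=> k _; case: eqP => [->|_]; rewrite ?subrK ?addr0.
    rewrite big_split /= sumrB sz s0 subr0.
    by rewrite (bigD1_seq i)//= eqxx big1 ?addr0// => k /negbTE->.
  apply: sumN => k; case: eqP => [_|_]; [exact: nm_proj | exact: zpm].
have h2 : nm (z *+ size l - a i) <= (size l)%:R.
  have -> : z *+ size l - a i = \sum_(k <- l) (if k == i then z - a k else z).
    rewrite (eq_bigr (fun k => z - (if k == i then a k else 0))); last first.
      by move=> k _; case: eqP => [->|_]; rewrite ?subr0.
    rewrite sumrB sz.
    by rewrite (bigD1_seq i)//= eqxx big1 ?addr0// => k /negbTE->.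
  apply: sumN => k; case: eqP => [_|_]; [exact: zpm | exact: nm_proj].
have c0 : c *: a i = 0.
  apply: (@unit_pm_eq0 z) => //.
  - by rewrite csZr /a !csM zs ps mulrA.
  - by rewrite csclAr /a !mulrA zz.
  - by rewrite csclAl /a -!mulrA zz.
  - by rewrite -{1}cz -scalerDr; exact: cle.
  - by rewrite -{1}cz -scalerBr; exact: cle.
by apply: (scalerI _ (etrans c0 (esym (scaler0 _ _))));
  rewrite -(rmorph0 (real_complex R)) (inj_eq (@complexI R)) invr_eq0 gt_eqF.
Qed.

(** Relation (o6) does not say that the edges leaving a finite emitter have orthogonal ranges under
    its projection; this is recovered here. [sum_corner_eq0] with [1 - u] for [z] puts each [p i]
    under [u], and with [p j] for [z] makes the others orthogonal to [p j]. *)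
Lemma sum_proj_orth (I : eqType) (l : seq I) (p : I -> X) u : proj_elt u ->
  (forall i, proj_elt (p i)) -> uniq l -> \sum_(i <- l) p i = u ->
  (forall i, i \in l -> u * p i = p i) /\
  (forall i j, i \in l -> j \in l -> i != j -> p i * p j = 0).
Proof.
move=> [us uu] hp ul su.
have hz : proj_elt (1 - u).
  split; first by rewrite cstarB cs1 us.
  by rewrite mulrBl !mulrBr uu; ncring.
have pu i : i \in l -> p i * u = p i.
  move=> il; apply/esym/subr0_eq; rewrite -{1}[p i]mulr1 -mulrBr.
  apply: (sum_corner_eq0 hz hp ul) => //.
  by rewrite -mulr_suml -mulr_sumr su mulrBl mul1r uu subrr mul0r.
have up i : i \in l -> u * p i = p i.
  by move=> il; have [ps _] := hp i; rewrite -{1}ps -us -csM pu.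
split=> // i j il jl ij; have jr := rem_uniq j ul.
apply: (@sum_corner_eq0 _ (rem j l) p (p j) (hp j) hp jr).
  rewrite -mulr_suml -mulr_sumr.
  have -> : \sum_(k <- rem j l) p k = u - p j.
    by rewrite -su (perm_big _ (perm_to_rem jl)) big_cons /=; ncring.
  by rewrite mulrBr pu// (hp j).2 subrr mul0r.
by rewrite mem_rem_uniq// inE ij.
Qed.

End Extremality.

(** * Orthogonality relations of edges and paths *)

Section GraphRelations.
Variables (R : realType) (E : digraph) (A : cstarAlgType R).
Variables (pv : vertex E -> A) (se : edge E -> A).
Hypothesis hps : graph_relations pv se.
Local Notation D := (infinite_emitters E).

Definition vel u : ucs A := emb (pv u).
Definition eel e : ucs A := emb (se e).

Let eh := @emb_hom R A.

Lemma vel_proj u : proj_elt (vel u).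
Proof.
have [h1 h2] := vertex_projection hps u.
by split; rewrite /vel -?(shS eh) -?cmulE -?(shcM eh) ?h1 ?h2.
Qed.

Lemma velM u v : u <> v -> vel u * vel v = 0.
Proof. by move=> uv; rewrite /vel -cmulE -(shcM eh) (vertex_orthogonal hps uv). Qed.

Lemma eel_source e : (eel e)^# * eel e = vel (terminus e).
Proof. by rewrite /eel /vel -(shS eh) -cmulE -(shcM eh) (edge_source hps). Qed.

Lemma eel_range_proj e : proj_elt (eel e * (eel e)^#).
Proof.
split; first by rewrite csM cstarK.
have es := piso_mul (vel_proj (terminus e)) (eel_source e).
by rewrite mulrA -(mulrA (eel e)) eel_source es.
Qed.

Lemma finite_emitter_seq u : ~ D u -> exists2 l : seq (edge E), uniq l & out_edges u = [set` l].
Proof.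
move=> Du; have /finite_seqP[l hl] : finite_set (out_edges u) by apply: contrapT.
exists (undup l); first exact: undup_uniq.
by rewrite hl; apply/seteqP; split=> e; rewrite /= mem_undup.
Qed.

Lemma vel_sum u l : ~ D u -> uniq l -> out_edges u = [set` l] ->
  \sum_(e <- l) eel e * (eel e)^# = vel u.
Proof.
move=> Du ul hl; rewrite /vel (vertex_sum hps Du) hl -fsbig_seq// (sh_sum eh).
by apply: eq_bigr => e _; rewrite /eel -(shS eh) -cmulE -(shcM eh).
Qed.

Let eel_ranges u e f : ~ D u -> origin e = u -> origin f = u ->
  vel u * (eel e * (eel e)^#) = eel e * (eel e)^# /\
  (e <> f -> eel e * (eel e)^# * (eel f * (eel f)^#) = 0).
Proof.
move=> Du oe of_; have [l ul hl] := finite_emitter_seq Du.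
have il g : origin g = u -> g \in l.
  by move=> og; have : out_edges u g by []; rewrite hl.
have [h1 h2] := sum_proj_orth (vel_proj u) eel_range_proj ul (vel_sum Du ul hl).
split; first exact/h1/il.
by move=> ef; apply: h2; [exact: il | exact: il | exact/eqP].
Qed.

Lemma vel_eel e : vel (origin e) * eel e = eel e.
Proof.
have [De|De] := pselect (D (origin e)).
  by rewrite /vel /eel -cmulE -(shcM eh) (edge_range hps De).
have [h _] := eel_ranges De (erefl (origin e)) (erefl (origin e)).
have es := piso_mul (vel_proj (terminus e)) (eel_source e).
by rewrite -[in LHS]es -eel_source (mulrA (eel e)) mulrA h -mulrA eel_source es.
Qed.

Lemma eel_vel e : eel e * vel (terminus e) = eel e.
Proof. exact: (piso_mul (vel_proj _) (eel_source e)). Qed.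

Lemma eel_orth e f : e <> f -> (eel e)^# * eel f = 0.
Proof.
move=> ef; have [oef|oef] := eqVneq (origin e) (origin f); last first.
  have [vs _] := vel_proj (origin e).
  rewrite -(vel_eel e) -(vel_eel f) csM vs mulrA -(mulrA _ (vel _) (vel _)) velM ?mulr0 ?mul0r//.
  exact/eqP.
have [De|De] := pselect (D (origin e)).
  by rewrite /eel -(shS eh) -cmulE -(shcM eh) (edge_orthogonal hps ef oef De).
have [_ /(_ ef) h] := eel_ranges De erefl (esym oef).
have := congr1 (fun x => (eel e)^# * x * eel f) h; rewrite mulr0 mul0r.
by rewrite !mulrA eel_source -[vel _ * _]cstarK csM cstarK (vel_proj _).1 eel_vel
  -!mulrA eel_source eel_vel.
Qed.

Fixpoint gwalk (u : vertex E) (es : seq (edge E)) (v : vertex E) : Prop :=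
  if es is e :: es' then origin e = u /\ gwalk (terminus e) es' v else u = v.

Fixpoint pel (u : vertex E) (es : seq (edge E)) : ucs A :=
  if es is e :: es' then eel e * pel (terminus e) es' else vel u.

(** Comparability: one path is a prefix of the other. Incomparable paths give orthogonal ranges
    ([pel_orth]). *)
Fixpoint comp (s t : seq (edge E)) : bool :=
  if (s, t) is (e :: s', f :: t') then (e == f) && comp s' t' else true.

Lemma gwalk_cat u es v fs w : gwalk u es v -> gwalk v fs w -> gwalk u (es ++ fs) w.
Proof. by elim: es u => [|e es IH] u /= => [->//|[<- h1 h2]]; split=> //; exact: IH. Qed.

Lemma pel_source u es v : gwalk u es v -> (pel u es)^# * pel u es = vel v.
Proof.
elim: es u => [|e es IH] u /= => [->|[_ h]].
  by have [-> ->] := vel_proj v.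
have l : vel (terminus e) * pel (terminus e) es = pel (terminus e) es.
  by case: (es) h => [|f fs] /=; [rewrite (vel_proj _).2 | move=> [<- _]; rewrite mulrA vel_eel].
by rewrite csM -mulrA (mulrA _ (eel e)) eel_source l IH.
Qed.

Lemma vel_pel u es v : gwalk u es v -> vel u * pel u es = pel u es.
Proof.
by case: es => [|f fs] /=; [rewrite (vel_proj _).2 | move=> [<- _]; rewrite mulrA vel_eel].
Qed.

Lemma pel_vel u es v : gwalk u es v -> pel u es * vel v = pel u es.
Proof. by move=> h; exact: (piso_mul (vel_proj _) (pel_source h)). Qed.

Lemma pel_cat u es v fs w : gwalk u es v -> gwalk v fs w ->
  pel u (es ++ fs) = pel u es * pel v fs.
Proof.
elim: es u => [|e es IH] u /= => [-> h|[_ h1] h2]; first by rewrite (vel_pel h).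
by rewrite -mulrA -IH.
Qed.

Lemma pel_orth u es v u' fs v' : gwalk u es v -> gwalk u' fs v' -> ~~ comp es fs ->
  (pel u es)^# * pel u' fs = 0.
Proof.
elim: es u u' fs => [|e es IH] u u' [|f fs] //= [_ h1] [_ h2].
rewrite csM -mulrA (mulrA (eel e)^#).
have [ef|/eqP ef] := eqVneq e f => /= c; last by rewrite eel_orth// mul0r mulr0.
rewrite -ef in h2 *; by rewrite eel_source (vel_pel h2) (IH _ _ _ h1 h2 c).
Qed.

Lemma comp_cat s x t y : comp (s ++ x) (t ++ y) -> comp s t.
Proof. by elim: s t => [|e s IH] [|f t] //= /andP[-> /IH]. Qed.

Lemma comp_catl x s t : comp (x ++ s) (x ++ t) = comp s t.
Proof. by elim: x => //= e x ->; rewrite eqxx. Qed.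

(** Both [s] and [t] are prefixes of [m]. *)
Lemma comp_long s t m : (size s <= size m)%N -> (size t <= size m)%N ->
  comp s m -> comp t m -> comp s t.
Proof.
elim: m s t => [|g m IH] [|e s] [|f t] //= h1 h2 /andP[/eqP-> c1] /andP[/eqP-> c2].
by rewrite eqxx IH.
Qed.

Lemma comp_sym s t : comp s t = comp t s.
Proof. by elim: s t => [|e s IH] [|f t] //=; rewrite IH eq_sym. Qed.

Fixpoint rep_path (la : seq (edge E)) n := if n is n'.+1 then la ++ rep_path la n' else [::].

Lemma gwalk_rep u la n : gwalk u la u -> gwalk u (rep_path la n) u.
Proof. by move=> h; elim: n => //= n IH; exact: gwalk_cat IH. Qed.

Lemma comp_rep la lb i j x y : ~~ comp la lb -> (i < j)%N ->
  ~~ comp (rep_path la i ++ lb ++ x) (rep_path la j ++ y).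
Proof.
move=> c; elim: i j => [|i IH] [|j] //= ij.
  by apply: contra c; rewrite comp_sym -catA => /comp_cat.
by rewrite -!catA comp_catl; exact: IH.
Qed.

Lemma size_rep la n : size (rep_path la n) = (n * size la)%N.
Proof. by elim: n => //= n IH; rewrite size_cat IH mulSn. Qed.

End GraphRelations.

(** * Dense subalgebras and local units of the graph algebra *)

Section Density.
Variables (R : realType) (E : digraph) (O : graph_algebra R E).
Implicit Types a b y : O.

Lemma dense_subalgebra (S : set O) : is_star_subalgebra S ->
  (forall u, S (vertex_elt O u)) -> (forall e, S (edge_elt O e)) ->
  forall a (e : R), 0 < e -> exists2 y, S y & nm (a - y) < e.
Proof.
move=> [S0 SL SM SS] Sv Se a e e0.
pose T : set O := fun a => forall e : R, 0 < e -> exists2 y, S y & nm (a - y) < e.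
suff TT : T = setT by apply: (_ : T a) => //; rewrite TT.
have ST y : S y -> T y by move=> Sy d d0; exists y; rewrite // subrr nm0.
apply: graph_algebra_generated.
- split; first exact: ST.
  + move=> c x y=> Tx Ty d d0.
    have c1 : 0 < cn c + 1 by rewrite ltr_wpDl// cn_ge0.
    have [x' Sx' hx] := Tx (d / 2 / (cn c + 1)) (divr_gt0 (divr_gt0 d0 (ltr0Sn _ 1)) c1).
    have [y' Sy' hy] := Ty (d / 2) (divr_gt0 d0 (ltr0Sn _ 1)).
    exists (c *: x' + y'); first exact: SL.
    have -> : c *: x + y - (c *: x' + y') = c *: (x - x') + (y - y').
      by rewrite scalerBr opprD addrACA.
    rewrite (le_lt_trans (nmD _ _))// nmZ (_ : complex.Re _ = cn c)//.
    move: hx; rewrite ltr_pdivlMr// => hx; have := nm_ge0 (x - x'); have := cn_ge0 c; nra.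
  + move=> x y=> Tx Ty d d0.
    have y1 : 0 < nm y + 1 by rewrite ltr_wpDl// nm_ge0.
    have [x' Sx' hx] := Tx (d / 2 / (nm y + 1)) (divr_gt0 (divr_gt0 d0 (ltr0Sn _ 1)) y1).
    have x1 : 0 < nm x' + 1 by rewrite ltr_wpDl// nm_ge0.
    have [y' Sy' hy] := Ty (d / 2 / (nm x' + 1)) (divr_gt0 (divr_gt0 d0 (ltr0Sn _ 1)) x1).
    exists (cmul x' y'); first exact: SM.
    have -> : cmul x y - cmul x' y' = cmul (x - x') y + cmul x' (y - y').
      by rewrite cmulDl cmulDr cmulNl cmulNr addrA subrK.
    rewrite (le_lt_trans (nmD _ _))//.
    move: hx hy; rewrite !ltr_pdivlMr// => hx hy.
    have := nm_cmul (x - x') y; have := nm_cmul x' (y - y').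
    have := nm_ge0 (x - x'); have := nm_ge0 (y - y'); lra.
  + move=> x=> Tx d d0; have [x' Sx' hx] := Tx d d0.
    by exists (cstar x'); [exact: SS | rewrite -cstarB nm_cstar].
- apply: nm_closed => x h d d0.
  have [y] := h _ (divr_gt0 d0 (ltr0Sn _ 1)) => Ty xy.
  have [z Sz yz] := Ty _ (divr_gt0 d0 (ltr0Sn _ 1)).
  by exists z => //; rewrite (le_lt_trans (nm_dist_tri y _ _))//; lra.
by move=> _ [[u _ <-]|[e' _ <-]]; exact: ST.
Qed.

Lemma dense_eq0 (V : normedModType R[i]) (S : set O) (F : O -> V) (C : R) :
  is_star_subalgebra S -> (forall u, S (vertex_elt O u)) -> (forall e, S (edge_elt O e)) ->
  (forall a b, nm (F a - F b) <= C * nm (a - b)) -> (forall a, S a -> F a = 0) ->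
  forall a, F a = 0.
Proof.
move=> hS Sv Se FL F0 a; apply: nm_eq0P => e e0.
have C1 : 0 < `|C| + 1 by rewrite ltr_wpDl.
have [y Sy ay] := dense_subalgebra hS Sv Se a (divr_gt0 e0 C1).
have := FL a y; rewrite (F0 y Sy) subr0 => /le_trans->//.
move: ay; rewrite ltr_pdivlMr// => ay.
have := ler_norm C; have := nm_ge0 (a - y); nra.
Qed.

Local Notation P := (vel (vertex_elt O)).
Local Notation S := (eel (edge_elt O)).
Local Notation rel := (graph_algebraP O).
Local Notation pel := (pel (vertex_elt O) (edge_elt O)).

(** A quantitative trace of being a polynomial in the generators and their adjoints: [y] changes
    only the beginning of a long path. The one number [N] bounds the number of resulting paths as
    well as their loss of length. *)
Definition shifts_paths y (N : nat) := forall u la w, gwalk u la w -> (N <= size la)%N ->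
  exists l : seq (R[i] * (vertex E * seq (edge E))),
  [/\ (size l <= N)%N, emb y * pel u la = \sum_(t <- l) t.1 *: pel t.2.1 t.2.2 &
      forall t, t \in l -> gwalk t.2.1 t.2.2 w /\ (size la <= size t.2.2 + N)%N].

Let eh := @emb_hom R O.

Let shifts0 : shifts_paths 0 0.
Proof. by move=> u la w _ _; exists [::]; rewrite big_nil (sh0 eh) mul0r; split. Qed.

Let shiftsL c y N z M : shifts_paths y N -> shifts_paths z M ->
  shifts_paths (c *: y + z) (N + M).
Proof.
move=> hy hz u la w g le.
have [l [l1 l2 l3]] := hy _ _ _ g (leq_trans (leq_addr _ _) le).
have [l' [l1' l2' l3']] := hz _ _ _ g (leq_trans (leq_addl _ _) le).
exists ([seq (c * t.1, t.2) | t <- l] ++ l'); split.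
- by rewrite size_cat size_map leq_add.
- rewrite (shD eh) (shZ eh) mulrDl csclAl l2 l2' big_cat big_map /= scaler_sumr.
  by congr (_ + _); apply: eq_bigr => t _; rewrite scalerA.
move=> t; rewrite mem_cat => /orP[/mapP[t' /l3[g' s'] ->] /=|/l3'[g' s']].
  by split=> //; apply: leq_trans s' _; rewrite addnA leq_addr.
by split=> //; apply: leq_trans s' _; rewrite leq_add2l leq_addl.
Qed.

(** Lengths drop by at most [N + M] and at most [N * M] terms arise; the sum bounds both. *)
Let shiftsM y N z M : shifts_paths y N -> shifts_paths z M ->
  shifts_paths (cmul y z) (N + M + N * M).
Proof.
move=> hy hz u la w g /(leq_trans (leq_addr _ _)) le.
have [|l [l1 l2 l3]] := hz _ _ _ g; first by rewrite (leq_trans _ le)// leq_addl.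
have : forall t, t \in l -> exists l' : seq (R[i] * (vertex E * seq (edge E))),
  [/\ (size l' <= N)%N, emb y * pel t.2.1 t.2.2 = \sum_(t <- l') t.1 *: pel t.2.1 t.2.2 &
      forall t', t' \in l' -> gwalk t'.2.1 t'.2.2 w /\ (size la <= size t'.2.2 + N + M)%N].
  move=> t /l3[g' s']; have [|l' [h1 h2 h3]] := hy _ _ _ g'.
    by rewrite -(leq_add2r M) (leq_trans le).
  by exists l'; split=> // t' /h3[? h]; split=> //; rewrite (leq_trans s')// leq_add2r.
rewrite (shcM eh) cmulE -mulrA l2 {l2 l3} => h.
suff [l' [h1 h2 h3]] : exists l' : seq (R[i] * (vertex E * seq (edge E))),
  [/\ (size l' <= N * size l)%N,
      emb y * (\sum_(t <- l) t.1 *: pel t.2.1 t.2.2) = \sum_(t <- l') t.1 *: pel t.2.1 t.2.2 &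
      forall t', t' \in l' -> gwalk t'.2.1 t'.2.2 w /\ (size la <= size t'.2.2 + N + M)%N].
  exists l'; split=> // [|t /h3[g' s']]; last first.
    by split=> //; apply: leq_trans s' _; rewrite -addnA leq_add2l leq_addr.
  by rewrite (leq_trans h1)// (leq_trans (leq_mul (leqnn N) l1))// leq_addl.
elim: l h {l1} => [|t l IH] h; first by exists [::]; rewrite !big_nil mulr0; split.
have [|l1 [h1 h2 h3]] := IH; first by move=> t' t'l; apply: h; rewrite inE t'l orbT.
have [|l2 [k1 k2 k3]] := h t; first by rewrite inE eqxx.
exists ([seq (t.1 * t'.1, t'.2) | t' <- l2] ++ l1); split.
- by rewrite size_cat size_map /= mulnS leq_add.
- rewrite big_cons mulrDr csclAr k2 h2 big_cat big_map /= scaler_sumr.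
  by congr (_ + _); apply: eq_bigr => t' _; rewrite scalerA.
by move=> t'; rewrite mem_cat => /orP[/mapP[t0 /k3[? ?] ->]|/h3].
Qed.

Let shifts_vertex u : shifts_paths (vertex_elt O u) 1.
Proof.
move=> v la w g _; have [<-|/eqP uv] := eqVneq v u.
  exists [:: (1, (v, la))]; split=> //; first by rewrite big_seq1 /= scale1r -[RHS](vel_pel rel g).
  by move=> t; rewrite inE => /eqP->; rewrite /= leq_addr.
exists [::]; split=> //; rewrite big_nil -(vel_pel rel g) mulrA.
by rewrite [emb _ * _](velM rel) ?mul0r// => vu; apply: uv.
Qed.

Let shifts_edge e : shifts_paths (edge_elt O e) 1.
Proof.
move=> v la w g _; have [te|/eqP te] := eqVneq (terminus e) v.
  exists [:: (1, (origin e, e :: la))]; split=> //.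
    by rewrite big_seq1 /= scale1r te.
  by move=> t; rewrite inE => /eqP->; rewrite /= te; split=> //; rewrite addn1 leqW.
exists [::]; split=> //; rewrite big_nil -(vel_pel rel g) mulrA.
by rewrite -[emb (edge_elt O e)]/(S e) -(eel_vel rel e) -(mulrA (S e)) (velM rel te) mulr0 mul0r.
Qed.

Let shifts_edge_star e : shifts_paths (cstar (edge_elt O e)) 1.
Proof.
move=> v [//|f la] w /= [of_ g] _; rewrite (shS eh) -[emb _]/(S e) mulrA.
have [ef|/eqP ef] := eqVneq e f.
  subst f; exists [:: (1, (terminus e, la))]; split=> //.
    by rewrite big_seq1 /= scale1r (eel_source rel) (vel_pel rel g).
  by move=> t; rewrite inE => /eqP->; rewrite /= addn1.
by exists [::]; split=> //; rewrite big_nil (eel_orth rel ef) mul0r.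
Qed.

Lemma shifts_paths_dense a (e : R) : 0 < e ->
  exists y N, nm (a - y) < e /\ shifts_paths y N.
Proof.
move=> e0.
(* The bound for [y] gives none for [cstar y]; asking for both makes [T] closed under adjoints. *)
pose T := [set y | (exists N, shifts_paths y N) /\ (exists N, shifts_paths (cstar y) N)].
have [|u|f|y [[N hN] _] h] := @dense_subalgebra T _ _ _ a e e0; last by exists y, N.
- split.
  + by split; exists 0%N; rewrite ?cstar0; exact: shifts0.
  + move=> c x y [[N hN] [M hM]] [[N' hN'] [M' hM']]; split.
      by exists (N + N')%N; exact: shiftsL.
    by exists (M + M')%N; rewrite cstarD cstarZ; exact: shiftsL.
  + move=> x y [[N hN] [M hM]] [[N' hN'] [M' hM']]; split.
      by eexists; exact: (shiftsM hN hN').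
    by eexists; rewrite cstarM; exact: (shiftsM hM' hM).
  + by move=> x [hx hy]; split; rewrite ?cstarK.
- split; exists 1%N; first exact: shifts_vertex.
  by rewrite (vertex_projection rel u).1; exact: shifts_vertex.
- by split; exists 1%N; [exact: shifts_edge | exact: shifts_edge_star].
Qed.

Definition finite_unit (l : seq (vertex E)) : ucs O := \sum_(x <- l) P x.

Lemma finite_unit_vel l x : uniq l -> x \in l -> finite_unit l * P x = P x.
Proof.
move=> ul xl; rewrite /finite_unit mulr_suml (bigD1_seq x)//= (vel_proj rel x).2.
by rewrite big1 ?addr0// => y /eqP yx; rewrite (velM rel).
Qed.

Lemma finite_unit_proj l : (finite_unit l)^# = finite_unit l.
Proof. by rewrite /finite_unit cs_sum; apply: eq_bigr => x _; exact: (vel_proj rel x).1. Qed.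

(** With infinitely many vertices the algebra may lack a unit; finite sums of vertex projections
    serve as local units that can be inserted between two factors. *)
Definition finitely_supported a := exists l : seq (vertex E), forall l', uniq l' -> {subset l <= l'} ->
  finite_unit l' * emb a = emb a /\ emb a * finite_unit l' = emb a.

Lemma finitely_supported_subalgebra (T : set O) :
  T 0 -> (forall (c : R[i]) a b, T a -> T b -> T (c *: a + b)) ->
  (forall a b, finitely_supported a -> T a -> T b -> T (cmul a b)) ->
  (forall a, T a -> T (cstar a)) ->
  is_star_subalgebra [set a | finitely_supported a /\ T a].
Proof.
move=> T0 TL TM TS; split.
- by split=> //; exists [::] => l' _ _; rewrite (sh0 eh) mulr0 mul0r.
- move=> c a b [[l hl] Ta] [[m hm] Tb]; split; last exact: TL.
  exists (l ++ m) => l' ul' sub.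
  have [|h1 h2] := hl l' ul'; first by move=> x xl; apply: sub; rewrite mem_cat xl.
  have [|h3 h4] := hm l' ul'; first by move=> x xl; apply: sub; rewrite mem_cat xl orbT.
  by rewrite (shD eh) (shZ eh) mulrDr mulrDl csclAr csclAl h1 h2 h3 h4.
- move=> a b [fa Ta] [[m hm] Tb]; split; last exact: TM.
  have [l hl] := fa; exists (l ++ m) => l' ul' sub.
  have [|h1 h2] := hl l' ul'; first by move=> x xl; apply: sub; rewrite mem_cat xl.
  have [|h3 h4] := hm l' ul'; first by move=> x xl; apply: sub; rewrite mem_cat xl orbT.
  by rewrite (shcM eh) cmulE mulrA h1 -mulrA h4.
move=> a [[l hl] Ta]; split; last exact: TS.
exists l => l' ul' sub; have [h1 h2] := hl l' ul' sub.
by rewrite (shS eh); split; rewrite -{1}(finite_unit_proj l') -csM ?h1 ?h2.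
Qed.

Lemma finitely_supported_vertex u : finitely_supported (vertex_elt O u).
Proof.
exists [:: u] => l' ul' sub; have ul : u \in l' by apply: sub; rewrite inE.
have h := finite_unit_vel ul' ul; split=> //.
by rewrite -[emb _]/(P u) -{1}(vel_proj rel u).1 -(finite_unit_proj l') -csM h (vel_proj rel u).1.
Qed.

Lemma finitely_supported_edge e : finitely_supported (edge_elt O e).
Proof.
exists [:: origin e; terminus e] => l' ul' sub.
have ol : origin e \in l' by apply: sub; rewrite !inE eqxx.
have tl : terminus e \in l' by apply: sub; rewrite !inE eqxx orbT.
rewrite -[emb _]/(S e); split.
  by rewrite -(vel_eel rel e) mulrA finite_unit_vel.
rewrite -(eel_vel rel e) -mulrA; congr (_ * _).
by rewrite -{1}(vel_proj rel _).1 -(finite_unit_proj l') -csM finite_unit_vel// (vel_proj rel _).1.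
Qed.

End Density.

(** [rot m] takes the initial projection of [m] to its range, so conjugation by it moves [Z] from
    one to the other; and conjugation by an element of [lam p] changes nothing modulo [lam p]. *)
Lemma lam_eq_move (R : realType) (A : cstarAlgType R) (p m Z : ucs A) : proj_elt p ->
  in_corner p m -> m * m^# * m = m -> m * m = 0 -> corner_unitary (m^# * m) Z ->
  lam_eq p Z (1 + m * (Z - 1) * m^#).
Proof.
move=> hp pm m3 m2 hZ; have [ps pp] := hp; have hR := lam_rot ps pm m3 m2.
have hZ' : corner_unitary p Z.
  apply: corner_unitary_sub hZ; first by rewrite mulrA -{1}ps -csM pm.2.
  by rewrite -mulrA pm.2.
have [_ _ [h1 h2]] := hZ; have [_ R2 _] := lam_unitary ps hR.
suff <- : rot m * Z * (rot m)^# = 1 + m * (Z - 1) * m^#.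
  exact/lam_eq_sym/lam_eq_conj.
have Rm : rot m * (m^# * m) = m.
  have rr : m^# * m * (m^# * m) = m^# * m by rewrite mulrA -(mulrA m^#) -mulrA m3.
  by rewrite (rot_mul m2 rr) mulrA m3.
have mR : m^# * m * (rot m)^# = m^# by rewrite -[X in _ = X^#]Rm !csM cstarK.
rewrite -[X in rot m * X](subrK 1) mulrDr mulr1 mulrDl R2 addrC; congr (_ + _).
have zr : Z - 1 = m^# * m * (Z - 1) * (m^# * m) by rewrite h1 h2.
transitivity (rot m * (m^# * m) * (Z - 1) * (m^# * m * (rot m)^#)); last by rewrite Rm mR.
by rewrite {1}zr; ncring.
Qed.

Lemma conj_cs (R : realType) (A : cstarAlgType R) (w Y : ucs A) :
  (1 + w * (Y - 1) * w^#)^# = 1 + w * (Y^# - 1) * w^#.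
Proof. by rewrite cstarD cs1 !csM cstarK cstarB cs1 mulrA. Qed.

Lemma corner_unitary_conj (R : realType) (A : cstarAlgType R) (w p Y : ucs A) : proj_elt p ->
  w^# * w = p -> corner_unitary p Y -> corner_unitary (w * w^#) (1 + w * (Y - 1) * w^#).
Proof.
move=> hp wp hY; have [y1 y2 y3] := hY; have [_ _ y4] := corner_unitaryS hp.1 hY.
have wpw := piso_mul hp wp.
split.
- by rewrite conj_cs (conj_corner wp y4 y3) y1 subrr mulr0 mul0r addr0.
- by rewrite conj_cs (conj_corner wp y3 y4) y2 subrr mulr0 mul0r addr0.
rewrite addrC addKr; apply: in_cornerM; first by rewrite -mulrA wp.
by rewrite mulrA wp -{1}hp.1 -csM wpw.
Qed.

Lemma lam_eq_iso (R : realType) (A : cstarAlgType R) (w p Y Z : ucs A) : proj_elt p ->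
  w^# * w = p -> p * w = w -> corner_unitary p Y -> corner_unitary p Z -> lam_eq p Y Z ->
  lam_eq p (1 + w * (Y - 1) * w^#) (1 + w * (Z - 1) * w^#).
Proof.
move=> hp wp pw hY hZ YZ; have [_ _ y] := hY; have [_ _ z] := corner_unitaryS hp.1 hZ.
rewrite /lam_eq conj_cs (conj_corner wp y z).
have h := lam_conj hp wp erefl YZ; apply: lam_sub h; first by rewrite mulrA pw.
by rewrite -mulrA -{1}hp.1 -csM pw.
Qed.

Lemma lam_transport1 (R : realType) (A : cstarAlgType R) (p y z : ucs A) : proj_elt p ->
  proj_elt (y^# * y) -> z^# * z = y^# * y -> y^# * z = 0 -> p * y = y -> p * z = z ->
  exists2 L, lam p L & L * y = z.
Proof.
move=> hp hy zy yz py pz.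
have h0 : proj_elt ((0 : ucs A)^# * 0) by rewrite mulr0; split; rewrite ?cstar0 ?mulr0.
have [|||||||||||L [hL Ly _]] := @lam_transport _ _ p y 0 z 0 hp hy h0 zy;
  rewrite ?mulr0 ?cstar0 ?mul0r//; last by exists L.
Qed.

(** * Transport of corner unitaries along loops, modulo [lam] *)

Section Absorption.
Variables (R : realType) (E : digraph) (O : graph_algebra R E).
Local Notation P := (vel (vertex_elt O)).
Local Notation S := (eel (edge_elt O)).
Local Notation rel := (graph_algebraP O).
Local Notation pel := (pel (vertex_elt O) (edge_elt O)).
Variables (o : vertex E) (la lb : seq (edge E)).
Hypotheses (gla : gwalk o la o) (glb : gwalk o lb o) (clab : ~~ comp la lb).

Let eh := @emb_hom R O.
Let hP := vel_proj rel o.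

(** Two paths [ka i] and [ka j] comparable with the same, at least as long [m] would be prefixes of
    it, hence comparable. So each of the fewer than [M] paths in [ms] rules out at most one
    index. *)
Let pigeonhole (M : nat) (ms : seq (seq (edge E))) (ka : nat -> seq (edge E)) :
  (size ms < M)%N -> (forall i j, i <> j -> ~~ comp (ka i) (ka j)) ->
  (forall i m, m \in ms -> (i < M)%N -> (size (ka i) <= size m)%N) ->
  exists2 i, (i < M)%N & forall m, m \in ms -> ~~ comp (ka i) m.
Proof.
move=> hM hk hs; apply: contrapT => no.
have hc i : (i < M)%N -> has (comp (ka i)) ms.
  move=> iM; apply: contrapT => /negP/hasPn h; apply: no; exists i => //.
pose f (i : nat) := find (comp (ka i)) ms.
have fi : {in iota 0 M &, injective f}.
  move=> i j; rewrite !mem_iota !add0n /= => iM jM fij; apply/eqP/negPn/negP => /eqP ij.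
  have := hk i j ij; rewrite (@comp_long _ (ka i) (ka j) (nth [::] ms (f i)))//.
  - by apply: hs => //; rewrite mem_nth// -has_find hc.
  - by apply: hs => //; rewrite mem_nth// -has_find hc.
  - exact: nth_find (hc _ iM).
  - by rewrite fij; exact: nth_find (hc _ jM).
have := @uniq_leq_size _ [seq f i | i <- iota 0 M] (iota 0 (size ms)).
rewrite map_inj_in_uniq// iota_uniq size_map !size_iota leqNgt hM => /(_ isT) h.
suff : false by []; apply: h => _ /mapP[i + ->].
by rewrite !mem_iota !add0n /= => iM; rewrite -has_find hc.
Qed.

Let scalar0 x : P o * x = x -> exists a : O, x = emb a.
Proof.
move=> h; exists x.1; have : x.2 = 0 by rewrite -h /=; exact: mul0r.
by case: (x) => a l /= ->.
Qed.

(* A long path [x] from [o] is moved by [Y] to within [1/10] of a partial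
   isometry whose range misses that of some path [ka] incomparable with [x]. *)
Lemma near_path_isometry (Y : ucs O) : corner_unitary (P o) Y ->
  exists n ka (v : ucs O),
  [/\ (0 < n)%N, gwalk o ka o /\ ~~ comp ka (rep_path lb n),
     v^# * v = P o /\ P o * v = v, (pel o ka)^# * v = 0 &
     nm (v - Y * pel o (rep_path lb n)) <= 10^-1].
Proof.
move=> hY; have [y1 y2 [Py yP]] := hY; have YP := corner_unitary_comm hY.
have [ps pp] := hP.
have [a Ya] := scalar0 Py.
(* With 1/100 here, [z] below is within 1/100 of [Y s], the defect [P o - z^# z] is at most 3/100,
   and the correction of [z] to [v] costs at most 9/100: in all 1/10. *)
have [|y [N [ay hy]]] := @shifts_paths_dense R E O a 100^-1; first by rewrite invr_gt0.
pose ka i := rep_path la i.+1 ++ lb.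
have kac i j : i <> j -> ~~ comp (ka i) (ka j).
  move=> ij; wlog ltij : i j ij / (i < j)%N => [H|].
    case: (ltngtP i j) => [/H|/H|//]; first exact.
    by rewrite comp_sym; apply; exact/nesym.
  by have := @comp_rep _ la lb i.+1 j.+1 [::] lb clab; rewrite cats0 ltnS; exact.
have lb0 : (0 < size lb)%N.
  by case: (lb) clab => //; rewrite comp_sym.
(* So large that the paths occurring in [emb y * s], which are shorter than [x] by at most [N], are
   at least as long as each [ka i] with [i <= N]. *)
pose n := (N + N.+1 * size la + N.+1 * size la + size lb).+1.
pose x := rep_path lb n.
have sx : (n <= size x)%N by rewrite size_rep leq_pmulr.
have gx : gwalk o x o by exact: gwalk_rep.
have [|l [l1 l2 l3]] := hy _ _ _ gx; first by rewrite /n in sx; lia.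
have [|||i iN hi] := @pigeonhole N.+1 [seq t.2.2 | t <- l] ka.
- by rewrite size_map ltnS.
- exact: kac.
- move=> i m /mapP[t /l3[_ h] ->] iN.
  have aux (a1 b1 c1 d1 e1 : nat) :
      (a1 <= b1 -> (N + b1 + b1 + c1).+1 <= d1 -> d1 <= e1 + N -> a1 + c1 <= e1)%N.
    by lia.
  rewrite size_cat size_rep; exact: aux (leq_mul iN (leqnn (size la))) sx h.
have gka : gwalk o (ka i) o by apply: gwalk_cat glb; exact: gwalk_rep.
have kax : ~~ comp (ka i) x.
  by rewrite /ka /x -catA; apply: contra clab => /=; exact: comp_cat.
pose s := pel o x.
have ks : (pel o (ka i))^# * s = 0 by apply: (pel_orth rel gka gx).
have ky : (pel o (ka i))^# * (emb y * s) = 0.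
  rewrite l2 mulr_sumr big_seq big1// => t tl; have [gt _] := l3 t tl.
  rewrite csclAr (pel_orth rel gka gt) ?scaler0//.
  by apply: hi; apply: map_f.
pose z := P o * (s + emb y * s).
have Pz : P o * z = z by rewrite /z mulrA pp.
have kz : (pel o (ka i))^# * z = 0.
  have kP : (pel o (ka i))^# * P o = (pel o (ka i))^# by rewrite -{2}(vel_pel rel gka) csM ps.
  by rewrite /z mulrA kP mulrDr ks ky addr0.
have sP : s * P o = s := pel_vel rel gx.
have zP : z * P o = z by rewrite /z -mulrA mulrDl -mulrA sP.
have Ys : Y * s = P o * (s + emb a * s).
  have -> : s + emb a * s = Y * s by rewrite -Ya mulrBl mul1r; ncring.
  by rewrite mulrA -YP -mulrA (vel_pel rel gx).
have ss : s^# * s = P o := pel_source rel gx.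
have s1 : nm s <= 1 := nm_piso hP ss.
have YsYs : (Y * s)^# * (Y * s) = P o by rewrite csM -mulrA (mulrA Y^#) y1 mul1r.
have Ys1 : nm (Y * s) <= 1 := nm_piso hP YsYs.
have P1 := nm_proj hP.
pose d := z - Y * s.
have d1 : nm d <= 100^-1.
  have -> : d = P o * (emb (y - a) * s).
    by rewrite /d /z Ys (shB eh); ncring.
  have e1 : nm (emb (y - a)) <= 100^-1 by rewrite nm_emb nmBC ltW.
  have := nmM (P o) (emb (y - a) * s); have := nmM (emb (y - a)) s.
  have := nm_ge0 (emb (y - a)); have := nm_ge0 (emb (y - a) * s).
  have := nm_ge0 s; have := nm_ge0 (P o); nra.
have h1 : nm (P o - z^# * z) <= 3 / 100.
  have -> : P o - z^# * z = - (d^# * z + (Y * s)^# * d).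
    rewrite /d cstarB -{1}YsYs; ncring.
  have z1 : nm z <= 1 + 100^-1.
    by rewrite (le_trans (ler_nm_dist z (Y * s)))// lerD.
  rewrite nmN; have := nmD (d^# * z) ((Y * s)^# * d).
  have := nmM d^# z; have := nmM (Y * s)^# d; rewrite !nm_cs.
  have := nm_ge0 d; have := nm_ge0 z; have := nm_ge0 (Y * s); nra.
have [|c [vv vz _]] := isometry_perturb hP zP; first lra.
exists n, (ka i), (z * c); split=> //.
- by split=> //; rewrite mulrA Pz.
- by rewrite mulrA kz mul0r.
rewrite (le_trans (nm_dist_tri z _ _))//; rewrite -/s -/d; lra.
Qed.

(** Let [s] be the element of the path [rep_path lb n]. As [Y s] is close to [v], an element of
    [lam] carrying [v] to [s] turns [Y] into a unitary almost fixing [s]. Perturbing the compression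
    of this unitary to the complement of [s s^#] gives a nearby unitary that is exactly 1 under
    [s]. *)
Lemma lam_eq_off_path (Y : ucs O) : corner_unitary (P o) Y -> exists n Z,
  [/\ (0 < n)%N, lam_eq (P o) Y Z &
      corner_unitary (P o - pel o (rep_path lb n) * (pel o (rep_path lb n))^#) Z].
Proof.
move=> hY; have [n [ka [v [n0 [gka kx] [vv Pv] kv hv]]]] := near_path_isometry hY.
have gx : gwalk o (rep_path lb n) o by exact: gwalk_rep.
exists n; set s := pel o _ in hv *; set k := pel o ka in kv.
have [ps pp] := hP.
have ss : s^# * s = P o := pel_source rel gx.
have kk : k^# * k = P o := pel_source rel gka.
have Ps : P o * s = s := vel_pel rel gx.
have Pk : P o * k = k := vel_pel rel gka.
have sP : s * P o = s := pel_vel rel gx.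
have ks : k^# * s = 0 by apply: (pel_orth rel gka gx).
have sk : s^# * k = 0 by rewrite -[LHS]cstarK csM cstarK ks cstar0.
have vk : v^# * k = 0 by rewrite -[LHS]cstarK csM cstarK kv cstar0.
(* [v] need not be orthogonal to [s], but [k] is orthogonal to both, so [v] reaches [s] by way of
   [k]. *)
have [|||||L1 hL1 L1v] := @lam_transport1 _ _ (P o) v k hP; rewrite ?vv ?kk//.
have [|||||L2 hL2 L2k] := @lam_transport1 _ _ (P o) k s hP; rewrite ?ss ?kk//.
have hL : lam (P o) (L2 * L1) := lamMM hL2 hL1.
have [Lu _ _] := lam_unitary ps hL.
pose Z := L2 * L1 * Y; have hZ : corner_unitary (P o) Z.
  by apply: corner_unitaryM => //; exact: lam_unitary.
have YZ : lam_eq (P o) Y Z by apply/lam_eq_sym/lam_eq_mull.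
have Zs : nm (Z * s - s) <= 10^-1.
  have -> : Z * s - s = L2 * L1 * (Y * s - v).
    by rewrite /Z mulrBr -(mulrA L2 L1 v) L1v L2k; ncring.
  rewrite (le_trans (nmM _ _))// (nm_isometry Lu) mul1r nmBC//.
have ZP := corner_unitary_comm hZ; have [z1 z2 [PZ ZP1]] := hZ.
clearbody Z; clear L1 L2 hL1 hL2 hL Lu L1v L2k.
pose e0 := s * s^#; pose f0 := P o - e0.
have Pe : P o * e0 = e0 by rewrite /e0 mulrA Ps.
have e0s : e0^# = e0 by rewrite /e0 csM cstarK.
have eP : e0 * P o = e0 by rewrite -{1}e0s -ps -csM Pe.
have ee : e0 * e0 = e0 by rewrite /e0 mulrA -(mulrA s) ss sP.
have s1 : nm s <= 1 := nm_piso hP ss.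
have Ze : nm (Z * e0 - e0) <= 10^-1.
  have -> : Z * e0 - e0 = (Z * s - s) * s^# by rewrite /e0; ncring.
  rewrite (le_trans (nmM _ _))// nm_cs; have := nm_ge0 (Z * s - s); have := nm_ge0 s; nra.
have f0E : f0 = P o - e0 by [].
have -> : P o - s * s^# = f0 by [].
clearbody f0 e0.
have Zes : e0 * Z^# - e0 = (Z * e0 - e0)^# by rewrite cstarB csM e0s.
have eZ : nm (e0 * Z - e0) <= 10^-1.
  have -> : e0 * Z - e0 = - ((e0 * Z^# - e0) * Z) by rewrite mulrBl -(mulrA e0 Z^# Z) z1; ncring.
  by rewrite nmN (le_trans (nmM _ _))// (nm_isometry z1) mulr1 Zes nm_cs.
have hf0 : proj_elt f0.
  split; first by rewrite f0E cstarB ps e0s.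
  by rewrite f0E mulrBl !mulrBr pp Pe eP ee; ncring.
have [f0s ff] := hf0.
have fe : f0 * e0 = 0 by rewrite f0E mulrBl Pe ee subrr.
have ef : e0 * f0 = 0 by rewrite f0E mulrBr eP ee subrr.
have fP : f0 * P o = f0 by rewrite f0E mulrBl pp eP.
have Pf : P o * f0 = f0 by rewrite f0E mulrBr pp Pe.
have f1 : nm f0 <= 1 := nm_proj hf0.
have small (W : ucs O) : nm (e0 * W - e0) <= 10^-1 -> nm (e0 * W * f0) <= 10^-1.
  move=> h; have -> : e0 * W * f0 = (e0 * W - e0) * f0 by rewrite mulrBl ef subr0.
  rewrite (le_trans (nmM _ _))//; have := nm_ge0 (e0 * W - e0); have := nm_ge0 f0; nra.
have c1 := small Z eZ; have c2 : nm (e0 * Z^# * f0) <= 10^-1.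
  by apply: small; rewrite Zes nm_cs.
pose x := f0 * Z * f0.
have corner (W : ucs O) : W^# * W = 1 -> W * P o = P o * W ->
    f0 - (f0 * W * f0)^# * (f0 * W * f0) = (e0 * W * f0)^# * (e0 * W * f0).
  move=> W1 WP; rewrite !csM f0s e0s.
  have E1 : f0 = f0 * W^# * (P o * W) * f0.
    by rewrite -WP mulrA -(mulrA f0) W1 mulr1 -mulrA Pf ff.
  rewrite {1}E1 !mulrA -(mulrA _ e0 e0) ee -(mulrA _ f0 f0) ff.
  by rewrite (_ : P o = f0 + e0); [ncring | rewrite f0E subrK].
have sq (y : ucs O) : nm y <= 10^-1 -> nm (y^# * y) <= 16^-1.
  by move=> h; rewrite nm_csM; have := nm_ge0 y; nra.
have xx1 : nm (f0 - x^# * x) <= 16^-1 by rewrite corner//; exact: sq.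
have xx2 : nm (f0 - x * x^#) <= 4^-1.
  have := corner Z^#; rewrite cstarK => /(_ z2) h.
  have xs : x^# = f0 * Z^# * f0 by rewrite /x !csM f0s mulrA.
  rewrite -{1}[x]cstarK xs h; first by rewrite (le_trans (sq _ c2))// lef_pV2 ?posrE// ler_nat.
  by rewrite -ps -csM -ZP csM ps.
have xf : x * f0 = x by rewrite /x -mulrA ff.
have fx : f0 * x = x by rewrite /x !mulrA ff.
have [c [wf1 wf2 wx _]] := piso_perturb hf0 hf0 xf fx xx1 xx2.
set w := x * c in wf1 wf2 wx.
have fw : f0 * w = w by rewrite /w mulrA fx.
have wf : w * f0 = w := piso_mul hf0 wf1.
have fws : f0 * w^# = w^# by rewrite -{1}f0s -csM wf.
have wfs : w^# * f0 = w^# by rewrite -{1}f0s -csM fw.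
pose Z' := 1 - f0 + w; have Z's : Z'^# = 1 - f0 + w^# by rewrite cstarD cstarB cs1 f0s.
have exp (y z : ucs O) : (1 - f0 + y) * (1 - f0 + z) =
    1 - f0 - f0 + f0 * f0 + (z - f0 * z) + (y - y * f0) + y * z by ncring.
have hZ' : corner_unitary f0 Z'.
  split.
  - rewrite Z's /Z' exp ff fw wf1 wfs; ncring.
  - rewrite Z's /Z' exp ff fws wf2 wf; ncring.
  have -> : Z' - 1 = - f0 + w by rewrite /Z'; ncring.
  by apply: in_cornerD => //; apply: in_cornerN.
exists Z'; split=> //; apply: (lam_eq_trans hZ YZ); apply: lam_eq_near => //.
  exact: corner_unitary_sub hZ'.
have PZf : P o * Z * f0 = Z * f0 by rewrite -ZP -mulrA Pf.
(* The three errors are at most 1/10, 1/10 and, from [piso_perturb], 3/16; their sum is below the 1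
   that [lam_eq_near] requires. *)
have -> : Z - Z' = (Z * e0 - e0) + e0 * Z * f0 + (x - w).
  have -> : e0 * Z * f0 = Z * f0 - x.
    have {1}-> : e0 = P o - f0 by rewrite f0E; ncring.
    by rewrite !mulrBl PZf.
  have -> : Z - Z' = (Z - 1) + f0 - w by rewrite /Z'; ncring.
  by rewrite -ZP1 (_ : P o = f0 + e0); [ncring | rewrite f0E subrK].
have := nmD ((Z * e0 - e0) + e0 * Z * f0) (x - w).
have := nmD (Z * e0 - e0) (e0 * Z * f0).
rewrite (nmBC x w); lra.
Qed.

(** By [lam_eq_off_path], [Y] may be replaced by some [Z] supported under [f0 = P o - s s^#].
    Rotations only move between orthogonal ranges, whereas the range of [a] lies under [f0]. So [Z]
    is first moved under [s] by [w = s f0], and from there under [a] by [m = a w^#]. *)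
Lemma absorption (Y : ucs O) : corner_unitary (P o) Y ->
  lam_eq (P o) Y (1 + pel o la * (Y - 1) * (pel o la)^#).
Proof.
move=> hY; have [n [Z [n0 YZ hZ]]] := lam_eq_off_path hY.
have gx : gwalk o (rep_path lb n) o by exact: gwalk_rep.
set s := pel o (rep_path lb n) in hZ *; set a := pel o la.
have [ps pp] := hP.
have ss : s^# * s = P o := pel_source rel gx.
have aa : a^# * a = P o := pel_source rel gla.
have Ps : P o * s = s := vel_pel rel gx.
have Pa : P o * a = a := vel_pel rel gla.
have sP : s * P o = s := pel_vel rel gx.
have as_ : a^# * s = 0.
  apply: (pel_orth rel gla gx); case: (n) n0 => // m _ /=.
  by apply: contra clab; rewrite -{1}[la]cats0; exact: comp_cat.
have sa : s^# * a = 0 by rewrite -[LHS]cstarK csM cstarK as_ cstar0.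
pose f0 := P o - s * s^#; rewrite -/f0 in hZ.
have f0s : f0^# = f0 by rewrite /f0 cstarB ps csM cstarK.
have f0s0 : f0 * s = 0 by rewrite /f0 mulrBl Ps -mulrA ss sP subrr.
have Pf : P o * f0 = f0 by rewrite /f0 mulrBr pp mulrA Ps.
have fP : f0 * P o = f0 by rewrite -{1}f0s -ps -csM Pf.
have ff : f0 * f0 = f0 by rewrite {2}/f0 mulrBr fP mulrA f0s0 mul0r subr0.
have hf0 : proj_elt f0 by [].
clearbody f0; have hZ' : corner_unitary (P o) Z by exact: corner_unitary_sub hZ.
have [_ _ [fZ Zf]] := hZ.
pose w := s * f0; have ws : w^# = f0 * s^# by rewrite /w csM f0s.
have w1 : w^# * w = f0 by rewrite ws /w -mulrA (mulrA s^#) ss Pf ff.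
have Pw : P o * w = w by rewrite /w mulrA Ps.
have wP : w * P o = w by rewrite /w -mulrA fP.
have wf : w * f0 = w by rewrite /w -mulrA ff.
have fw : f0 * w = 0 by rewrite /w mulrA f0s0 mul0r.
have wa : w^# * a = 0 by rewrite ws -mulrA sa mulr0.
clearbody w.
have wsP : w^# * P o = w^# by rewrite -{1}ps -csM Pw.
have fws : f0 * w^# = w^# by rewrite -{1}f0s -csM wf.
have ZW : lam_eq (P o) Z (1 + w * (Z - 1) * w^#).
  apply: lam_eq_move; rewrite ?w1//; first by rewrite -mulrA w1.
  by rewrite -{1}wf -mulrA fw mulr0.
have hW := corner_unitary_conj hf0 w1 hZ.
set W := 1 + w * (Z - 1) * w^# in ZW hW.
pose m := a * w^#; have ms : m^# = w * a^# by rewrite /m csM cstarK.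
have mm : m^# * m = w * w^# by rewrite ms /m mulrA -(mulrA w) aa wP.
have hW' : corner_unitary (P o) W.
  by apply: corner_unitary_sub hW; [rewrite mulrA Pw | rewrite -mulrA wsP].
have : lam_eq (P o) W (1 + m * (W - 1) * m^#).
  apply: lam_eq_move; rewrite ?mm//.
  - by split; rewrite /m ?mulrA ?Pa// -mulrA wsP.
  - by rewrite -mulrA mm /m -mulrA (mulrA w^#) w1 fws.
  - by rewrite {2}/m mulrA /m -(mulrA a) wa mulr0 mul0r.
have -> : m * (W - 1) * m^# = a * (Z - 1) * a^#.
  rewrite ms /m /W addrC addKr.
  transitivity (a * (w^# * w * (Z - 1) * (w^# * w)) * a^#); first ncring.
  by rewrite w1 fZ Zf.
move=> WV; apply: (lam_eq_trans hZ' YZ); apply: (lam_eq_trans hW' ZW).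
have hV T : corner_unitary (P o) T -> corner_unitary (P o) (1 + a * (T - 1) * a^#).
  move=> hT; have := corner_unitary_conj hP aa hT; apply: corner_unitary_sub.
    by rewrite mulrA Pa.
  by rewrite -mulrA -{1}ps -csM Pa.
apply: (lam_eq_trans (hV _ hZ') WV); apply: lam_eq_iso => //; exact: lam_eq_sym.
Qed.

End Absorption.

(** * Murray-von Neumann classes of projections of the algebra *)

Section ProjectionClass.
Variables (R : realType) (A : cstarAlgType R).
Local Notation U := (unitization A).

Definition mx1 (x : ucs A) : 'M[U]_1 := (x : U)%:M.

Lemma adj_mx1 (x : ucs A) : adjmx (mx1 x) = mx1 x^#.
Proof. by apply/matrixP => i j; rewrite !mxE !ord1 /= !mulr1n. Qed.

Lemma mx1M (x y : ucs A) : mx1 x *m mx1 y = mx1 (x * y).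
Proof. by rewrite /mx1 -[LHS]scalar_mxM. Qed.

Lemma proj_mx1 x : proj_elt x -> is_projmx (mx1 x).
Proof. by move=> [h1 h2]; split; rewrite ?adj_mx1 ?mx1M ?h1 ?h2. Qed.

(** The value 0 off projections lets classes of expressions such as [q - x x^#] be written without
    carrying a proof along. *)
Definition proj_class (x : ucs A) : mvnClass U :=
  if pselect (proj_elt x) is left h then \pi_(mvnClass U) (Proj (proj_mx1 h)) else 0.

Lemma proj_classE x (h : proj_elt x) : proj_class x = \pi_(mvnClass U) (Proj (proj_mx1 h)).
Proof.
rewrite /proj_class; case: pselect => // h'; congr (\pi_(_) (Proj _)).
exact: Prop_irrelevance.
Qed.

Lemma proj_class_eq (p q w : ucs A) : proj_elt p -> proj_elt q -> w^# * w = p -> w * w^# = q ->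
  proj_class p = proj_class q.
Proof.
move=> hp hq wp wq; rewrite !proj_classE; apply/eqP/mvnClassP; exists (mx1 w^#).
by rewrite adj_mx1 !mx1M cstarK wp wq.
Qed.

Lemma proj_class_inj (p q : ucs A) : proj_elt p -> proj_elt q -> proj_class p = proj_class q ->
  exists w : ucs A, w^# * w = p /\ w * w^# = q.
Proof.
move=> hp hq; rewrite !proj_classE => /eqP/mvnClassP[v]; pose x : ucs A := v 0 0.
have -> : v = mx1 x by apply/matrixP => i j; rewrite !mxE !ord1 mulr1n.
rewrite adj_mx1 !mx1M /= => -[h1 h2]; exists x^#.
by rewrite cstarK; split; [move/matrixP: h1 | move/matrixP: h2] => /(_ 0 0); rewrite !mxE !mulr1n.
Qed.

Lemma proj_classD (p q : ucs A) : proj_elt p -> proj_elt q -> p * q = 0 ->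
  proj_class (p + q) = proj_class p + proj_class q.
Proof.
move=> hp hq pq; have [ps pp] := hp; have [qs qq] := hq.
have qp : q * p = 0 by rewrite -ps -qs -csM pq cstar0.
have hpq : proj_elt (p + q).
  by split; rewrite ?cstarD ?ps ?qs// mulrDl !mulrDr pp qq pq qp addr0 add0r.
rewrite !proj_classE pi_mvnD; apply/eqP/mvnClassP; exists (row_mx (mx1 p) (mx1 q)) => /=.
have -> : adjmx (row_mx (mx1 p) (mx1 q)) = col_mx (mx1 p) (mx1 q).
  by rewrite /adjmx tr_row_mx map_col_mx -!/(adjmx _) !adj_mx1 ps qs.
rewrite mul_row_col mul_col_row !mx1M pp qq pq qp; split.
  by rewrite /mx1 -[LHS](raddfD (@scalar_mx U 1)).
by rewrite /dsum /mx1 [scalar_mx 0](raddf0 (@scalar_mx U 1)).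
Qed.

Lemma proj_sub (q x : ucs A) p : proj_elt q -> proj_elt p -> x^# * x = p -> q * x = x ->
  [/\ proj_elt (x * x^#), proj_elt (q - x * x^#) & x * x^# * (q - x * x^#) = 0].
Proof.
move=> [qs qq] hp xp qx; have xq : x^# * q = x^# by rewrite -{1}qs -csM qx.
have xpx := piso_mul hp xp.
have xx : x * x^# * (x * x^#) = x * x^# by rewrite mulrA (mulKeq xp) xpx.
split; first by split=> //; rewrite csM cstarK.
  split; first by rewrite cstarB qs csM cstarK.
  by rewrite mulrBl !mulrBr qq xx mulrA qx -mulrA xq subrr subr0.
by rewrite mulrBr xx -mulrA xq subrr.
Qed.

Lemma proj_class_sub (q x : ucs A) p : proj_elt q -> proj_elt p -> x^# * x = p -> q * x = x ->
  proj_class q = proj_class p + proj_class (q - x * x^#).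
Proof.
move=> hq hp xp qx; have [h1 h2 h3] := proj_sub hq hp xp qx.
by rewrite (proj_class_eq hp h1 xp erefl) -proj_classD// addrC subrK.
Qed.

End ProjectionClass.

Inductive unitary_gen (R : realType) (A : cstarAlgType R) (p : ucs A) (ks : seq (ucs A)) :
  ucs A -> Prop :=
| UgenLam c : lam p c -> unitary_gen p ks c
| UgenMem k : k \in ks -> unitary_gen p ks k
| UgenM Y Z : unitary_gen p ks Y -> unitary_gen p ks Z -> unitary_gen p ks (Y * Z)
| UgenS (Y : ucs A) : unitary_gen p ks Y -> unitary_gen p ks Y^#.

(** * Embedding the stabilized algebra into one corner; K_0 and K_1 *)

Section CornerEmbedding.
Variables (R : realType) (E : digraph) (O : graph_algebra R E).
Local Notation P := (vel (vertex_elt O)).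
Local Notation S := (eel (edge_elt O)).
Local Notation rel := (graph_algebraP O).
Local Notation pel := (pel (vertex_elt O) (edge_elt O)).
Variables (o : vertex E) (la lb : seq (edge E)) (m : vertex E -> nat)
  (mu : vertex E -> seq (edge E)).
Hypotheses (gla : gwalk o la o) (glb : gwalk o lb o) (clab : ~~ comp la lb).
Hypotheses (m_inj : injective m) (gmu : forall x, gwalk o (mu x) x).

Let eh := @emb_hom R O.
Let hP := vel_proj rel o.

(** Since [m] is injective, the beginnings [lb^(m x) la] form a prefix code; paths of different
    vertices are incomparable, and the [vx x] have orthogonal ranges in the corner at [o]. [cpath]
    uses the same code to index matrix entries. *)
Definition vpath x := rep_path lb (m x) ++ la ++ mu x.
Definition vx x : ucs O := pel o (vpath x).
Definition cpath k := rep_path lb k ++ la.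
Definition cx k : ucs O := pel o (cpath k).

Lemma gwalk_vpath x : gwalk o (vpath x) x.
Proof. by apply: gwalk_cat (gwalk_rep _ glb) _; apply: gwalk_cat gla _. Qed.

Lemma gwalk_cpath k : gwalk o (cpath k) o.
Proof. exact: gwalk_cat (gwalk_rep _ glb) gla. Qed.

Let clba : ~~ comp lb la. Proof. by rewrite comp_sym. Qed.

Lemma vxM x y : (vx x)^# * vx y = P x * P y.
Proof.
have [->|/eqP xy] := eqVneq x y.
  by rewrite (pel_source rel (gwalk_vpath y)) (vel_proj rel y).2.
rewrite (velM rel xy); apply: (pel_orth rel (gwalk_vpath x) (gwalk_vpath y)).
rewrite /vpath; case: (ltngtP (m x) (m y)) => [|ltyx|/m_inj//].
  exact: comp_rep.
by rewrite comp_sym; exact: comp_rep.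
Qed.

Lemma cxM k l : (cx k)^# * cx l = if k == l then P o else 0.
Proof.
have [->|kl] := eqVneq k l; first exact: (pel_source rel (gwalk_cpath l)).
apply: (pel_orth rel (gwalk_cpath k) (gwalk_cpath l)); rewrite /cpath.
case: (ltngtP k l) kl => // kl _; first by rewrite -{1}[la]cats0; exact: comp_rep.
by rewrite comp_sym -{1}[la]cats0; exact: comp_rep.
Qed.

Lemma P_vx x : P o * vx x = vx x. Proof. exact: (vel_pel rel (gwalk_vpath x)). Qed.
Lemma vx_P x : vx x * P x = vx x. Proof. exact: (pel_vel rel (gwalk_vpath x)). Qed.
Lemma P_cx k : P o * cx k = cx k. Proof. exact: (vel_pel rel (gwalk_cpath k)). Qed.
Lemma cx_P k : cx k * P o = cx k. Proof. exact: (pel_vel rel (gwalk_cpath k)). Qed.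
Let csP (x : ucs O) y : x * P y = x -> P y * x^# = x^#.
Proof. by move=> h; rewrite -{1}(vel_proj rel y).1 -csM h. Qed.
Let csP' (x : ucs O) y : P y * x = x -> x^# * P y = x^#.
Proof. by move=> h; rewrite -{1}(vel_proj rel y).1 -csM h. Qed.

(** The generators, conjugated by the [vx], satisfy the defining relations inside the corner at [o];
    the universal property then yields [rho]. *)
Lemma corner_relations : graph_relations (fun x => vx x * (vx x)^#)
  (fun e => vx (origin e) * S e * (vx (terminus e))^#).
Proof.
have vv x : (vx x)^# * vx x = P x by rewrite vxM (vel_proj rel x).2.
have rs e : (vx (origin e) * S e * (vx (terminus e))^#)^# =
    vx (terminus e) * (S e)^# * (vx (origin e))^# by rewrite !csM cstarK mulrA.
have SP e : (S e)^# * P (origin e) = (S e)^# by apply/csP'/(vel_eel rel).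
have vvK x := mulKeq (vv x); have SPK e := mulKeq (SP e).
have ssK e := mulKeq (eel_source rel e).
have src e : vx (terminus e) * (S e)^# * (vx (origin e))^# *
    (vx (origin e) * S e * (vx (terminus e))^#) = vx (terminus e) * (vx (terminus e))^#.
  by rewrite !mulrA vvK SPK ssK vx_P.
split.
- move=> e; rewrite /is_partial_isometry !cmulE rs -mulrA src !mulrA.
  by rewrite vvK (mulKeq (csP (vx_P _))).
- move=> u; split; first by rewrite csM cstarK.
  by rewrite cmulE !mulrA vvK vx_P.
- move=> u v uv; rewrite cmulE !mulrA (mulKeq (vxM u v)) (velM rel uv).
  by rewrite mulr0 mul0r.
- by move=> e; rewrite cmulE rs src.
- by move=> e _; rewrite cmulE !mulrA vvK vx_P.
- move=> e f ef oef _; rewrite cmulE rs !mulrA -oef vvK SPK (mulKeq (eel_orth rel ef)).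
  by rewrite mulr0 mul0r.
move=> u Du; have [l ul hl] := finite_emitter_seq Du.
have hu := vel_sum rel Du ul hl.
rewrite hl -fsbig_seq// -{1}vx_P -hu mulr_sumr mulr_suml [LHS]big_seq [RHS]big_seq.
apply: eq_bigr => e el; have <- : origin e = u by have : out_edges u e by rewrite hl.
by rewrite cmulE rs !mulrA vvK (mulKeq (eel_vel rel e)).
Qed.

Lemma corner_hom_ex : exists f : O -> ucs O, [/\ is_star_hom f,
  forall u, f (vertex_elt O u) = vx u * (vx u)^# &
  forall e, f (edge_elt O e) = vx (origin e) * S e * (vx (terminus e))^#].
Proof. exact: graph_algebra_universal corner_relations. Qed.

Definition rho : O -> ucs O := projT1 (cid corner_hom_ex).

Lemma rho_hom : is_star_hom rho.
Proof. by rewrite /rho; case: cid => f []. Qed.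

Lemma rho_vertex u : rho (vertex_elt O u) = vx u * (vx u)^#.
Proof. by rewrite /rho; case: cid => f []. Qed.

Lemma rho_edge e : rho (edge_elt O e) = vx (origin e) * S e * (vx (terminus e))^#.
Proof. by rewrite /rho; case: cid => f []. Qed.

Lemma rho_corner a : P o * rho a = rho a /\ rho a * P o = rho a.
Proof.
have rh := rho_hom.
pose T := [set a : O | P o * rho a = rho a /\ rho a * P o = rho a].
have T0 : is_star_subalgebra T.
  split.
  - by split; rewrite (sh0 rh) ?mulr0 ?mul0r.
  - move=> c x y [h1 h2] [h3 h4]; split; rewrite (shD rh) (shZ rh).
      by rewrite mulrDr csclAr h1 h3.
    by rewrite mulrDl csclAl h2 h4.
  - move=> x y [h1 h2] [h3 h4]; split; rewrite (shcM rh) cmulE.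
      by rewrite mulrA h1.
    by rewrite -mulrA h4.
  - by move=> x [h1 h2]; split; rewrite (shS rh); [exact: csP | exact: csP'].
have Tv u : T (vertex_elt O u).
  by split; rewrite rho_vertex ?mulrA ?P_vx// -mulrA (csP' (P_vx _)).
have Te e : T (edge_elt O e).
  by split; rewrite rho_edge ?mulrA ?P_vx// -mulrA (csP' (P_vx _)).
split; apply/subr0_eq.
  apply: (@dense_eq0 R E O (ucs O) T (fun a => P o * rho a - rho a) (nm (P o - 1))) => //.
    move=> x y; have -> : P o * rho x - rho x - (P o * rho y - rho y) = (P o - 1) * rho (x - y).
      by rewrite (shB rh); ncring.
    by rewrite (le_trans (nmM _ _))// ler_wpM2l ?nm_ge0// star_hom_nm.
  by move=> x [-> _]; rewrite subrr.
apply: (@dense_eq0 R E O (ucs O) T (fun a => rho a * P o - rho a) (nm (P o - 1))) => //.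
  move=> x y; have -> : rho x * P o - rho x - (rho y * P o - rho y) = rho (x - y) * (P o - 1).
    by rewrite (shB rh); ncring.
  by rewrite (le_trans (nmM _ _))// mulrC ler_wpM2l ?nm_ge0// star_hom_nm.
by move=> x [_ ->]; rewrite subrr.
Qed.

(** Formally [rho a = V a V^#] with [V] the sum of all [vx x], an infinite sum of which only
    compressions make sense. The proof is by density, and local units inserted between two factors
    handle products. *)
Lemma rho_compress a x y : (vx x)^# * rho a * vx y = P x * emb a * P y.
Proof.
have rh := rho_hom.
pose T : set O := [set a | forall x y, (vx x)^# * rho a * vx y = P x * emb a * P y].
have PP z : P z * P z = P z := (vel_proj rel z).2.
apply/subr0_eq; move: a.
apply: (@dense_eq0 R E O (ucs O) [set a | finitely_supported a /\ T a] _
  (nm (vx x)^# * nm (vx y) + nm (P x) * nm (P y))).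
- apply: finitely_supported_subalgebra.
  + by move=> u v; rewrite (sh0 rh) (sh0 eh) !mulr0 !mul0r.
  + move=> c a b Ta Tb u v; rewrite (shD rh) (shD eh) (shZ rh) (shZ eh).
    by rewrite !mulrDr !mulrDl !csclAr !csclAl Ta Tb.
  + move=> a b [l hl] Ta Tb u v.
    have [|_ h] := hl (undup l) (undup_uniq _); first by move=> z; rewrite mem_undup.
    have h' : emb a * (\sum_(z <- undup l) P z) = emb a := h.
    have ea : a = \sum_(z <- undup l) cmul a (vertex_elt O z).
      apply: emb_inj; rewrite -{1}h' mulr_sumr (sh_sum eh).
      by apply: eq_bigr => z _; rewrite (shcM eh).
    have ra : rho a = \sum_(z <- undup l) rho a * (vx z * (vx z)^#).
      by rewrite {1}ea (sh_sum rh); apply: eq_bigr => z _; rewrite (shcM rh) rho_vertex.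
    rewrite (shcM rh) (shcM eh) !cmulE ra mulr_suml mulr_sumr mulr_suml.
    transitivity (\sum_(z <- undup l) P u * emb a * P z * emb b * P v).
      apply: eq_bigr => z _.
      transitivity (((vx u)^# * rho a * vx z) * ((vx z)^# * rho b * vx v)); first ncring.
      by rewrite Ta Tb !mulrA (mulKeq (PP z)).
    by rewrite -!mulr_suml -mulr_sumr -(mulrA (P u)) h' mulrA.
  + move=> a Ta u v; rewrite (shS rh) (shS eh); have := congr1 cstar (Ta v u).
    by rewrite !csM !cstarK !(vel_proj rel _).1 !mulrA.
- move=> u; split; first exact: finitely_supported_vertex.
  move=> v w; rewrite rho_vertex mulrA -mulrA !vxM -!mulrA; congr (_ * _).
  by rewrite mulrA PP.
- move=> e; split; first exact: finitely_supported_edge.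
  move=> v w; rewrite rho_edge !mulrA vxM -!mulrA vxM.
  by rewrite !mulrA -(mulrA _ (P (origin e))) (vel_eel rel) -(mulrA _ (S e)) (eel_vel rel).
- move=> a b.
  have -> : (vx x)^# * rho a * vx y - P x * emb a * P y -
     ((vx x)^# * rho b * vx y - P x * emb b * P y) =
     (vx x)^# * rho (a - b) * vx y - P x * emb (a - b) * P y.
    by rewrite (shB rh) (shB eh); ncring.
  rewrite (le_trans (nmB _ _))// mulrDl lerD// (le_trans (nmM _ _))// mulrAC.
    by rewrite ler_wpM2r ?nm_ge0// (le_trans (nmM _ _))// ler_wpM2l ?nm_ge0// star_hom_nm.
  by rewrite ler_wpM2r ?nm_ge0// (le_trans (nmM _ _))// ler_wpM2l ?nm_ge0// nm_emb.
by move=> a [_ Ta]; rewrite Ta subrr.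
Qed.

Local Notation U := (unitization O).

(* [rho] compresses [O] into the corner at [o]; [rt] is its unital extension. *)
Definition rt (x : U) : ucs O := rho x.1 + x.2 *: P o.

Lemma rtD x y : rt (x + y) = rt x + rt y.
Proof. by rewrite /rt /= (shD rho_hom) scalerDl addrACA. Qed.

Lemma rt0 : rt 0 = 0.
Proof. by rewrite /rt /= (sh0 rho_hom) scale0r addr0. Qed.

Lemma rt1 : rt 1 = P o.
Proof. by rewrite /rt /= (sh0 rho_hom) scale1r add0r. Qed.

Lemma rtM x y : rt (x * y) = rt x * rt y.
Proof.
have rh := rho_hom; have [h1 _] := rho_corner y.1; have [_ h2] := rho_corner x.1.
rewrite /rt /= !(shD rh) (shcM rh) !(shZ rh) mulrDl !mulrDr !csclAl !csclAr h1 h2.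
by rewrite scalerA (vel_proj rel o).2 cmulE; ncring.
Qed.

Lemma rtS x : rt (star x) = (rt x)^#.
Proof. by rewrite /rt /= (shS rho_hom) cstarD cstarZ hP.1. Qed.

Lemma rt_corner x : P o * rt x = rt x /\ rt x * P o = rt x.
Proof.
have [h1 h2] := rho_corner x.1.
by rewrite /rt mulrDr mulrDl csclAl csclAr h1 h2 hP.2.
Qed.

Lemma rt_sum I (r : seq I) (F : I -> U) : rt (\sum_(i <- r) F i) = \sum_(i <- r) rt (F i).
Proof. by apply: (big_morph rt rtD rt0). Qed.

(** The [cx i] have orthogonal ranges, so [cx i * x * (cx j)^#] multiplies like a matrix entry, and
    matrices of every size fit into the corner. The identity matrix goes to the sum of the ranges of
    finitely many [cx i], which is why [Gam] adds a complement. *)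
Definition Phi n k (W : 'M[U]_(n, k)) : ucs O :=
  \sum_(i < n) \sum_(j < k) cx i * rt (W i j) * (cx j)^#.

Lemma PhiM n k l (W : 'M[U]_(n, k)) (V : 'M[U]_(k, l)) : Phi (W *m V) = Phi W * Phi V.
Proof.
rewrite /Phi mulr_suml; apply: eq_bigr => i _.
rewrite (eq_bigr (fun j : 'I_l => \sum_(h < k) cx i * rt (W i h) * rt (V h j) * (cx j)^#)); last first.
  move=> j _; rewrite mxE rt_sum mulr_sumr mulr_suml; apply: eq_bigr => h _.
  by rewrite rtM mulrA.
rewrite exchange_big /= mulr_suml; apply: eq_bigr => h _.
rewrite mulr_sumr [RHS](bigD1 h)//= [X in _ = _ + X]big1 ?addr0; last first.
  move=> h' hh; rewrite mulr_sumr big1// => j _.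
  have e0 : (h == h' :> nat) = false by rewrite (inj_eq val_inj) eq_sym (negbTE hh).
  by rewrite !mulrA (mulKeq (cxM h h')) e0 !(mulr0, mul0r).
rewrite mulr_sumr; apply: eq_bigr => j _.
by rewrite !mulrA (mulKeq (cxM h h)) eqxx (mulKeq (rt_corner _).2).
Qed.

Lemma Phi_adj n k (W : 'M[U]_(n, k)) : Phi (adjmx W) = (Phi W)^#.
Proof.
rewrite /Phi exchange_big cs_sum; apply: eq_bigr => i _.
rewrite cs_sum; apply: eq_bigr => j _.
by rewrite !mxE rtS !csM cstarK mulrA.
Qed.

Lemma Phi_corner n k (W : 'M[U]_(n, k)) : in_corner (P o) (Phi W).
Proof.
rewrite /Phi; elim/big_ind: _ => [||i _]; [exact: in_corner0|exact: in_cornerD|].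
elim/big_ind: _ => [||j _]; [exact: in_corner0|exact: in_cornerD|].
by apply: in_cornerM; [exact: P_cx | exact/csP'/P_cx].
Qed.

(* A homomorphism, compatible with padding, from the unitary groups defining K_1 to the
   unitaries of the corner at [o]. *)
Definition Gam n (W : 'M[U]_n) : ucs O := 1 + (Phi W - Phi (1%:M : 'M_n)).

Lemma GamM n (W V : 'M[U]_n) : Gam (W *m V) = Gam W * Gam V.
Proof.
rewrite /Gam; have h1 := PhiM (1%:M) V; have h2 := PhiM W 1%:M.
have h3 := PhiM (1%:M : 'M[U]_n) 1%:M.
rewrite mul1mx in h1; rewrite mulmx1 in h2; rewrite mulmx1 in h3.
rewrite PhiM; set x := Phi W in h2 *; set y := Phi V in h1 *; set q := Phi _ in h1 h2 h3 *.
have -> : (1 + (x - q)) * (1 + (y - q)) =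
   1 + (x - q) + (y - q) + (x * y - x * q - q * y + q * q) by ncring.
by rewrite -h1 -h2 -h3; ncring.
Qed.

Lemma Gam1 n : Gam (1%:M : 'M_n) = 1.
Proof. by rewrite /Gam subrr addr0. Qed.

Lemma Gam_adj n (W : 'M[U]_n) : Gam (adjmx W) = (Gam W)^#.
Proof. by rewrite /Gam Phi_adj -{1}[1%:M]adjmx1 Phi_adj cstarD cs1 cstarB. Qed.

Lemma Gam_unitary n (W : 'M[U]_n) : Defs.is_unitary W -> corner_unitary (P o) (Gam W).
Proof.
move=> [w1 w2]; split; rewrite -?Gam_adj -?GamM ?w1 ?w2 ?Gam1//.
rewrite /Gam addrC addKr; apply: in_cornerD; first exact: Phi_corner.
exact/in_cornerN/Phi_corner.
Qed.

Lemma Gam_pad n k (W : 'M[U]_n) : (n <= k)%N -> Gam (pad k W) = Gam W.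
Proof.
move=> /subnKC <-; move: (k - n)%N => d; rewrite /Gam; congr (1 + _).
have H (V : 'M[U]_n) : Phi (pad (n + d) V) = Phi V + \sum_(i < d) cx (n + i) * (cx (n + i))^#.
  rewrite padE /Phi big_split_ord /=; congr (_ + _); apply: eq_bigr => i _.
    rewrite big_split_ord /= [X in _ + X]big1 ?addr0 => [|j _].
      by apply: eq_bigr => j _; rewrite block_mxEul.
    by rewrite block_mxEur mxE rt0 mulr0 mul0r.
  rewrite big_split_ord /= [X in X + _]big1 ?add0r => [|j _]; last first.
    by rewrite block_mxEdl mxE rt0 mulr0 mul0r.
  rewrite (bigD1 i)//= big1 ?addr0 => [|j ji].
    by rewrite block_mxEdr mxE eqxx rt1 cx_P.
  by rewrite block_mxEdr mxE eq_sym (negbTE ji) rt0 mulr0 mul0r.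
rewrite H; have := H 1%:M; rewrite pad1 ?leq_addr// => ->; ncring.
Qed.

Let nm_conj k l (x : ucs O) : nm (cx k * x * (cx l)^#) <= nm x.
Proof.
have c1 j : nm (cx j) <= 1 by apply: (nm_piso hP); rewrite cxM eqxx.
have := nmM (cx k * x) (cx l)^#; have := nmM (cx k) x; rewrite nm_cs.
have := c1 k; have := c1 l; have := nm_ge0 x; have := nm_ge0 (cx l).
have := nm_ge0 (cx k); have := nm_ge0 (cx k * x); nra.
Qed.

Lemma nm_Gam_dist n (W V : 'M[U]_n) (e : R) :
  (forall i j, nm (W i j - V i j).1 <= e /\ cn (W i j - V i j).2 <= e) ->
  nm (Gam W - Gam V) <= (e + e) *+ (n * n).
Proof.
move=> h; have -> : Gam W - Gam V = \sum_(i < n) \sum_(j < n) cx i * rt (W i j - V i j) * (cx j)^#.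
  transitivity (Phi W - Phi V); first by rewrite /Gam; ncring.
  rewrite /Phi -sumrB; apply: eq_bigr => i _; rewrite -sumrB; apply: eq_bigr => j _.
  have -> : rt (W i j - V i j) = rt (W i j) - rt (V i j).
    by apply/esym/eqP; rewrite subr_eq -rtD subrK.
  by rewrite mulrBr mulrBl.
rewrite (le_trans (nm_sum _ _))// mulrnA.
have -> : (e + e) *+ n *+ n = \sum_(i < n) \sum_(j < n) (e + e).
  by rewrite sumr_const card_ord sumr_const card_ord.
apply: ler_sum => i _; rewrite (le_trans (nm_sum _ _))//; apply: ler_sum => j _.
rewrite (le_trans (nm_conj _ _ _))// /rt (le_trans (nmD _ _))// lerD//.
  by rewrite (le_trans (star_hom_nm _ rho_hom))//; have [] := h i j.
rewrite nmZ; have [_ h2] := h i j; have := nm_proj hP.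
rewrite (_ : complex.Re _ = cn (W i j - V i j).2)//; have := cn_ge0 (W i j - V i j).2.
have := nm_ge0 (P o); nra.
Qed.

(** By [lam_eq_near] the times at which the path equals its start modulo [lam] form a relatively
    open and closed subset of the unit interval, which is connected. *)
Lemma Gam_path n (W V : 'M[U]_n) : homotopic W V -> lam_eq (P o) (Gam W) (Gam V).
Proof.
move=> [h [hc hu h0 h1]]; pose I := @unit_itv R.
have I0 : I 0 by rewrite /I /unit_itv /= in_itv /= lexx ler01.
have I1 : I 1 by rewrite /I /unit_itv /= in_itv /= lexx ler01.
have hG t : I t -> corner_unitary (P o) (Gam (h t)) by move=> /hu/Gam_unitary.
have near_dist t : I t -> \forall t' \near t, I t' -> nm (Gam (h t) - Gam (h t')) < 1.
  (* [nm_Gam_dist] bounds the distance by [2 e n^2]; the successor makes this strictly less than 1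
     and covers [n = 0]. *)
  move=> It; pose e : R := ((n * n).+1%:R *+ 2)^-1.
  have e0 : 0 < e by rewrite invr_gt0 mulrn_wgt0.
  have en : (e + e) *+ (n * n) < 1.
    have e1 : (e + e) *+ (n * n).+1 = 1.
      rewrite /e; have : (n * n).+1%:R != 0 :> R by rewrite pnatr_eq0.
      by rewrite -[LHS]mulr_natr; move: (n * n).+1%:R => N N0; field.
    by rewrite -e1 ltr_pMn2l ?addr_gt0.
  have : \forall t' \near (t : subspace I), forall i j,
      nm (h t i j - h t' i j).1 <= e /\ cn (h t i j - h t' i j).2 <= e.
    have C i j : \forall t' \near (t : subspace I),
      nm (h t i j - h t' i j).1 <= e /\ cn (h t i j - h t' i j).2 <= e.
      have /continuousUP[/(_ t)/cvgrPdist_le c1 /(_ t)/cvgrPdist_le c2] := hc i j.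
      have ec : (0 : R[i]) < e%:C by rewrite ltr0c.
      have := c1 _ ec; have := c2 _ ec; apply: filterS2 => t' k2 k1.
      by split; rewrite -lecR -?nmE -?cnE.
    have SF : Filter (nbhs (t : subspace I)) by exact: subspace_filter.
    by apply: (filter_forall SF) => i; apply: (filter_forall SF) => j; exact: C.
  have nE : nbhs (t : subspace I) = within I (nbhs (t : R)) by exact: (esym (nbhs_subspace_in It)).
  rewrite /prop_near1 nE /within /=; apply: filterS => t' Ht' It'.
  exact: le_lt_trans (nm_Gam_dist (Ht' It')) en.
have loc t : I t -> \forall t' \near t, I t' -> lam_eq (P o) (Gam (h t)) (Gam (h t')).
  move=> It; apply: filterS (near_dist t It) => t' H It'.
  by apply: lam_eq_near; [exact: hP.1 | exact: hG | exact: hG | exact: H].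
pose Q := I `&` [set t | lam_eq (P o) (Gam (h 0)) (Gam (h t))].
suff QI : Q = I.
  have Q1 : Q 1 by rewrite QI.
  by case: Q1 => _; rewrite /= h0 h1.
have cI : connected I := @segment_connected R 0 1.
apply: cI.
- by exists 0; split=> //; exact/lam_eq_refl/hG.
- exists [set t | I t -> Q t]°; first exact: open_interior.
  apply/seteqP; split=> t [It Qt].
    split=> //; rewrite /interior /=; apply: filterS (loc t It) => t' Ht' It'; split=> //.
    exact: lam_eq_trans (hG t It) Qt (Ht' It').
  by apply: (interior_subset Qt).
exists (~` [set t | I t -> ~ Q t]°); first exact/open_closedC/open_interior.
apply/seteqP; split=> t [It Qt]; split=> //.
  by move=> /interior_subset /= /(_ It) H; apply: H.
apply: contrapT => nQ; apply: Qt; rewrite /interior /=.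
apply: filterS (loc t It) => t' Ht' It' [_ Qt']; apply: nQ.
exact: lam_eq_trans (hG t' It') Qt' (lam_eq_sym (Ht' It')).
Qed.

(* [Gam] maps the unitary of size one given by [Y] to the transport of [Y] along a loop,
   which equals [Y] modulo [lam] by [absorption]. *)
Lemma corner_unitary_generated : group_finitely_generated (K1 O) ->
  exists ks : seq (ucs O), (forall k, k \in ks -> corner_unitary (P o) k) /\
    forall Y, corner_unitary (P o) Y -> unitary_gen (P o) ks Y.
Proof.
move=> [s hs]; pose ks := [seq Gam (unitary_mx (repr (g : K1 O))) | g <- s]; exists ks.
have GU := Gam_unitary.
split=> [k /mapP[g _ ->]|]; first exact/GU/unitaryP.
(* Quantifying over all representatives makes [H] easy to use; [move_gen] shows that testing a
   single one suffices. *)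
pose H := [set g : K1 O | forall W : unitary O, \pi_(K1 O) W = g -> unitary_gen (P o) ks (Gam W)].
have move_gen (W V : unitary O) : \pi_(K1 O) W = \pi_(K1 O) V ->
    unitary_gen (P o) ks (Gam V) -> unitary_gen (P o) ks (Gam W).
  move=> /eqP/K1P[k [Wk Vk h]] gV.
  have l : lam_eq (P o) (Gam W) (Gam V).
    by have := Gam_path h; rewrite !Gam_pad.
  have [V1 V2 _] := GU _ _ (unitaryP V).
  have -> : Gam W = Gam W * (Gam V)^# * Gam V by rewrite -mulrA V1 mulr1.
  by apply: UgenM gV; exact: UgenLam.
have HT : H = setT.
  apply: hs.
  - move=> W hW; apply: (move_gen W (Unitary (unitary1 U 0))); first by rewrite hW.
    by apply: UgenLam; rewrite /= Gam1; exact: Lam1.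
  - move=> x y Hx Hy W hW; apply: (move_gen W (unitary_prod (repr x) (repr y))) => //.
    rewrite /= GamM !Gam_pad ?leq_maxl ?leq_maxr//.
    by apply: UgenM; [apply: Hx; rewrite reprK | apply: Hy; rewrite reprK].
  - move=> x Hx W hW; apply: (move_gen W (Unitary (unitary_adj (unitaryP (repr x))))) => //.
    by rewrite /= Gam_adj; apply/UgenS/Hx; rewrite reprK.
  move=> g gs W hW; apply: (move_gen W (repr g)); first by rewrite reprK.
  by apply: UgenMem; apply/mapP; exists g.
move=> Y hY; have [Y1 Y2 [PY YP]] := hY.
pose y : U := Y.
have hy : Defs.is_unitary (y%:M : 'M[U]_1).
  have ea : adjmx (y%:M : 'M[U]_1) = (star y)%:M.
    by apply/matrixP => i j; rewrite !mxE !ord1 /= !mulr1n.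
  have s1 : star y * y = 1 := Y1.
  have s2 : y * star y = 1 := Y2.
  by split; [apply: etrans (congr1 (mulmx^~ _) ea) _ | apply: etrans (congr1 (mulmx _) ea) _];
    rewrite -[LHS]scalar_mxM (s1, s2).
have gy : unitary_gen (P o) ks (Gam (y%:M : 'M[U]_1)).
  have : H (\pi_(K1 O) (Unitary hy)) by rewrite HT.
  by move=> /(_ (Unitary hy) erefl).
have y2 : Y.2 = 1.
  have : (P o * (Y - 1)).2 = (Y - 1).2 by rewrite PY.
  by rewrite /= mul0r => /esym/eqP; rewrite subr_eq0 => /eqP.
have ey : Y - 1 = emb Y.1.
  by apply/eqP; rewrite -subr_eq0; apply/eqP; congr pair; rewrite /= ?y2 ?subr0 ?subrr ?subr0//.
have vo : (vx o)^# * vx o = P o.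
  by rewrite vxM ?(vel_proj rel o).2.
have ro : rho Y.1 = vx o * emb Y.1 * (vx o)^#.
  have rh := rho_hom.
  have := rho_compress Y.1 o o; rewrite -ey PY YP => <-.
  have e1 : Y.1 = cmul (vertex_elt O o) Y.1.
    by apply: (@emb_inj R O); rewrite (shcM (@emb_hom R O)) -ey; exact: esym PY.
  have e2 : Y.1 = cmul Y.1 (vertex_elt O o).
    by apply: (@emb_inj R O); rewrite (shcM (@emb_hom R O)) -ey; exact: esym YP.
  rewrite !mulrA -(mulrA _ (vx o) (vx o)^#).
  rewrite {1}e1 {1}e2 !(shcM rh) rho_vertex !cmulE.
  by rewrite mulrA.
have GE : Gam (y%:M : 'M[U]_1) = 1 + (cx 0 * vx o) * (Y - 1) * (cx 0 * vx o)^#.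
  rewrite /Gam /Phi !big_ord1 /= !mxE eqxx !mulr1n rt1 /rt y2 scale1r.
  by rewrite ro -ey csM; ncring.
(* [Gam] has moved [Y] along this loop. It begins with [la], hence is incomparable with [lb], and
   [absorption] applies to the pair. *)
pose kap := cpath 0 ++ vpath o.
have gk : gwalk o kap o.
  by apply: gwalk_cat (gwalk_cpath 0) _; exact: gwalk_vpath.
have ek : cx 0 * vx o = pel o kap.
  by rewrite (pel_cat rel (gwalk_cpath 0) (gwalk_vpath o)).
have ck : ~~ comp kap lb.
  by apply: contra clab; rewrite /kap /cpath /= -{1}[lb]cats0; exact: comp_cat.
have := absorption gk glb ck hY; rewrite -ek -GE /lam_eq => l.
have [G1 G2 _] := GU _ _ hy.
have -> : Y = Y * (Gam (y%:M : 'M[U]_1))^# * Gam (y%:M : 'M[U]_1) by rewrite -mulrA G1 mulr1.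
by apply: UgenM gy; exact: UgenLam.
Qed.

Lemma PhiD n k (W V : 'M[U]_(n, k)) : Phi (W + V) = Phi W + Phi V.
Proof.
rewrite /Phi -big_split; apply: eq_bigr => i _; rewrite -big_split; apply: eq_bigr => j _.
by rewrite mxE rtD mulrDr mulrDl.
Qed.

Lemma Phi0 n k : Phi (0 : 'M[U]_(n, k)) = 0.
Proof. by apply: (addrI (Phi (0 : 'M_(n, k)))); rewrite -PhiD !addr0. Qed.

Lemma Phi_proj n (p : 'M[U]_n) : is_projmx p -> proj_elt (Phi p).
Proof. by move=> [h1 h2]; split; rewrite -?Phi_adj -?PhiM ?h1 ?h2. Qed.

Lemma Phi_mx1 x : Phi (mx1 (emb x)) = cx 0 * rho x * (cx 0)^#.
Proof. by rewrite /Phi !big_ord1 mxE eqxx mulr1n /rt /= scale0r addr0. Qed.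

Lemma Phi_dsum0 n d (p : 'M[U]_n) : Phi (dsum p (0 : 'M_d)) = Phi p.
Proof.
rewrite /Phi /dsum big_split_ord /= [X in _ + X]big1 ?addr0 => [|i _].
  apply: eq_bigr => i _; rewrite big_split_ord /= [X in _ + X]big1 ?addr0 => [|j _].
    by apply: eq_bigr => j _; rewrite block_mxEul.
  by rewrite block_mxEur mxE rt0 mulr0 mul0r.
rewrite big_split_ord /= !big1 ?addr0// => j _; rewrite ?block_mxEdl ?block_mxEdr mxE rt0.
  by rewrite mulr0 mul0r.
by rewrite mulr0 mul0r.
Qed.

(** Equality in K_0 means equivalence after adding some projection matrix [r]. [Phi] turns [r] into
    a subprojection [z] of [P o], and adding the class of [P o - z] completes it to [P o]. *)
Lemma proj_class_stable x y : vertex_class O x = vertex_class O y ->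
  proj_class (P x) + proj_class (P o) = proj_class (P y) + proj_class (P o).
Proof.
move=> /(congr1 val)/eqP/grothP[] /=; elim/quotW => r.
rewrite !addr0 !pi_mvnD => /eqP/mvnClassP /=.
set px := ((vertex_elt O x, 0) : U)%:M; set py := ((vertex_elt O y, 0) : U)%:M => -[v [v1 v2]].
pose d := proj_size r; pose z := Phi (dsum (0 : 'M_1) r).
have hz : proj_elt z by apply/Phi_proj/dsum_proj; [exact: proj0 | exact: projP].
have P2 : P o * P o = P o := hP.2.
have zP : P o * z = z by have [] := Phi_corner (dsum (0 : 'M_1) r).
have cl u (pu := ((vertex_elt O u, 0) : U)%:M : 'M_1) :
    proj_elt (Phi pu) /\ proj_class (Phi (dsum pu r)) = proj_class (P u) + proj_class z.
  have e : Phi pu = cx 0 * vx u * (cx 0 * vx u)^#.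
    by rewrite (Phi_mx1 (vertex_elt O u)) rho_vertex csM !mulrA.
  have e1 : (cx 0 * vx u)^# * (cx 0 * vx u) = P u.
    by rewrite csM !mulrA (mulKeq (cxM 0 0)) /= -mulrA P_vx vxM (vel_proj rel u).2.
  have e2 : P o * (cx 0 * vx u) = cx 0 * vx u by rewrite mulrA P_cx.
  have [h1 _ _] := proj_sub (vel_proj rel o) (vel_proj rel u) e1 e2.
  have h : proj_elt (Phi pu) by rewrite e.
  split=> //; rewrite (proj_class_eq (vel_proj rel u) h e1 (esym e)).
  have -> : dsum pu r = dsum pu 0 + dsum 0 r.
    by rewrite /dsum add_block_mx !addr0 !add0r.
  have o0 : Phi pu * z = 0.
    rewrite -(Phi_dsum0 d) /z -PhiM /dsum mulmx_block !mul0mx !mulmx0 !addr0.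
    by rewrite block_mx0 Phi0.
  by rewrite PhiD Phi_dsum0 proj_classD.
have cz : proj_class (P o) = proj_class z + proj_class (P o - z).
  have zz : z^# * z = z by rewrite hz.1 hz.2.
  by have := proj_class_sub (vel_proj rel o) hz zz zP; rewrite hz.1 hz.2.
have clo u : proj_class (P u) + proj_class (P o) =
    proj_class (Phi (dsum (((vertex_elt O u, 0) : U)%:M : 'M_1) r)) + proj_class (P o - z).
  by have [_ ->] := cl u; rewrite cz addrA.
pose c u := proj_class (Phi (dsum (((vertex_elt O u, 0) : U)%:M : 'M_1) r)).
suff cxy : c x = c y by rewrite (clo x) (clo y) [X in X + _ = _]cxy.
have hp u : proj_elt (Phi (dsum (((vertex_elt O u, 0) : U)%:M : 'M_1) r)).
  apply/Phi_proj/dsum_proj; last exact: projP.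
  exact: is_projmx_unitization (vertex_projection rel u).
apply: (proj_class_eq (w := (Phi v)^#)); rewrite ?cstarK -?Phi_adj -?PhiM; [exact: hp|exact: hp| |].
  by rewrite v1.
by rewrite v2.
Qed.

(* Two orthogonal loops at [x] give [P x] = [P x] + h with h >= [P o], and [P y] contains
   [P x]; so h, and hence the stabilizing summand [P o], is absorbed on both sides. *)
Lemma vertex_class_equiv x y la' lb' eta nu : vertex_class O x = vertex_class O y ->
  gwalk x la' x -> gwalk x lb' x -> ~~ comp la' lb' -> gwalk x eta o -> gwalk y nu x ->
  exists w : ucs O, w^# * w = P x /\ w * w^# = P y.
Proof.
move=> /proj_class_stable xy gla' glb' clab' geta gnu.
have hv := vel_proj rel.
have sub u es v : gwalk u es v -> proj_class (P u) =
    proj_class (P v) + proj_class (P u - pel u es * (pel u es)^#).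
  by move=> g; apply: proj_class_sub => //; [exact: (pel_source rel g) | exact: (vel_pel rel g)].
set h := P x - pel x la' * (pel x la')^#.
have gl : gwalk x (lb' ++ eta) o := gwalk_cat glb' geta.
have [_ hh _] := proj_sub (hv x) (hv x) (pel_source rel gla') (vel_pel rel gla').
have hl : h * pel x (lb' ++ eta) = pel x (lb' ++ eta).
  rewrite mulrBl (vel_pel rel gl) -mulrA (pel_orth rel gla' gl) ?mulr0 ?subr0//.
  by apply: contra clab'; rewrite -{1}[la']cats0; exact: comp_cat.
have := proj_class_sub hh (hv o) (pel_source rel gl) hl.
set h' := _ - _ => eh'.
have ex := sub _ _ _ gla'; rewrite -/h in ex.
have ey := sub _ _ _ gnu; set k := P y - _ in ey.
apply: proj_class_inj => //.
have yh : proj_class (P y) + proj_class h = proj_class (P y).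
  by rewrite ey {2}ex addrAC.
by rewrite -yh eh' addrA -xy -addrA -eh' -ex.
Qed.

End CornerEmbedding.

(** * Combinatorics of the exhausting subgraphs *)

Section Exhaustion.
Variables (E : digraph) (F : nat -> subgraph E) (C : vertex E -> vertex E -> Prop).
Local Notation D := (infinite_emitters E).
Hypotheses (E_infinite : infinite_digraph E) (F_finite : forall n, is_finite (F n)).
Hypotheses (F_incr : forall n, is_sub (F n) (F n.+1)).
Hypotheses (F_verts : \bigcup_n verts (F n) = [set: vertex E])
  (F_edges : \bigcup_n edges (F n) = [set: edge E]).
Hypotheses (a1 : D `<=` verts (F 0)) (a2 : forall n, irreducible (F n)).
Hypothesis a4 : forall n e, (verts (F n) `\` D) (origin e) -> edges (F n) e.
Hypothesis b2 : forall u, ~ D u -> exists v, (verts (F 0) `\` D) v /\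
  exists ge, set_bij (out_edges u) (out_edges v) ge /\
    forall e, out_edges u e -> C (terminus e) (terminus (ge e)).

Lemma verts_mono n k : (n <= k)%N -> verts (F n) `<=` verts (F k).
Proof.
move=> /subnK <-; elim: (k - n)%N => // d IH x /IH; rewrite addSn.
by have [h _] := F_incr (d + n); exact: h.
Qed.

Lemma verts_ex x : exists n, verts (F n) x.
Proof. by have : [set: vertex E] x by []; rewrite -F_verts => -[n _]; exists n. Qed.

Lemma walk_gwalk G u es v : walk G u es v -> gwalk (E := E) u es v.
Proof. by elim: es u => //= e es IH u [_ h /IH]. Qed.

Lemma strongly_connected u v : exists2 es, es <> [::] & gwalk (E := E) u es v.
Proof.
have [n un] := verts_ex u; have [k vk] := verts_ex v.
have [es es0 w] := a2 (verts_mono (leq_maxl n k) un) (verts_mono (leq_maxr n k) vk).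
by exists es => //; exact: walk_gwalk w.
Qed.

(** Otherwise (a4) would make [F 0] closed under leaving edges; as every vertex is reached from
    [F 0], the graph would be contained in the finite [F 0]. *)
Lemma emitter_ex : exists d, D d.
Proof.
apply: contrapT => nD; have nDu u : ~ D u by move=> h; apply: nD; exists u.
have V0 w : verts (F 0) w.
  have [v [[v0 _] _]] := b2 (nDu w); have [es _] := strongly_connected v w.
  elim: es v v0 => [v v0 <- //|e es IH v v0 /= [ev]]; apply: IH.
  by apply: (terminus_verts (a4 _)); rewrite ev; split.
have E0 e : edges (F 0) e by apply: a4; split.
have [f1 f2] := F_finite 0.
by case: E_infinite; apply; [apply: sub_finite_set f1 | apply: sub_finite_set f2].
Qed.

(** A path leads from [x] to an infinite emitter, which is left by two different edges, each
    continued back to [x]. *)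
Lemma incomparable_loops x : exists la lb, [/\ gwalk (E := E) x la x, gwalk x lb x & ~~ comp la lb].
Proof.
have [d Dd] := emitter_ex; have [et _ gxd] := strongly_connected x d.
have [e oe] : exists e, out_edges d e.
  apply: contrapT => n; apply: Dd; rewrite (_ : out_edges d = set0)//.
  by apply/seteqP; split=> // e h; apply: n; exists e.
have [f [of_ fe]] : exists f, out_edges d f /\ f <> e.
  apply: contrapT => n; apply: Dd; apply: (@sub_finite_set _ _ [set e]) => // f of_.
  by apply: contrapT => fe; apply: n; exists f.
have [s _ gs] := strongly_connected (terminus e) x.
have [t _ gt] := strongly_connected (terminus f) x.
exists (et ++ e :: s), (et ++ f :: t); split.
- by apply: gwalk_cat gxd _.
- by apply: gwalk_cat gxd _.
by rewrite comp_catl /=; apply/negP => /andP[/eqP/esym].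
Qed.

Lemma enumerated (T : choiceType) (V : nat -> set T) :
  (forall n, finite_set (V n)) -> \bigcup_n V n = [set: T] -> exists m : T -> nat, injective m.
Proof.
move=> fV UV; have : countable [set: T].
  by rewrite -UV; apply: bigcup_countable => // n _; exact: finite_set_countable.
move=> /countable_injP[m hm]; exists m => x y xy; apply: hm => //; exact: mem_setT.
Qed.

Lemma vertex_enumerated : exists m : vertex E -> nat, injective m.
Proof. by apply: (enumerated _ F_verts) => n; have [] := F_finite n. Qed.

Lemma edge_enumerated : exists m : edge E -> nat, injective m.
Proof. by apply: (enumerated _ F_edges) => n; have [] := F_finite n. Qed.

(** [sequence_lift] runs through all natural numbers, so the vertices outside the base must be none
    or infinitely many. If there are finitely many vertices, a late [F N] contains them all;
    otherwise [F 0] serves. *)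
Lemma base_vertices : exists V0 : seq (vertex E), [/\ uniq V0, forall d, D d -> d \in V0,
  forall e, origin e \in V0 -> ~ D (origin e) -> terminus e \in V0,
  (forall u, u \in V0) \/ infinite_set [set u | u \notin V0] &
  forall u, ~ D u -> exists v, [/\ v \in V0, ~ D v & exists ge,
    set_bij (out_edges u) (out_edges v) ge /\
    forall e, out_edges u e -> C (terminus e) (terminus (ge e))]].
Proof.
have [N hN] : exists N, (forall u, verts (F N) u) \/ infinite_set (~` verts (F N)).
  have [fin|inf] := pselect (finite_set [set: vertex E]); last first.
    exists 0%N; right => f; apply: inf; rewrite -(setvU (verts (F 0))).
    by rewrite finite_setU; split=> //; have [] := F_finite 0.
  have [l hl] := (finite_seqP _).1 fin.
  have [N hN] : exists N, forall u, u \in l -> verts (F N) u.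
    elim: l {hl} => [|x l [N hN]]; first by exists 0%N.
    have [n xn] := verts_ex x; exists (maxn n N) => u; rewrite inE => /orP[/eqP->|/hN].
      exact: verts_mono (leq_maxl _ _) _ xn.
    exact: verts_mono (leq_maxr _ _) _.
  by exists N; left => u; apply: hN; have : [set: vertex E] u by []; rewrite hl.
have [f1 _] := F_finite N; have [l hl] := (finite_seqP _).1 f1.
have inV u : u \in undup l <-> verts (F N) u by rewrite mem_undup hl.
exists (undup l); split; rewrite ?undup_uniq//.
- by move=> d /a1 /(verts_mono (leq0n N)) /inV.
- by move=> e /inV h1 h2; apply/inV/(terminus_verts (a4 _)); split.
- case: hN => [h|h]; [by left=> u; apply/inV | right]; rewrite (_ : [set u | _] = ~` verts (F N))//.
  by apply/seteqP; split=> u /=; [move=> /negP n /inV | move=> n; apply/negP => /inV].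
move=> u /b2[v [[v0 Dv] h]]; exists v; split=> //.
by apply/inV; exact: verts_mono (leq0n N) _ v0.
Qed.

End Exhaustion.

Lemma orth_mul (R : realType) (A : cstarAlgType R) (p q a b : ucs A) :
  p^# = p -> p * a = a -> q * b = b -> p * q = 0 -> a^# * b = 0.
Proof. by move=> ps <- <- pq; rewrite csM ps mulrA -(mulrA _ p) pq mulr0 mul0r. Qed.

Lemma range_mul (R : realType) (A : cstarAlgType R) (p q w : ucs A) :
  proj_elt p -> w^# * w = p -> w * w^# = q -> q * w = w.
Proof. by move=> hp wp <-; rewrite -mulrA wp (piso_mul hp wp). Qed.

Lemma sum_orth (R : realType) (A : cstarAlgType R) (I : eqType) (l : seq I) (p : I -> ucs A) :
  uniq l -> {in l, forall i, proj_elt (p i)} -> {in l &, forall i j, i <> j -> p i * p j = 0} ->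
  proj_elt (\sum_(i <- l) p i) /\ {in l, forall i, p i * (\sum_(i <- l) p i) = p i}.
Proof.
move=> ul hp po; have H : {in l, forall i, p i * (\sum_(i <- l) p i) = p i}.
  move=> i il; rewrite mulr_sumr (bigD1_seq i)//= (hp i il).2 big_seq_cond big1 ?addr0//.
  by move=> j /andP[jl /eqP ji]; apply: po => // /esym.
split=> //; split.
  by rewrite cs_sum [LHS]big_seq [RHS]big_seq; apply: eq_bigr => i /hp[].
by rewrite mulr_suml [LHS]big_seq [RHS]big_seq; apply: eq_bigr => i il; exact: H.
Qed.

Lemma proj_compl (R : realType) (A : cstarAlgType R) (p : ucs A) :
  proj_elt p -> proj_elt (1 - p) /\ (p * (1 - p) = 0).
Proof.
move=> [ps pp]; split; last by rewrite mulrBr mulr1 pp subrr.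
by split; rewrite ?cstarB ?cs1 ?ps// mulrBr mulr1 mulrBl mul1r pp subrr subr0.
Qed.

Lemma corner_unitary_compl (R : realType) (A : cstarAlgType R) (p y : ucs A) :
  proj_elt p -> p * y = y -> y * p = y -> y^# * y = p -> y * y^# = p ->
  corner_unitary p (1 - p + y).
Proof.
move=> [ps pp] py yp y1 y2; have ysp : y^# * p = y^# by rewrite -{1}ps -csM py.
have pys : p * y^# = y^# by rewrite -{1}ps -csM yp.
split.
- transitivity (1 - p - p + p * p + (y - p * y) + (y^# - y^# * p) + y^# * y).
    by rewrite cstarD cstarB cs1 ps; ncring.
  by rewrite pp y1 py ysp; ncring.
- transitivity (1 - p - p + p * p + (y - y * p) + (y^# - p * y^#) + y * y^#).
    by rewrite cstarD cstarB cs1 ps; ncring.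
  by rewrite pp y2 yp pys; ncring.
have -> : 1 - p + y - 1 = y - p by ncring.
by split; rewrite ?mulrBr ?mulrBl ?py ?yp pp.
Qed.

Lemma set_seq_perm (T : choiceType) (l l' : seq T) : uniq l -> uniq l' ->
  [set` l] = [set` l'] -> perm_eq l l'.
Proof.
move=> ul ul' e; apply: uniq_perm => // x.
by apply/idP/idP => h; [have : [set` l'] x by rewrite -e | have : [set` l] x by rewrite e].
Qed.

Lemma set_bij_seq (T : choiceType) (A B : set T) (g : T -> T) (l : seq T) :
  set_bij A B g -> uniq l -> A = [set` l] -> uniq (map g l) /\ B = [set` map g l].
Proof.
move=> [gB g_inj g_surj] ul hl; split.
  by rewrite map_inj_in_uniq// => x y xl yl; apply: g_inj; rewrite inE hl.
apply/seteqP; split=> [y /g_surj[x + <-]|y /= /mapP[x xl ->]].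
  by rewrite hl => xl; apply/mapP; exists x.
by apply: gB; rewrite hl.
Qed.

(** * Lifting all generators at a fixed stage *)

Section Assembly.
Variables (R : realType) (E : digraph) (O : graph_algebra R E) (Q : cstarAlgType R).
Local Notation P := (vel (vertex_elt O)).
Local Notation S := (eel (edge_elt O)).
Local Notation rel := (graph_algebraP O).
Local Notation D := (infinite_emitters E).
Variable f : ucs Q -> ucs O.
Hypotheses (uf : unital_hom f) (fsurj : forall x, exists y, f y = x).
Let hf : is_star_hom f := uf.1.
Variables (V0 : seq (vertex E)) (vv : vertex E -> vertex E) (w ka : vertex E -> ucs O).
Variables (o : vertex E) (pb al : vertex E -> ucs Q) (be : ucs Q).
Hypotheses (uV0 : uniq V0) (vvV : forall u, vv u \in V0) (oV : o \in V0).
Hypotheses (w_src : forall u, (w u)^# * w u = P (vv u)) (w_rng : forall u, w u * (w u)^# = P u).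
Hypotheses (ka_iso : forall u, (ka u)^# * ka u = P o) (vka : forall u, P (vv u) * ka u = ka u).
Hypotheses (pb_proj : {in V0, forall v, proj_elt (pb v)})
  (pb_orth : {in V0 &, forall v v', v <> v' -> pb v * pb v' = 0})
  (fpb : {in V0, forall v, f (pb v) = P v}).
Hypotheses (be_iso : be^# * be = pb o) (obe : pb o * be = be).
Hypotheses (al_iso : {in V0, forall v, (al v)^# * al v = pb v})
  (oal : {in V0, forall v, pb o * al v = al v}) (be_al : {in V0, forall v, be^# * al v = 0}).

Lemma P_w u : P u * w u = w u.
Proof. exact: range_mul (vel_proj rel _) (w_src u) (w_rng u). Qed.

Let psum := \sum_(v <- V0) pb v.

(** The image of [1 - psum] contains the ranges of all [w (en n)], so [sequence_lift] applies under
    [1 - psum]. The ranges of the lifts [wt u] will be the lifted vertex projections. *)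
Lemma outer_isometries (en : nat -> vertex E) (r : ucs Q) :
  injective en -> (forall n, en n \notin V0) -> (forall u, u \notin V0 -> exists n, en n = u) ->
  r^# * r = pb o -> (1 - psum) * r = r -> f r = w (en 0) * ka (en 0) ->
  exists wt : vertex E -> ucs Q, forall u, u \notin V0 ->
    [/\ (wt u)^# * wt u = pb (vv u), {in V0, forall v, pb v * wt u = 0}, f (wt u) = w u &
      forall u', u' \notin V0 -> u <> u' -> (wt u)^# * wt u' = 0].
Proof.
move=> en_inj enV en_surj rr Gr fr; have [hpsum psumE] := sum_orth uV0 pb_proj pb_orth.
have [hG pG] := proj_compl hpsum.
have Gw n : f (1 - psum) * w (en n) = w (en n).
  rewrite (shB hf) uf.2 mulrBl mul1r (sh_sum hf) mulr_suml big_seq big1 ?subr0// => v vV.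
  rewrite fpb// -P_w mulrA (velM rel) ?mul0r// => e.
  by have := enV n; rewrite -e vV.
have worth n k : n <> k -> (w (en n))^# * w (en k) = 0.
  move=> nk; apply: orth_mul (P_w _) (P_w _) _; first exact: (vel_proj rel _).1.
  by apply: (velM rel) => /en_inj.
have [||||||||||||||||wt' [h1 h2 h3 h4]] := @sequence_lift R Q O f uf fsurj (1 - psum) (pb o) r
  (pb \o vv \o en) (al \o vv \o en) be (w \o en) (ka \o en) => //=.
- exact: pb_proj.
- by move=> n; exact: pb_proj.
- by move=> n; exact: al_iso.
- by move=> n; exact: oal.
- by move=> n; exact: be_al.
- by move=> n; rewrite w_src fpb.
- by move=> n; rewrite ka_iso fpb.
- by move=> n; rewrite fpb.
have /choice[nu hnu] : forall u, exists n, u \notin V0 -> en n = u.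
  move=> u; have [uV|/en_surj[n e]] := boolP (u \in V0); first by exists 0%N.
  by exists n.
exists (wt' \o nu) => u uV; have en_u := hnu u uV; rewrite /=; split.
- by rewrite h1 /= en_u.
- move=> v vV; rewrite -(h2 (nu u)) mulrA mulrBr mulr1 psumE// subrr mul0r//.
- by rewrite h4 /= en_u.
move=> u' u'V uu'; apply: h3 => e; apply: uu'.
by rewrite -en_u -(hnu u' u'V) e.
Qed.

Variables (wt : vertex E -> ucs Q) (sb : edge E -> ucs Q).
Hypotheses (vv0 : {in V0, forall v, vv v = v}).
Hypotheses (wt_src : forall u, (wt u)^# * wt u = pb (vv u))
  (wt_orth : forall u u', u <> u' -> (wt u)^# * wt u' = 0)
  (wt0 : {in V0, forall v, wt v = pb v}) (fwt : forall u, f (wt u) = w u).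
Hypothesis tV : forall e, origin e \in V0 -> ~ D (origin e) -> terminus e \in V0.
Hypotheses (sb_src : forall e, origin e \in V0 -> ~ D (origin e) ->
    (sb e)^# * sb e = pb (terminus e))
  (sb_rng : forall e, origin e \in V0 -> ~ D (origin e) -> pb (origin e) * sb e = sb e)
  (fsb : forall e, origin e \in V0 -> ~ D (origin e) -> f (sb e) = S e)
  (sb_sum : forall v l, v \in V0 -> ~ D v -> uniq l -> out_edges v = [set` l] ->
    \sum_(e <- l) sb e * (sb e)^# = pb v).
Hypothesis yb_ex : {in V0 &, forall v v', (exists x : ucs O, x^# * x = P v /\ x * x^# = P v') ->
  exists y : ucs Q, y^# * y = pb v /\ y * y^# = pb v'}.
Hypothesis unitary_lift : {in V0, forall v, ~ D v -> forall Y, corner_unitary (P v) Y ->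
  exists2 Z, corner_unitary (pb v) Z & f Z = Y}.

Definition pt u := wt u * (wt u)^#.

Let hpb u : proj_elt (pb (vv u)). Proof. exact: pb_proj. Qed.

Lemma wt_pb u : wt u * pb (vv u) = wt u.
Proof. exact: piso_mul (hpb u) (wt_src u). Qed.

Lemma pt_proj u : proj_elt (pt u).
Proof. by split; rewrite /pt ?csM ?cstarK// mulrA (mulKeq (wt_src u)) wt_pb. Qed.

Lemma pt_wt u : pt u * wt u = wt u.
Proof. by rewrite /pt -mulrA wt_src wt_pb. Qed.

Lemma pt0 : {in V0, forall v, pt v = pb v}.
Proof. by move=> v vV; rewrite /pt wt0// (pb_proj vV).1 (pb_proj vV).2. Qed.

Lemma pt_orth u u' : u <> u' -> pt u * pt u' = 0.
Proof. by move=> uu'; rewrite /pt mulrA (mulKeq (wt_orth uu')) mulr0 mul0r. Qed.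

Lemma fpt u : f (pt u) = P u.
Proof. by rewrite /pt (shM _ _ hf) (shS hf) fwt w_rng. Qed.

Let S_w e : S e * w (terminus e) * (w (terminus e))^# = S e.
Proof. by rewrite -mulrA w_rng (eel_vel rel). Qed.

(** Only base projections are available as sources of the pieces [al] in [sequence_lift]; so it is
    applied to [S e * w (terminus e)], with source [P (vv (terminus e))], and the factor
    [w (terminus e)] is undone by [wt] afterwards. *)
Lemma infinite_emitter_lift (d : vertex E) (ee : nat -> edge E) (r : ucs Q) : d \in V0 ->
  injective ee -> (forall n, origin (ee n) = d) ->
  (forall e, origin e = d -> exists n, ee n = e) ->
  r^# * r = pb o -> pb d * r = r -> f r = S (ee 0) * w (terminus (ee 0)) * ka (terminus (ee 0)) ->
  exists st : edge E -> ucs Q, forall e, origin e = d ->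
    [/\ (st e)^# * st e = pt (terminus e), pt d * st e = st e, f (st e) = S e &
      forall e', origin e' = d -> e <> e' -> (st e)^# * st e' = 0].
Proof.
move=> dV ee_inj ee_o ee_surj rr dr fr.
pose x e := S e * w (terminus e).
have xx e e' : (x e)^# * x e' = (w (terminus e))^# * ((S e)^# * S e') * w (terminus e').
  by rewrite /x csM !mulrA.
have x_iso e : (x e)^# * x e = P (vv (terminus e)).
  by rewrite xx (eel_source rel) -mulrA P_w w_src.
have x_orth e e' : e <> e' -> (x e)^# * x e' = 0.
  by move=> ee'; rewrite xx (eel_orth rel ee') mulr0 mul0r.
have [||||||||||||||||wt' [h1 h2 h3 h4]] := @sequence_lift R Q O f uf fsurj (pb d) (pb o) r
  (fun n => pb (vv (terminus (ee n)))) (fun n => al (vv (terminus (ee n)))) be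
  (fun n => x (ee n)) (fun n => ka (terminus (ee n))) => //=.
- exact: pb_proj.
- exact: pb_proj.
- by move=> n; exact: al_iso.
- by move=> n; exact: oal.
- by move=> n; exact: be_al.
- by move=> n; rewrite x_iso fpb.
- by move=> n; rewrite fpb// /x mulrA -{1}(ee_o n) (vel_eel rel).
- by move=> n k nk; apply: x_orth => /ee_inj.
- by move=> n; rewrite ka_iso fpb.
- by move=> n; rewrite fpb.
have /choice[nu hnu] : forall e, exists n, origin e = d -> ee n = e.
  move=> e; have [ed|ed] := pselect (origin e = d); last by exists 0%N.
  by have [n en] := ee_surj e ed; exists n.
exists (fun e => wt' (nu e) * (wt (terminus e))^#) => e ed.
have hn := hnu e ed; split.
- rewrite csM cstarK mulrA (mulKeq (h1 _)) hn wt_pb//.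
- by rewrite pt0// mulrA h2.
- by rewrite (shM _ _ hf) (shS hf) h4 fwt hn S_w.
move=> e' ed' ee'; rewrite csM cstarK mulrA -(mulrA (wt _)) h3 ?mulr0 ?mul0r// => nn.
by apply: ee'; rewrite -hn -(hnu e' ed') nn.
Qed.

(* Through [w u], [sb] and [yb_ex] one obtains lifts [me e] of partial isometries with the
   right initial projections, whose ranges add up to [pt u].  They differ from the [S e] by a
   unitary [Y] of the corner at [u], and [Y] lifts because it comes from the corner at [vv u]. *)
Lemma finite_emitter_lift u (ge : edge E -> edge E) : ~ D u -> ~ D (vv u) ->
  set_bij (out_edges u) (out_edges (vv u)) ge ->
  (forall e, origin e = u -> exists x : ucs O,
     x^# * x = P (vv (terminus e)) /\ x * x^# = P (terminus (ge e))) ->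
  exists st : edge E -> ucs Q, [/\ forall e, origin e = u -> (st e)^# * st e = pt (terminus e),
    forall e, origin e = u -> f (st e) = S e &
    forall l, uniq l -> out_edges u = [set` l] -> \sum_(e <- l) st e * (st e)^# = pt u].
Proof.
move=> Du Dv bij hx; have [ge_out ge_inj _] := bij.
have go e : origin e = u -> origin (ge e) = vv u by exact: ge_out.
have goV e : origin e = u -> origin (ge e) \in V0 by move=> /go->.
have goD e : origin e = u -> ~ D (origin (ge e)) by move=> /go->.
have /choice[y hy] : forall e, exists y : ucs Q, origin e = u ->
    y^# * y = pb (vv (terminus e)) /\ y * y^# = pb (terminus (ge e)).
  move=> e; have [eu|eu] := pselect (origin e = u); last by exists 0.
  have [y hy] := yb_ex (vvV _) (tV (goV e eu) (goD e eu)) (hx e eu); by exists y.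
pose me e := wt u * sb (ge e) * y e * (wt (terminus e))^#.
have sbs e : origin e = u -> (sb (ge e))^# * sb (ge e) = pb (terminus (ge e)).
  by move=> eu; apply: sb_src; [exact: goV | exact: goD].
have vsb e : origin e = u -> pb (vv u) * sb (ge e) = sb (ge e).
  by move=> eu; rewrite -{1}(go e eu); apply: sb_rng; [exact: goV | exact: goD].
have tgV e : origin e = u -> terminus (ge e) \in V0 by move=> eu; apply: tV; [exact: goV | exact: goD].
have y_src e : origin e = u -> (y e)^# * y e = pb (vv (terminus e)) by move=> /hy[].
have y_rng e : origin e = u -> y e * (y e)^# = pb (terminus (ge e)) by move=> /hy[].
have py e : origin e = u -> pb (terminus (ge e)) * y e = y e.
  by move=> eu; exact: range_mul (hpb _) (y_src e eu) (y_rng e eu).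
have me_src e : origin e = u -> (me e)^# * me e = pt (terminus e).
  move=> eu; rewrite /me !csM cstarK !mulrA (mulKeq (wt_src u)) -(mulrA _ (pb _)) vsb//.
  by rewrite (mulKeq (sbs e eu)) -(mulrA _ (pb _)) py// (mulKeq (y_src e eu)) wt_pb.
have me_rng e : origin e = u -> me e * (me e)^# = wt u * (sb (ge e) * (sb (ge e))^#) * (wt u)^#.
  move=> eu; rewrite /me !csM cstarK !mulrA (mulKeq (wt_src _)).
  rewrite -(mulrA _ (y e) (pb _)) (piso_mul (hpb _) (y_src e eu)) (mulKeq (y_rng e eu)).
  rewrite -(mulrA _ (sb _) (pb _)) (piso_mul _ (sbs e eu))//.
  exact/pb_proj/tgV.
have [l ul hl] := finite_emitter_seq Du.
have lu e : e \in l -> origin e = u by move=> el; have : out_edges u e by rewrite hl.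
have [ul' hl'] := set_bij_seq bij ul hl.
have me_sum : \sum_(e <- l) me e * (me e)^# = pt u.
  rewrite [LHS]big_seq (eq_bigr _ (fun e el => me_rng e (lu e el))) -big_seq.
  rewrite -mulr_suml -mulr_sumr; have := sb_sum (vvV u) Dv ul' hl'; rewrite big_map => ->.
  by rewrite wt_pb.
pose M e := f (me e).
have MM e : origin e = u -> (M e)^# * M e = P (terminus e).
  by move=> eu; rewrite /M -(shS hf) -(shM _ _ hf) me_src// fpt.
have M_sum : \sum_(e <- l) M e * (M e)^# = P u.
  rewrite -fpt -me_sum (sh_sum hf); apply: eq_bigr => e _.
  by rewrite (shM _ _ hf) (shS hf).
have PM e : P u * M e = M e.
  by rewrite /M -fpt -(shM _ _ hf) /me !mulrA pt_wt.
have MP e : origin e = u -> M e * P (terminus e) = M e.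
  by move=> eu; exact: piso_mul (vel_proj rel _) (MM e eu).
have ME e : origin e = u -> M e = w u * S (ge e) * f (y e) * (w (terminus e))^#.
  move=> eu; rewrite /M /me !(shM _ _ hf) (shS hf) !fwt fsb//; [exact: goV | exact: goD].
have Morth e e' : e \in l -> e' \in l -> e <> e' -> (M e)^# * M e' = 0.
  move=> el e'l ee'; rewrite !ME ?lu// !csM cstarK !mulrA (mulKeq (w_src u)).
  rewrite -{1}(go e' (lu e' e'l)) -(mulrA _ (P _)) (vel_eel rel) (mulKeq (eel_orth rel _)).
    by rewrite mulr0 !mul0r.
  move=> /ge_inj e_e'; apply: ee'; apply: e_e'; rewrite inE hl//.
have [Ps _] := vel_proj rel u.
(* [A] sends each [M e] to [S e]. It is a unitary of the corner at [u] because the ranges of either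
   family add up to [P u]. *)
pose A := \sum_(e <- l) S e * (M e)^#.
have PA : P u * A = A.
  rewrite mulr_sumr [LHS]big_seq [RHS]big_seq; apply: eq_bigr => e el.
  by rewrite mulrA -{1}(lu e el) (vel_eel rel).
have AP : A * P u = A.
  rewrite mulr_suml; apply: eq_bigr => e _.
  by rewrite -mulrA -Ps -csM PM.
have AM e : e \in l -> A * M e = S e.
  move=> el; rewrite mulr_suml (bigD1_seq e)//= -mulrA MM ?lu// (eel_vel rel).
  rewrite big_seq_cond big1 ?addr0// => e' /andP[e'l /eqP e'e].
  by rewrite -mulrA Morth// mulr0.
have AA : A * A^# = P u.
  rewrite {2}/A cs_sum mulr_sumr -(vel_sum rel Du ul hl) [LHS]big_seq [RHS]big_seq.
  by apply: eq_bigr => e el; rewrite csM cstarK mulrA AM.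
have AS e : e \in l -> A^# * S e = M e.
  move=> el; rewrite cs_sum mulr_suml (bigD1_seq e)//= csM cstarK -mulrA (eel_source rel) MP ?lu//.
  rewrite big_seq_cond big1 ?addr0// => e' /andP[e'l /eqP e'e].
  by rewrite csM cstarK -mulrA (eel_orth rel e'e) mulr0.
have AA' : A^# * A = P u.
  rewrite {2}/A mulr_sumr -M_sum [LHS]big_seq [RHS]big_seq.
  by apply: eq_bigr => e el; rewrite mulrA AS.
clearbody A.
pose Y := 1 - P u + A.
have hY : corner_unitary (P u) Y by exact: corner_unitary_compl (vel_proj rel u) PA AP AA' AA.
have YM e : e \in l -> Y * M e = S e.
  by move=> el; rewrite /Y mulrDl mulrBl mul1r PM subrr add0r AM.
have wss : (w u)^#^# * (w u)^# = P u by rewrite cstarK w_rng.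
have hY' := corner_unitary_conj (vel_proj rel u) wss hY; rewrite cstarK w_src in hY'.
have [Z' hZ' fZ'] := unitary_lift (vvV u) Dv hY'.
have hZ := corner_unitary_conj (hpb u) (wt_src u) hZ'; set Z := (X in corner_unitary _ X) in hZ.
have fZ : f Z = Y.
  have e : f Z' - 1 = (w u)^# * (Y - 1) * w u by rewrite fZ'; ncring.
  have [_ _ [h1 h2]] := hY.
  rewrite /Z (shD hf) uf.2 !(shM _ _ hf) (shB hf) (shS hf) uf.2 !fwt e !mulrA w_rng.
  by rewrite -(mulrA _ (w u)) w_rng h1 h2 addrC subrK.
have [Z1 Z2 _] := hZ.
exists (fun e => Z * me e); split.
- move=> e eu; rewrite csM -mulrA (mulrA Z^#) Z1 mul1r; exact: me_src.
- move=> e eu; rewrite (shM _ _ hf) fZ YM//; have : out_edges u e by []; by rewrite hl.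
move=> l' ul1 hl1; have pl : perm_eq l' l by exact: set_seq_perm (etrans (esym hl1) hl).
rewrite (perm_big _ pl) /=.
transitivity (Z * (\sum_(e <- l) me e * (me e)^#) * Z^#).
  by rewrite mulr_sumr mulr_suml; apply: eq_bigr => e _; rewrite csM !mulrA.
by rewrite me_sum -/(pt u) (corner_unitary_comm hZ) -mulrA Z2 mulr1.
Qed.

(** The relations other than those of sources concern edges leaving one common vertex, so families
    are chosen vertex by vertex and glued along [origin]. *)
Lemma graph_lift : (forall d, D d -> d \in V0) ->
  (forall u, u \notin V0 -> ~ D (vv u) /\ exists ge, set_bij (out_edges u) (out_edges (vv u)) ge /\
     forall e, origin e = u -> exists x : ucs O,
       x^# * x = P (vv (terminus e)) /\ x * x^# = P (terminus (ge e))) ->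
  (forall d, D d -> exists (ee : nat -> edge E) (r : ucs Q), [/\ injective ee,
     forall n, origin (ee n) = d, forall e, origin e = d -> exists n, ee n = e &
     [/\ r^# * r = pb o, pb d * r = r &
         f r = S (ee 0) * w (terminus (ee 0)) * ka (terminus (ee 0))]]) ->
  exists st : edge E -> ucs Q,
    [/\ forall e, (st e)^# * st e = pt (terminus e), forall e, f (st e) = S e,
        forall e, D (origin e) -> pt (origin e) * st e = st e,
        forall e e', e <> e' -> origin e = origin e' -> D (origin e) -> (st e)^# * st e' = 0 &
        forall u l, ~ D u -> uniq l -> out_edges u = [set` l] ->
          \sum_(e <- l) st e * (st e)^# = pt u].
Proof.
move=> DV outer inner.
have /choice[F hF] : forall u, exists st : edge E -> ucs Q,
    [/\ forall e, origin e = u -> (st e)^# * st e = pt (terminus e),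
        forall e, origin e = u -> f (st e) = S e,
        D u -> forall e, origin e = u -> pt u * st e = st e /\
          forall e', origin e' = u -> e <> e' -> (st e)^# * st e' = 0 &
        ~ D u -> forall l, uniq l -> out_edges u = [set` l] ->
          \sum_(e <- l) st e * (st e)^# = pt u].
  move=> u; have [Du|Du] := pselect (D u).
    have [ee [r [h1 h2 h3 [h4 h5 h6]]]] := inner u Du.
    have [st hst] := infinite_emitter_lift (DV _ Du) h1 h2 h3 h4 h5 h6; exists st; split=> //.
    - by move=> e /hst[].
    - by move=> e /hst[].
    by move=> _ e /hst[].
  have [uV|uV] := boolP (u \in V0); last first.
    have [Dv [ge [bij hx]]] := outer u uV.
    have [st [h1 h2 h3]] := finite_emitter_lift Du Dv bij hx; exists st; split=> //.
  exists sb; split=> //.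
  - by move=> e eu; rewrite sb_src ?eu// pt0//; apply: tV; rewrite eu.
  - by move=> e eu; apply: fsb; rewrite eu.
  by move=> _ l ul hl; rewrite pt0//; exact: sb_sum.
exists (fun e => F (origin e) e); split.
- by move=> e; have [h _ _ _] := hF (origin e); exact: h.
- by move=> e; have [_ h _ _] := hF (origin e); exact: h.
- by move=> e De; have [_ _ h _] := hF (origin e); have [] := h De e erefl.
- move=> e e' ee' oe De; rewrite -oe.
  by have [_ _ h _] := hF (origin e); have [_ h'] := h De e erefl; apply: h'.
move=> u l Du ul hl; have [_ _ _ h] := hF u; rewrite -(h Du l ul hl).
rewrite [LHS]big_seq [RHS]big_seq; apply: eq_bigr => e el.
by have -> // : origin e = u by have : out_edges u e by rewrite hl.
Qed.

End Assembly.

(** * Perturbation arguments along a directed system of quotients *)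

(* [qe i] plays the role of the quotient map onto the quotient by the i-th ideal of a
   directed family, and [qh] that of the quotient map by the closure of its union. *)
Section LiftingSystem.
Variables (R : realType) (B A : cstarAlgType R) (T : Type) (le : T -> T -> Prop).
Variables (C : T -> cstarAlgType R) (qe : forall i, ucs B -> ucs (C i)).
Variables (qh : ucs B -> ucs A) (fe : forall i, ucs (C i) -> ucs A).
Hypotheses (le_refl : forall i, le i i) (le_trans : forall i j k, le i j -> le j k -> le i k).
Hypotheses (qe_hom : forall i, unital_hom (@qe i)) (qh_hom : unital_hom qh)
  (fe_hom : forall i, unital_hom (@fe i)) (fe_qe : forall i x, fe (qe i x) = qh x).
Hypotheses (qe_surj : forall i y, exists x, qe i x = y) (qh_surj : forall y, exists x, qh x = y).
Hypothesis qe_mono : forall i j x y, le i j -> qe i x = qe i y -> qe j x = qe j y.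
Hypothesis qe_small : forall i z (e : R), qh z = 0 -> 0 < e ->
  exists2 j, le i j & forall k, le j k -> nm (qe k z) <= e.

Let qeM i x y : qe i (x * y) = qe i x * qe i y := shM x y (qe_hom i).1.
Let qeS i x : qe i x^# = (qe i x)^# := shS (qe_hom i).1 x.
Let qeB i x y : qe i (x - y) = qe i x - qe i y := shB (qe_hom i).1 x y.
Let qhM x y : qh (x * y) = qh x * qh y := shM x y qh_hom.1.
Let qhS x : qh x^# = (qh x)^# := shS qh_hom.1 x.
Let qhB x y : qh (x - y) = qh x - qh y := shB qh_hom.1 x y.

Lemma qe_proj i j p : le i j -> proj_elt (qe i p) -> proj_elt (qe j p).
Proof.
move=> ij [h1 h2]; split; rewrite -?qeS -?qeM; apply: (qe_mono ij); first by rewrite qeS.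
by rewrite qeM.
Qed.

Lemma qh_proj i p : proj_elt (qe i p) -> proj_elt (qh p).
Proof.
move=> [h1 h2]; rewrite -(fe_qe i); split.
  by rewrite -(shS (fe_hom i).1) h1.
by rewrite -(shM _ _ (fe_hom i).1) h2.
Qed.

(** A preimage cut down to [g y p] satisfies the relations up to a small error at a late stage and
    is corrected there by a factor [c] with [fe c = 1], so its image stays [x]. *)
Lemma lift_partial_isometry i p g (x : ucs A) : proj_elt (qe i p) -> proj_elt (qe i g) ->
  x^# * x = qh p -> qh g * x = x -> exists2 j, le i j & exists t,
  [/\ (qe j t)^# * qe j t = qe j p, qe j g * qe j t = qe j t, qh t = x &
      x * x^# = qh g -> qe j t * (qe j t)^# = qe j g].
Proof.
move=> hp hg xx gx; have xp : x * qh p = x := piso_mul (qh_proj hp) xx.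
have [y hy] := qh_surj x; pose z := g * y * p.
have hz : qh z = x by rewrite /z !qhM hy gx xp.
have e16 : (0 : R) < 16^-1 by rewrite invr_gt0 ltr0n.
have e4 : (0 : R) < 4^-1 by rewrite invr_gt0 ltr0n.
have [|j1 ij1 s1] := @qe_small i (p - z^# * z) 16^-1 _ e16.
  by rewrite qhB qhM qhS hz xx subrr.
(* The range is controlled only if [x] has all of [qh g] as its range; otherwise 0 makes the
   smallness request trivial. *)
pose z2 := if pselect (x * x^# = qh g) is left _ then g - z * z^# else 0.
have [|j j1j s2] := @qe_small j1 z2 4^-1 _ e4.
  rewrite /z2; case: pselect => [e|_]; last by rewrite (sh0 qh_hom.1).
  by rewrite qhB qhM qhS hz e subrr.
have ij := le_trans ij1 j1j; exists j => //.
have hpj := qe_proj ij hp; have hgj := qe_proj ij hg.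
have zp : qe j z * qe j p = qe j z by rewrite -qeM /z -mulrA !qeM hpj.2.
have gz : qe j g * qe j z = qe j z by rewrite -qeM /z !qeM !mulrA hgj.2.
have {}s1 := s1 _ j1j; have {}s2 := s2 _ (le_refl j).
rewrite qeB qeM qeS in s1.
have fxx : fe (qe j z)^# * fe (qe j z) = fe (qe j p).
  by rewrite (shS (fe_hom j).1) !fe_qe hz xx.
have [c [h1 h2 h3 h4]] : exists c, [/\ (qe j z * c)^# * (qe j z * c) = qe j p,
    qe j g * (qe j z * c) = qe j z * c, fe c = 1 &
    x * x^# = qh g -> qe j z * c * (qe j z * c)^# = qe j g].
  move: s2; rewrite /z2; case: pselect => [e|ne] s2.
    rewrite qeB qeM qeS in s2.
    have [c [c1 c2 _ c3]] := piso_perturb hpj hgj zp gz s1 s2.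
    by exists c; split=> //; [rewrite mulrA gz | exact: c3 (fe_hom j) fxx].
  have [|c [c1 _ c3]] := isometry_perturb hpj zp.
    by apply: Order.POrderTheory.le_trans s1 _; rewrite lef_pV2 ?posrE ?ltr0n// ler_nat.
  by exists c; split=> //; [rewrite mulrA gz | exact: c3 (fe_hom j) fxx].
have [t ht] := qe_surj (qe j z * c); exists t; rewrite ht; split=> //.
by rewrite -(fe_qe j) ht (shM _ _ (fe_hom j).1) h3 mulr1 fe_qe.
Qed.

(** A self-adjoint preimage is cut down by [1 - s] before perturbing. The resulting [p] then
    commutes with [s], so [p (1 - s)] is a projection orthogonal to [s]; its image is still [r], as
    [r] is orthogonal to [qh s]. *)
Lemma lift_projection i s r : proj_elt (qe i s) -> proj_elt r -> qh s * r = 0 ->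
  exists2 j, le i j & exists t, [/\ proj_elt (qe j t), qe j s * qe j t = 0 & qh t = r].
Proof.
move=> hs [rs rr] sr; have [hh1 h11] := qh_hom.
have rS : r * qh s = 0 by rewrite -rs -(qh_proj hs).1 -csM sr cstar0.
have [y hy] := qh_surj r.
pose h : R[i] := (2^-1 : R)%:C.
have hh : h + h = 1.
  rewrite /h -(rmorphD (real_complex R)); have -> : 2^-1 + 2^-1 = 1 :> R by field.
  exact: (rmorph1 (real_complex R)).
have hc i' (z : ucs (C i')) : (h *: z)^# = h *: z^#.
  by rewrite cstarZ; congr (_ *: _); apply/eqP; rewrite eq_complex /= oppr0 !eqxx.
pose x := (1 - s) * (h *: (y + y^#)) * (1 - s).
have hx : qh x = r.
  rewrite /x !qhM qhB h11 (shZ hh1) (shD hh1) qhS hy rs scalerDr -scalerDl hh scale1r.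
  by rewrite mulrBl mul1r sr subr0 mulrBr mulr1 rS subr0.
have e8 : (0 : R) < 8^-1 by rewrite invr_gt0 ltr0n.
have [|j ij sm] := @qe_small i (x * x - x) 8^-1 _ e8.
  by rewrite qhB qhM hx rr subrr.
exists j => //; have hsj := qe_proj ij hs; have [hs1 hs2] := hsj.
have q1 : qe j 1 = 1 := (qe_hom j).2.
have hS := proj_compl hsj; set S := qe j s in hs1 hs2 hS *; have [cS1 cS2] := hS.1.
have xE : qe j x = (1 - S) * (h *: (qe j y + (qe j y)^#)) * (1 - S).
  by rewrite /x !qeM qeB q1 (shZ (qe_hom j).1) (shD (qe_hom j).1) qeS.
have s0 : S * qe j x = 0 by rewrite xE !mulrA hS.2 !mul0r.
have xs : (qe j x)^# = qe j x.
  by rewrite xE !csM cS1 hc cstarD cstarK (addrC _^#) !mulrA.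
have x0 : qe j x * S = 0 by rewrite -xs -hs1 -csM s0 cstar0.
have nx : nm (qe j x * qe j x - qe j x) <= 8^-1 by rewrite -qeM -qeB; exact: sm.
have [p [[ps pp] pc pf]] := proj_perturb xs nx.
have pS : p * S = S * p by apply: pc; rewrite x0 s0.
have [t ht] := qe_surj (p * (1 - S)); exists t; split.
- rewrite ht; have c : p * (1 - S) = (1 - S) * p by rewrite mulrBr mulrBl mulr1 mul1r pS.
  split; first by rewrite csM ps cS1 -c.
  by rewrite {1}c mulrA -(mulrA _ p p) pp -c -mulrA cS2.
- by rewrite ht mulrBr mulr1 pS mulrBr !mulrA hs2 subrr.
have [fh f1] := fe_hom j.
have fp : fe p = r by rewrite (pf _ _ (fe_hom j)) fe_qe hx.
by rewrite -(fe_qe j) ht (shM _ _ fh) (shB fh) f1 fp /S fe_qe mulrBr mulr1 rS subr0.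
Qed.

(** Properties persist at later stages, so the stage can be advanced once for each element of
    [l]. *)
Lemma choice_along (I : eqType) (X : Type) (x0 : X) (Pr : I -> T -> X -> Prop) (l : seq I) i0 :
  (forall k i j x, le i j -> Pr k i x -> Pr k j x) ->
  (forall k i, k \in l -> le i0 i -> exists2 j, le i j & exists x, Pr k j x) ->
  exists2 j, le i0 j & exists x : I -> X, forall k, k \in l -> Pr k j (x k).
Proof.
move=> mono; elim: l => [|k l IH] h; first by exists i0 => //; exists (fun=> x0).
have [|i i0i [x hx]] := IH; first by move=> k' i k'l; apply: h; rewrite inE k'l orbT.
have [|j ij [y hy]] := h k i _ i0i; first by rewrite inE eqxx.
exists j; first exact: le_trans i0i ij.
exists (fun k' => if k' == k then y else x k') => k'; rewrite inE.
by case: eqP => [->//|_ /= /hx]; exact: mono ij.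
Qed.

(** Each projection is lifted orthogonally to the sum of the earlier lifts. *)
Lemma lift_projections (I : eqType) (l : seq I) (r : I -> ucs A) i0 : uniq l ->
  {in l, forall k, proj_elt (r k)} -> {in l &, forall k k', k <> k' -> r k * r k' = 0} ->
  exists2 i, le i0 i & exists t : I -> ucs B, [/\ {in l, forall k, proj_elt (qe i (t k))},
    {in l &, forall k k', k <> k' -> qe i (t k) * qe i (t k') = 0} &
    {in l, forall k, qh (t k) = r k}].
Proof.
elim: l => [|k l IH] /=; first by exists i0 => //; exists (fun=> 0).
move=> /andP[kl ul] hr ro.
have lin k' : k' \in l -> k' \in k :: l by move=> h; rewrite inE h orbT.
have kin : k \in k :: l by rewrite inE eqxx.
have [||i i0i [t [t1 t2 t3]]] := IH ul.
- by move=> k' /lin; exact: hr.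
- by move=> k' k'' /lin h /lin; exact: ro.
have [hs sE] := sum_orth ul t1 t2; rewrite -(sh_sum (qe_hom i).1) in hs sE.
set s := \sum_(k <- l) t k in hs sE.
have [|j ij [u [u1 u2 u3]]] := lift_projection hs (hr k kin) (_ : qh s * r k = 0).
  rewrite (sh_sum qh_hom.1) mulr_suml big_seq big1// => k' k'l.
  by rewrite t3// (ro _ _ (lin _ k'l) kin)// => e; move: kl; rewrite -e k'l.
have ut k' : k' \in l -> qe j (t k') * qe j u = 0.
  move=> k'l; have -> : qe j (t k') = qe j (t k') * qe j s.
    by rewrite -qeM; apply: (qe_mono ij); rewrite qeM sE.
  by rewrite -mulrA u2 mulr0.
have tk k' : k' \in l -> k' == k = false by move=> k'l; apply: contraNF kl => /eqP<-.
have tj k' : k' \in l -> proj_elt (qe j (t k')) by move=> /t1; exact: qe_proj.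
exists j; first exact: le_trans i0i ij.
exists (fun k' => if k' == k then u else t k'); split.
- by move=> k'; rewrite inE; case: eqP => [_ _ //|_ /= /tj].
- move=> k' k''; rewrite !inE; case: (k' =P k) => [-> _|_ /= k'l].
    case: (k'' =P k) => [->//|_ /= k''l _].
    by rewrite -[LHS]cstarK csM u1.1 (tj _ k''l).1 ut// cstar0.
  case: (k'' =P k) => [_ _ _|_ /= k''l ne]; first exact: ut.
  rewrite -qeM -[RHS](sh0 (qe_hom j).1); apply: (qe_mono ij).
  by rewrite qeM t2// (sh0 (qe_hom i).1).
by move=> k'; rewrite inE; case: eqP => [-> //|_ /= /t3].
Qed.

End LiftingSystem.

(** * The finite data that determine the stage *)

Section BaseLifting.
Variables (R : realType) (E : digraph) (O : graph_algebra R E).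
Local Notation P := (vel (vertex_elt O)).
Local Notation S := (eel (edge_elt O)).
Local Notation rel := (graph_algebraP O).
Local Notation D := (infinite_emitters E).
Variables (B : cstarAlgType R) (T : Type) (le : T -> T -> Prop).
Variables (C : T -> cstarAlgType R) (qe : forall i, ucs B -> ucs (C i)).
Variables (qh : ucs B -> ucs O) (fe : forall i, ucs (C i) -> ucs O).
Hypotheses (le_refl : forall i, le i i) (le_trans : forall i j k, le i j -> le j k -> le i k).
Hypotheses (qe_hom : forall i, unital_hom (@qe i)) (qh_hom : unital_hom qh)
  (fe_hom : forall i, unital_hom (@fe i)) (fe_qe : forall i x, fe (qe i x) = qh x).
Hypotheses (qe_surj : forall i y, exists x, qe i x = y) (qh_surj : forall y, exists x, qh x = y).
Hypothesis qe_mono : forall i j x y, le i j -> qe i x = qe i y -> qe j x = qe j y.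
Hypothesis qe_small : forall i z (e : R), qh z = 0 -> 0 < e ->
  exists2 j, le i j & forall k, le j k -> nm (qe k z) <= e.
Variables (V0 : seq (vertex E)).
Hypotheses (uV0 : uniq V0) (DV : forall d, D d -> d \in V0).
Hypothesis tV : forall e, origin e \in V0 -> ~ D (origin e) -> terminus e \in V0.

Let qeM i x y : qe i (x * y) = qe i x * qe i y := shM x y (qe_hom i).1.
Let qeS i x : qe i x^# = (qe i x)^# := shS (qe_hom i).1 x.

Lemma qe_mono_src i j (x p : ucs B) : le i j -> (qe i x)^# * qe i x = qe i p ->
  (qe j x)^# * qe j x = qe j p.
Proof. by move=> ij; rewrite -!qeS -!qeM; exact: qe_mono. Qed.

Lemma qe_mono_rng i j (x p : ucs B) : le i j -> qe i x * (qe i x)^# = qe i p ->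
  qe j x * (qe j x)^# = qe j p.
Proof. by move=> ij; rewrite -!qeS -!qeM; exact: qe_mono. Qed.

Lemma qe_mono_mul i j x y z : le i j -> qe i x * qe i y = qe i z -> qe j x * qe j y = qe j z.
Proof. by move=> ij; rewrite -!qeM; exact: qe_mono. Qed.

Lemma qe_mono_mul0 i j x y : le i j -> qe i x * qe i y = 0 -> qe j x * qe j y = 0.
Proof.
by move=> ij; rewrite -(sh0 (qe_hom i).1) -(sh0 (qe_hom j).1); exact: qe_mono_mul.
Qed.

(** To have (o6) exactly at a finite emitter [v], the range projections of its edges are lifted
    first, as orthogonal projections [t (inl e)], and [pb v] is defined as their sum; an infinite
    emitter gets a projection of its own. The edges then lift to partial isometries with ranges
    exactly [t (inl e)]. *)
Lemma lift_base i0 : exists2 i, le i0 i & exists (pb : vertex E -> ucs B) (sb : edge E -> ucs B),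
  [/\ {in V0, forall v, proj_elt (qe i (pb v))},
      {in V0 &, forall v v', v <> v' -> qe i (pb v) * qe i (pb v') = 0},
      {in V0, forall v, qh (pb v) = P v},
      forall e, origin e \in V0 -> ~ D (origin e) ->
        [/\ (qe i (sb e))^# * qe i (sb e) = qe i (pb (terminus e)),
          qe i (pb (origin e)) * qe i (sb e) = qe i (sb e) & qh (sb e) = S e] &
      forall v l, v \in V0 -> ~ D v -> uniq l -> out_edges v = [set` l] ->
        \sum_(e <- l) qe i (sb e) * (qe i (sb e))^# = qe i (pb v)].
Proof.
have /choice[outl houtl] : forall v, exists l : seq (edge E),
    ~ D v -> uniq l /\ out_edges v = [set` l].
  move=> v; have [Dv|Dv] := pselect (D v); first by exists [::].
  by have [l ul hl] := finite_emitter_seq Dv; exists l.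
pose I := (edge E + vertex E)%type.
pose Lv v : seq I := if pselect (D v) is left _ then [:: inr v] else map inl (outl v).
pose own (k : I) := match k with inl e => origin e | inr d => d end.
pose r (k : I) : ucs O := match k with inl e => S e * (S e)^# | inr d => P d end.
have ownE v k : k \in Lv v -> own k = v.
  rewrite /Lv; case: pselect => Dv; first by rewrite inE => /eqP->.
  move=> /mapP[e el ->] /=; have [_ hl] := houtl v Dv.
  by have : out_edges v e by rewrite hl.
have uLv v : uniq (Lv v).
  rewrite /Lv; case: pselect => Dv //; rewrite map_inj_uniq; first by have [] := houtl v Dv.
  by move=> x y [].
pose l := undup (flatten [seq Lv v | v <- V0]).
have Ll v k : v \in V0 -> k \in Lv v -> k \in l.
  by move=> vV kL; rewrite mem_undup; apply/flatten_mapP; exists v.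
have r_proj : {in l, forall k, proj_elt (r k)}.
  move=> [e|d] _ /=; [exact: (eel_range_proj rel e) | exact: (vel_proj rel d)].
have Pr k : P (own k) * r k = r k.
  case: k => [e|d] /=; first by rewrite mulrA (vel_eel rel).
  by rewrite (vel_proj rel d).2.
have lD k : k \in l -> match k with inl e => ~ D (origin e) | inr d => D d end.
  rewrite mem_undup => /flatten_mapP[v _]; rewrite /Lv; case: pselect => Dv.
    by rewrite inE => /eqP->.
  move=> /mapP[e el ->]; have [_ hl] := houtl v Dv.
  by have -> : origin e = v by have : out_edges v e by rewrite hl.
have r_orth : {in l &, forall k k', k <> k' -> r k * r k' = 0}.
  move=> k k' kl k'l kk'; have [oo|oo] := eqVneq (own k) (own k'); last first.
    rewrite -[r k](r_proj k kl).1; apply: orth_mul (Pr k) (Pr k') _.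
      exact: (vel_proj rel _).1.
    by apply: (velM rel); exact/eqP.
  move: (lD _ kl) (lD _ k'l) kk' oo; case: k {kl} => [e|d]; case: k' {k'l} => [e'|d'] /=.
  - move=> _ _ ee' _; rewrite mulrA -(mulrA _ (S e)^#) (eel_orth rel) ?mulr0 ?mul0r//.
    by move=> h; apply: ee'; rewrite h.
  - by move=> h1 h2 _ h3; move: h1; rewrite h3.
  - by move=> h1 h2 _ h3; move: h2; rewrite -h3.
  by move=> _ _ dd' h; case: dd'; rewrite h.
have [i i0i [t [t1 t2 t3]]] := lift_projections le_refl le_trans qe_hom qh_hom fe_hom fe_qe
  qe_surj qh_surj qe_mono qe_small i0 (undup_uniq _) r_proj r_orth.
pose pb v := \sum_(k <- Lv v) t k.
have pbE j v : qe j (pb v) = \sum_(k <- Lv v) qe j (t k) by rewrite (sh_sum (qe_hom j).1).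
have tL1 v : v \in V0 -> {in Lv v, forall k, proj_elt (qe i (t k))}.
  by move=> vV k /(Ll _ _ vV) /t1.
have tL2 v : v \in V0 -> {in Lv v &, forall k k', k <> k' -> qe i (t k) * qe i (t k') = 0}.
  by move=> vV k k' /(Ll _ _ vV) kl /(Ll _ _ vV) k'l; exact: t2.
have pb_proj : {in V0, forall v, proj_elt (qe i (pb v))}.
  by move=> v vV; rewrite pbE; have [] := sum_orth (uLv v) (tL1 v vV) (tL2 v vV).
have pb_t v k : v \in V0 -> k \in Lv v -> qe i (pb v) * qe i (t k) = qe i (t k).
  move=> vV kL; have [[hs _] /(_ k kL) h] := sum_orth (uLv v) (tL1 v vV) (tL2 v vV).
  by rewrite -(tL1 v vV k kL).1 pbE -{1}hs -csM h.
have pb_orth : {in V0 &, forall v v', v <> v' -> qe i (pb v) * qe i (pb v') = 0}.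
  move=> v v' vV v'V vv'; rewrite !pbE mulr_suml big_seq big1// => k kL.
  rewrite mulr_sumr big_seq big1// => k' k'L; apply: t2; [exact: Ll kL|exact: Ll k'L|].
  by move=> kk'; apply: vv'; rewrite -(ownE v k kL) kk' (ownE v' k' k'L).
have qpb : {in V0, forall v, qh (pb v) = P v}.
  move=> v vV; rewrite /pb (sh_sum qh_hom.1).
  have -> : \sum_(k <- Lv v) qh (t k) = \sum_(k <- Lv v) r k.
    by rewrite [LHS]big_seq [RHS]big_seq; apply: eq_bigr => k kL; apply: t3; exact: Ll kL.
  rewrite /Lv; case: pselect => Dv; first by rewrite big_seq1.
  by rewrite big_map /=; have [ul hl] := houtl v Dv; exact: (vel_sum rel).
have eL e : ~ D (origin e) -> inl e \in Lv (origin e).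
  move=> De; rewrite /Lv; case: pselect => // Dv; apply/mapP; exists e => //.
  by have [_ hl] := houtl _ Dv; have : out_edges (origin e) e by []; rewrite hl.
pose LB := flatten [seq outl v | v <- [seq v <- V0 | ~~ `[< D v >]]].
have inLB e : origin e \in V0 -> ~ D (origin e) -> e \in LB.
  move=> oV Do; apply/flatten_mapP; exists (origin e).
    by rewrite mem_filter oV andbT; apply/asboolPn.
  by have [_ hl] := houtl _ Do; have : out_edges (origin e) e by []; rewrite hl.
have LBin e : e \in LB -> origin e \in V0 /\ ~ D (origin e).
  move=> /flatten_mapP[v]; rewrite mem_filter => /andP[/asboolPn Dv vV] el.
  have [_ hl] := houtl _ Dv; have -> // : origin e = v.
  by have : out_edges v e by rewrite hl.
pose PrB e j x := [/\ (qe j x)^# * qe j x = qe j (pb (terminus e)),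
  qe j x * (qe j x)^# = qe j (t (inl e)) & qh x = S e].
have [||j ij [sb hsb]] := @choice_along T le le_refl le_trans _ (ucs B) 0 PrB LB i.
- by move=> e i1 i2 x i12 [h1 h2 h3]; split; [exact: qe_mono_src h1|exact: qe_mono_rng h2|].
- move=> e i1 /LBin[oV Do] ii1.
  have h1 : proj_elt (qe i1 (pb (terminus e))) by apply: (qe_proj qe_hom qe_mono ii1); exact/pb_proj/tV.
  have tel : inl e \in l by apply: (Ll _ _ oV); exact: eL.
  have h2 : proj_elt (qe i1 (t (inl e))) by apply: (qe_proj qe_hom qe_mono ii1); exact: t1.
  have h3 : (S e)^# * S e = qh (pb (terminus e)) by rewrite qpb ?(eel_source rel)//; exact: tV.
  have h4 : qh (t (inl e)) * S e = S e.
    by rewrite t3//= -mulrA (eel_source rel) (eel_vel rel).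
  have [i2 i12 [x [x1 x2 x3 x4]]] := lift_partial_isometry le_refl le_trans qe_hom qh_hom fe_hom
    fe_qe qe_surj qh_surj qe_mono qe_small h1 h2 h3 h4.
  by exists i2 => //; exists x; split=> //; apply: x4; rewrite t3.
have mp v : v \in V0 -> proj_elt (qe j (pb v)).
  by move=> /pb_proj; exact: (qe_proj qe_hom qe_mono ij).
exists j; first exact: le_trans i0i ij.
exists pb, sb; split=> //.
- by move=> v v' vV v'V vv'; apply: (qe_mono_mul0 ij); exact: pb_orth.
- move=> e oV Do; have [h1 h2 h3] := hsb e (inLB e oV Do); split=> //.
  have pt : qe j (pb (origin e)) * qe j (t (inl e)) = qe j (t (inl e)).
    by apply: (qe_mono_mul ij); apply: pb_t => //; exact: eL.
  have h4 : qe j (t (inl e)) * qe j (sb e) = qe j (sb e).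
    by apply: range_mul h1 h2; exact/mp/tV.
  by rewrite -h4 mulrA pt.
move=> v l' vV Dv ul' hl'; have [ul hl] := houtl v Dv.
have pl : perm_eq l' (outl v) by exact: set_seq_perm (etrans (esym hl') hl).
rewrite (perm_big _ pl) /= pbE /Lv; case: pselect => // Dv'; rewrite big_map.
rewrite [LHS]big_seq [RHS]big_seq; apply: eq_bigr => e el.
have ov : origin e = v by have : out_edges v e by rewrite hl.
by have [_ -> _] : PrB e j (sb e) by apply: hsb; apply: inLB; rewrite ov.
Qed.

Lemma lift_partial_isometries i (l : seq (ucs B * ucs B * ucs O)) :
  (forall k, k \in l -> [/\ proj_elt (qe i k.1.1), proj_elt (qe i k.1.2),
     k.2^# * k.2 = qh k.1.1 & qh k.1.2 * k.2 = k.2]) ->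
  exists2 j, le i j & forall k, k \in l -> exists t, [/\ (qe j t)^# * qe j t = qe j k.1.1,
    qe j k.1.2 * qe j t = qe j t, qh t = k.2 &
    k.2 * k.2^# = qh k.1.2 -> qe j t * (qe j t)^# = qe j k.1.2].
Proof.
move=> hl; pose Pr (k : ucs B * ucs B * ucs O) j t := [/\ (qe j t)^# * qe j t = qe j k.1.1,
    qe j k.1.2 * qe j t = qe j t, qh t = k.2 &
    k.2 * k.2^# = qh k.1.2 -> qe j t * (qe j t)^# = qe j k.1.2].
have [||j ij [t ht]] := @choice_along T le le_refl le_trans _ (ucs B) 0 Pr l i.
- move=> k i1 j x i1j [h1 h2 h3 h4]; split=> //; first exact: qe_mono_src h1.
    exact: qe_mono_mul h2.
  by move=> /h4; exact: qe_mono_rng.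
- move=> k i1 /hl[h1 h2 h3 h4] ii1.
  have h1' := qe_proj qe_hom qe_mono ii1 h1; have h2' := qe_proj qe_hom qe_mono ii1 h2.
  have [i2 i12 [x hx]] := lift_partial_isometry le_refl le_trans qe_hom qh_hom fe_hom
    fe_qe qe_surj qh_surj qe_mono qe_small h1' h2' h3 h4.
  by exists i2 => //; exists x.
by exists j => // k /ht h; exists (t k).
Qed.

Variables (o : vertex E) (bO : ucs O) (aO rO : vertex E -> ucs O) (xs : seq (ucs O)).
Variable ks : vertex E -> seq (ucs O).
Hypotheses (oV : o \in V0) (bO_iso : bO^# * bO = P o) (o_bO : P o * bO = bO).
Hypotheses (aO_iso : forall v, (aO v)^# * aO v = P v) (o_aO : forall v, P o * aO v = aO v)
  (bO_aO : forall v, bO^# * aO v = 0).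
Hypotheses (rO_iso : forall d, D d -> (rO d)^# * rO d = P o)
  (d_rO : forall d, D d -> P d * rO d = rO d).
Hypothesis xs_iso : {in xs, forall x : ucs O, x^# * x = P o /\ {in V0, forall v, P v * x = 0}}.
Hypotheses (ks_unitary : forall v k, k \in ks v -> corner_unitary (P v) k)
  (ks_gen : forall v Y, corner_unitary (P v) Y -> unitary_gen (P v) (ks v) Y).

(** Everything that influences the choice of the stage is collected here. Of the unitaries in the
    base corners only the generators [ks] need perturbation; [lam_lift] handles [lam], and products
    and adjoints follow. *)
Lemma lift_data (i0 : T) : exists (j : T) (pb al : vertex E -> ucs (C j)) (be : ucs (C j))
    (sb : edge E -> ucs (C j)),
  [/\ [/\ {in V0, forall v, proj_elt (pb v)},
          {in V0 &, forall v v', v <> v' -> pb v * pb v' = 0} &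
          {in V0, forall v, fe (pb v) = P v}],
      [/\ be^# * be = pb o, pb o * be = be, {in V0, forall v, (al v)^# * al v = pb v},
          {in V0, forall v, pb o * al v = al v} & {in V0, forall v, be^# * al v = 0}],
      [/\ forall e, origin e \in V0 -> ~ D (origin e) -> (sb e)^# * sb e = pb (terminus e),
          forall e, origin e \in V0 -> ~ D (origin e) -> pb (origin e) * sb e = sb e,
          forall e, origin e \in V0 -> ~ D (origin e) -> fe (sb e) = S e &
          forall v l, v \in V0 -> ~ D v -> uniq l -> out_edges v = [set` l] ->
            \sum_(e <- l) sb e * (sb e)^# = pb v],
      {in V0 &, forall v v', (exists x : ucs O, x^# * x = P v /\ x * x^# = P v') ->
         exists y : ucs (C j), y^# * y = pb v /\ y * y^# = pb v'} /\
      {in V0, forall v, ~ D v -> forall Y, corner_unitary (P v) Y ->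
         exists2 Z, corner_unitary (pb v) Z & fe Z = Y} &
      (forall d, D d -> exists r : ucs (C j), [/\ r^# * r = pb o, pb d * r = r & fe r = rO d]) /\
      {in xs, forall x, exists r : ucs (C j),
         [/\ r^# * r = pb o, (1 - \sum_(v <- V0) pb v) * r = r & fe r = x]}].
Proof.
have [i i0i [pb [sb [pp po qpb hsb sb_sum]]]] := lift_base i0.
have [i1 ii1 [be [be1 be2 be3 _]]] : exists2 j, le i j & exists t,
    [/\ (qe j t)^# * qe j t = qe j (pb o), qe j (pb o) * qe j t = qe j t, qh t = bO & True].
  have h1 := pp _ oV; have h2 : bO^# * bO = qh (pb o) by rewrite qpb.
  have h3 : qh (pb o) * bO = bO by rewrite qpb.
  have [j ij [t [t1 t2 t3 _]]] := lift_partial_isometry le_refl le_trans qe_hom qh_hom fe_hom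
    fe_qe qe_surj qh_surj qe_mono qe_small h1 h1 h2 h3.
  by exists j => //; exists t.
have pp1 v : v \in V0 -> proj_elt (qe i1 (pb v)).
  by move=> /pp; exact: (qe_proj qe_hom qe_mono ii1).
have po1 j v v' : le i j -> v \in V0 -> v' \in V0 -> v <> v' -> qe j (pb v) * qe j (pb v') = 0.
  by move=> ij vV v'V vv'; apply: (qe_mono_mul0 ij); exact: po.
(* Lifting the [aO v] under [G] rather than [pb o] makes them exactly orthogonal to [be], which
   therefore had to be lifted earlier. *)
pose G := pb o - be * be^#.
have GE j : qe j G = qe j (pb o) - qe j be * (qe j be)^#.
  by rewrite (shB (qe_hom j).1) qeM qeS.
pose G2 := 1 - \sum_(v <- V0) pb v.
have G2E j : qe j G2 = 1 - \sum_(v <- V0) qe j (pb v).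
  by rewrite (shB (qe_hom j).1) (qe_hom j).2 (sh_sum (qe_hom j).1).
have hG : proj_elt (qe i1 G).
  by rewrite GE; have [_ h _] := proj_sub (pp1 o oV) (pp1 o oV) be1 be2.
have hG2 : proj_elt (qe i1 G2).
  rewrite G2E; have [|h _] := sum_orth uV0 pp1; last by have [] := proj_compl h.
  by move=> v v' vV v'V; exact: po1.
have GaO v : qh G * aO v = aO v.
  rewrite (shB qh_hom.1) (shM _ _ qh_hom.1) (shS qh_hom.1) be3 qpb//.
  by rewrite mulrBl o_aO -mulrA bO_aO mulr0 subr0.
pose mvb (p : vertex E * vertex E) := exists x : ucs O, x^# * x = P p.1 /\ x * x^# = P p.2.
have /choice[yO hyO] : forall p, exists x : ucs O, mvb p -> x^# * x = P p.1 /\ x * x^# = P p.2.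
  by move=> p; have [[x hx]|n] := pselect (mvb p); [exists x | exists 0].
(* Triples of a source projection, a projection above the range and the element to lift: the pieces
   [aO v], the equivalences among base projections, the generators of corner unitaries, the reserves
   at infinite emitters, and those outside the base. *)
pose l1 := [seq (pb v, G, aO v) | v <- V0].
pose l2 := [seq (pb p.1, pb p.2, yO p) |
  p <- [seq p <- [seq (v, v') | v <- V0, v' <- V0] | `[< mvb p >]]].
pose l3 := flatten [seq [seq (pb v, pb v, P v * k) | k <- ks v] | v <- V0].
pose l4 := [seq (pb o, pb d, rO d) | d <- [seq d <- V0 | `[< D d >]]].
pose l5 := [seq (pb o, G2, x) | x <- xs].
have hv := vel_proj rel.
have kP v k : k \in ks v -> k * P v = P v * k by move=> /ks_unitary/corner_unitary_comm.
have kk v k : k \in ks v -> (P v * k)^# * (P v * k) = P v /\ (P v * k) * (P v * k)^# = P v.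
  move=> kks; have [k1 k2 _] := ks_unitary kks; rewrite -(kP v k kks) csM (hv v).1.
  by rewrite -!mulrA (mulrA _ k) k1 mul1r (hv v).2 (mulrA (P v)) (hv v).2 mulrA kP// -mulrA k2 mulr1.
have [|j i1j hj] := @lift_partial_isometries i1 (l1 ++ l2 ++ l3 ++ l4 ++ l5).
  move=> k; rewrite !mem_cat => /or4P[|||/orP[|]].
  - by move=> /mapP[v vV ->] /=; split; rewrite ?qpb//; exact: pp1.
  - move=> /mapP[[v v']]; rewrite mem_filter => /andP[/asboolP h /allpairsP[[u u'] /= [uV u'V e]]].
    move: e h => [-> ->] h ->; have [h1 h2] := hyO _ h => /=.
    split; [exact: pp1|exact: pp1|by rewrite qpb|rewrite qpb//].
    exact: range_mul (hv u) h1 h2.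
  - move=> /flatten_mapP[v vV /mapP[k' k'ks ->]] /=; have [h1 h2] := kk v k' k'ks.
    by split; rewrite ?qpb// ?mulrA ?(hv v).2//; exact: pp1.
  - move=> /mapP[d]; rewrite mem_filter => /andP[/asboolP Dd dV] -> /=.
    split; rewrite ?qpb//; [exact: pp1|exact: pp1|exact: rO_iso|exact: d_rO].
  move=> /mapP[x xxs ->] /=; have [x1 x2] := xs_iso xxs; split; rewrite ?qpb//; first exact: pp1.
  rewrite (shB qh_hom.1) qh_hom.2 (sh_sum qh_hom.1) mulrBl mul1r mulr_suml.
  by rewrite big_seq big1 ?subr0// => v vV; rewrite qpb// x2.
have ij := le_trans ii1 i1j; have ppj v : v \in V0 -> proj_elt (qe j (pb v)).
  by move=> /pp; exact: (qe_proj qe_hom qe_mono ij).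
have poj v v' := po1 j v v' ij.
have fpj v : v \in V0 -> fe (qe j (pb v)) = P v by move=> vV; rewrite fe_qe qpb.
have be1j := qe_mono_src i1j be1; have be2j := qe_mono_mul i1j be2.
have /choice[al hal] : forall v, exists t, v \in V0 -> [/\ (qe j t)^# * qe j t = qe j (pb v),
    qe j (pb o) * qe j t = qe j t & (qe j be)^# * qe j t = 0].
  move=> v; have [vV|vV] := boolP (v \in V0); last by exists 0.
  have [|t [t1 t2 t3 _]] := hj (pb v, G, aO v).
    by rewrite mem_cat; apply/orP; left; apply/mapP; exists v.
  exists t => _; rewrite /= in t1 t2 t3; split=> //; rewrite -t2 GE mulrA.
    by rewrite mulrBr (ppj o oV).2 mulrA be2j.
  have e1 : (qe j be)^# * qe j (pb o) = (qe j be)^# by rewrite -{1}(ppj o oV).1 -csM be2j.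
  have e2 : qe j (pb o) * (qe j be)^# = (qe j be)^#.
    by rewrite -{1}(ppj o oV).1 -csM (piso_mul (ppj o oV) be1j).
  by rewrite mulrBr mulrA be1j e1 e2 subrr mul0r.
exists j, (fun v => qe j (pb v)), (fun v => qe j (al v)), (qe j be), (fun e => qe j (sb e)).
split.
- by split=> //; exact: poj.
- by split=> //; move=> v /hal[].
- split=> [e oe De|e oe De|e oe De|v l vV Dv ul hl]; try have [h1 h2 h3] := hsb e oe De.
  + exact: qe_mono_src h1.
  + exact: qe_mono_mul h2.
  + by rewrite fe_qe.
  have := sb_sum v l vV Dv ul hl.
  have sE k : \sum_(e <- l) qe k (sb e) * (qe k (sb e))^# = qe k (\sum_(e <- l) sb e * (sb e)^#).
    by rewrite (sh_sum (qe_hom k).1); apply: eq_bigr => e _; rewrite qeM qeS.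
  by rewrite !sE; exact: qe_mono.
- split.
  + move=> v v' vV v'V h; have [|t [t1 t2 t3 t4]] := hj (pb v, pb v', yO (v, v')).
      rewrite !mem_cat; apply/or4P/Or42/mapP; exists (v, v') => //.
      rewrite mem_filter; apply/andP; split; first exact/asboolP.
      by apply/allpairsP; exists (v, v').
    exists (qe j t); split; first exact: t1.
    by apply: t4; rewrite /= qpb//; have [] := hyO (v, v') h.
  move=> v vV _ Y /ks_gen; elim=> [c lc|k kks|{}Y Y' _ [Z hZ fZ] _ [Z' hZ' fZ']|{}Y _ [Z hZ fZ]].
  + by apply: (lam_lift (fe_hom j)); [|exact: ppj|rewrite fpj] => // y;
      have [x <-] := qh_surj y; exists (qe j x).
  + have [|t [t1 t2 t3 t4]] := hj (pb v, pb v, P v * k).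
      rewrite !mem_cat; apply/or4P/Or43/flatten_mapP; exists v => //.
      by apply/mapP; exists k.
    (* The generator was cut down to [P v * k] for lifting; [1 - pb v] restores the part off the
       corner. *)
    rewrite /= in t1 t2 t3 t4; exists (1 - qe j (pb v) + qe j t).
      apply: corner_unitary_compl => //; first exact: ppj.
        exact: piso_mul (ppj v vV) t1.
      by apply: t4; rewrite qpb//; have [] := kk v k kks.
    rewrite (shD (fe_hom j).1) (shB (fe_hom j).1) (fe_hom j).2 !fe_qe qpb// t3.
    have [_ _ [h _]] := ks_unitary kks; rewrite mulrBr mulr1 in h.
    by apply/eqP; rewrite -subr_eq0; apply/eqP; rewrite -[RHS](subrr (k - 1)) -{1}h; ncring.
  + exists (Z * Z'); first exact: corner_unitaryM.
    by rewrite (shM _ _ (fe_hom j).1) fZ fZ'.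
  exists Z^#; first exact: corner_unitaryS (ppj v vV).1 hZ.
  by rewrite (shS (fe_hom j).1) fZ.
split.
  move=> d Dd; have dV := DV Dd; have [|t [t1 t2 t3 _]] := hj (pb o, pb d, rO d).
    rewrite !mem_cat; apply/or4P/Or44/orP; left; apply/mapP; exists d => //.
    by rewrite mem_filter dV andbT; exact/asboolP.
  by exists (qe j t); rewrite fe_qe.
move=> x xxs; have [|t [t1 t2 t3 _]] := hj (pb o, G2, x).
  by rewrite !mem_cat; apply/or4P/Or44/orP; right; apply/mapP; exists x.
by exists (qe j t); rewrite fe_qe -G2E.
Qed.

End BaseLifting.

(** * The directed system given by a directed family of ideals *)

Section IdealSystem.
Variables (R : realType) (B A : cstarAlgType R) (L : set (set B)) (q : B -> A).
Hypotheses (hL : forall J, L J -> is_closed_ideal J) (dirL : directed L).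
Hypothesis hq : is_quotient (closure (\bigcup_(J in L) J)) q.

Definition stage := {J : set B | L J}.
Definition stage_le (i j : stage) := sval i `<=` sval j.
Definition stage_ideal (i : stage) : is_closed_ideal (sval i) := hL (svalP i).
Definition stage_quo i : cstarAlgType R := quo (stage_ideal i).
Definition stage_map i : ucs B -> ucs (stage_quo i) := uhom (qpi (stage_ideal i)).

Let qhom : is_star_hom q. Proof. by case: hq. Qed.

Lemma stage_ker (i : stage) b : sval i b -> q b = 0.
Proof.
move=> ib; have [_ _ ker] := hq; suff : (q @^-1` [set 0]) b by [].
by rewrite ker; apply: subset_closure; exists (sval i) => //; exact: (svalP i).
Qed.

Definition stage_factor i : stage_quo i -> A := @qfactor _ _ _ (stage_ideal i) A q.

Lemma stage_factor_hom i : is_star_hom (@stage_factor i).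
Proof. by apply: qfactor_hom => // b; exact: stage_ker. Qed.

Lemma stage_factorE i b : stage_factor (qpi (stage_ideal i) b) = q b.
Proof. by apply: qfactorE => // b'; exact: stage_ker. Qed.

Lemma stage_factor_map i x : uhom (stage_factor (i := i)) (stage_map i x) = uhom q x.
Proof. by rewrite /uhom /= stage_factorE. Qed.

Lemma stage_map_hom i : unital_hom (@stage_map i).
Proof. exact/unital_uhom/qpi_hom. Qed.

Lemma stage_map_surj i y : exists x, stage_map i x = y.
Proof.
have [_ h _] := qpi_quotient (stage_ideal i); have [b _ bE] := h y.1 I.
by exists (b, y.2); rewrite /stage_map /uhom /= bE; case: y {bE}.
Qed.

Lemma uhom_surj y : exists x, uhom q x = y.
Proof.
have [_ h _] := hq; have [b _ bE] := h y.1 I.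
by exists (b, y.2); rewrite /uhom /= bE; case: y {bE}.
Qed.

Lemma stage_map_mono i j x y : stage_le i j -> stage_map i x = stage_map i y ->
  stage_map j x = stage_map j y.
Proof.
move=> ij [] /qpi_eq h e2; congr pair; last exact: e2.
by apply/qpi_eq/ij.
Qed.

(** An element killed by [q] is within [e] of some [b] in an ideal of the family; at every stage
    containing that ideal its image is the image of a difference of norm less than [e]. *)
Lemma stage_map_small i z (e : R) : uhom q z = 0 -> 0 < e ->
  exists2 j, stage_le i j & forall k, stage_le j k -> nm (stage_map k z) <= e.
Proof.
move=> [z1 z2] e0; have [_ _ ker] := hq.
have cz : closure (\bigcup_(J in L) J) z.1 by rewrite -ker.
have [b [[J LJ Jb]]] : (\bigcup_(J in L) J `&` ball (z.1 : B) (e%:C : R[i])) !=set0.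
  by apply: cz; apply: nbhsx_ballx; rewrite ltr0c.
rewrite -ball_normE /= nmE ltcR => bz.
have [_ dir] := dirL; have [J' [LJ' iJ' JJ']] := dir _ _ (svalP i) LJ.
exists (exist _ J' LJ') => // k jk.
have -> : stage_map k z = stage_map k (emb (z.1 - b)).
  congr pair; last exact: z2.
  by apply/qpi_eq; rewrite opprB addrC subrK; apply: jk; exact: JJ'.
rewrite (_ : stage_map k _ = emb (qpi (stage_ideal k) (z.1 - b)))// nm_emb.
by apply: le_trans (nm_qpi _ _) _; exact: ltW.
Qed.

End IdealSystem.

Lemma infinite_enum (T : choiceType) (A : set T) (m : T -> nat) : injective m -> infinite_set A ->
  exists en : nat -> T, [/\ injective en, forall n, A (en n) & forall x, A x -> exists n, en n = x].
Proof.
move=> m_inj infA; have cA : countable A by apply/countable_injP; exists m => x y _ _; exact: m_inj.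
have /card_set_bijP[f [_ f_inj f_surj]] := Cantor_Bernstein cA ((infiniteP A).1 infA).
have /choice[en hen] : forall n, exists x, A x /\ f x = n.
  by move=> n; have [x Ax fx] := f_surj n I; exists x.
exists en; split=> [n k nk|n|x Ax].
- by rewrite -(hen n).2 nk (hen k).2.
- exact: (hen n).1.
exists (f x); apply: f_inj; rewrite ?inE//; first exact: (hen _).1.
exact: (hen _).2.
Qed.

(** * From lifted generators to a splitting homomorphism *)

Section Sections.
Variables (R : realType) (E : digraph) (O : graph_algebra R E) (Q : cstarAlgType R).
Variables (g : Q -> O) (p : vertex E -> ucs Q) (s : edge E -> ucs Q).
Hypothesis hg : is_star_hom g.
Local Notation D := (infinite_emitters E).
Local Notation P := (vel (vertex_elt O)).
Local Notation S := (eel (edge_elt O)).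

(** The universal property supplies [psi]; the composite [g \o psi] fixes the generators, hence
    everything by density. The 2 in [dense_eq0] is a Lipschitz constant of [g (psi a) - a]. *)
Lemma section_of_lift : (forall u, uhom g (p u) = P u) -> (forall e, uhom g (s e) = S e) ->
  (forall u, proj_elt (p u)) -> (forall u v, u <> v -> p u * p v = 0) ->
  (forall e, (s e)^# * s e = p (terminus e)) ->
  (forall e, D (origin e) -> p (origin e) * s e = s e) ->
  (forall e f, e <> f -> origin e = origin f -> D (origin e) -> (s e)^# * s f = 0) ->
  (forall u l, ~ D u -> uniq l -> out_edges u = [set` l] -> \sum_(e <- l) s e * (s e)^# = p u) ->
  exists psi : O -> Q, is_star_hom psi /\ forall a, g (psi a) = a.
Proof.
move=> gp gs hp p_orth s_src s_rng s_orth s_sum; have eh := @emb_hom R Q.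
(* [uhom g] keeps scalar parts, and those of [P u] and [S e] vanish, so the lifts lie in [Q]
   itself. *)
pose p' u := (p u).1; pose s' e := (s e).1.
have ep u : emb (p' u) = p u.
  by have := congr1 snd (gp u); rewrite /p' /=; case: (p u) => a c /= ->.
have es e : emb (s' e) = s e.
  by have := congr1 snd (gs e); rewrite /s' /=; case: (s e) => a c /= ->.
have gr : graph_relations p' s'.
  split.
  - move=> e; apply: emb_inj; rewrite !(shcM eh) (shS eh) es !cmulE -mulrA s_src.
    exact: piso_mul (hp _) (s_src e).
  - move=> u; have [h1 h2] := hp u.
    by split; apply: emb_inj; rewrite ?(shcM eh) ?(shS eh) ep.
  - by move=> u v uv; apply: emb_inj; rewrite (shcM eh) !ep (sh0 eh); exact: p_orth.
  - by move=> e; apply: emb_inj; rewrite (shcM eh) (shS eh) es ep; exact: s_src.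
  - by move=> e De; apply: emb_inj; rewrite (shcM eh) es ep; exact: s_rng.
  - by move=> e f ef oef De; apply: emb_inj; rewrite (shcM eh) (shS eh) !es (sh0 eh); exact: s_orth.
  move=> u Du; have [l ul hl] := finite_emitter_seq Du.
  apply: emb_inj; rewrite ep -(s_sum u l Du ul hl) hl -fsbig_seq// (sh_sum eh).
  by apply: eq_bigr => e _; rewrite (shcM eh) (shS eh) es.
have [psi [psih psiv psie]] := graph_algebra_universal O gr; exists psi; split=> // a.
have ch : is_star_hom (g \o psi) := is_star_hom_comp psih hg.
apply/subr0_eq; move: a.
apply: (@dense_eq0 R E O O [set a | g (psi a) = a] (fun a => g (psi a) - a) 2).
- split.
  + by rewrite /= (sh0 psih) (sh0 hg).
  + by move=> c a b /= ha hb; rewrite (shD psih) (shZ psih) (shD hg) (shZ hg) ha hb.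
  + by move=> a b /= ha hb; rewrite (shcM psih) (shcM hg) ha hb.
  by move=> a /= ha; rewrite (shS psih) (shS hg) ha.
- by move=> u; rewrite /= psiv; exact: (congr1 fst (gp u)).
- by move=> e; rewrite /= psie; exact: (congr1 fst (gs e)).
- move=> a b; have -> : g (psi a) - a - (g (psi b) - b) = g (psi (a - b)) - (a - b).
    by rewrite (shB psih) (shB hg) !opprB addrACA [RHS]addrACA (addrC (- a)).
  have := nmB (g (psi (a - b))) (a - b); have := star_hom_nm (a - b) ch; rewrite /=; lra.
by move=> a /= ->; rewrite subrr.
Qed.

End Sections.

Section EmitterIsometry.
Variables (R : realType) (E : digraph) (O : graph_algebra R E).
Local Notation P := (vel (vertex_elt O)).
Local Notation S := (eel (edge_elt O)).
Local Notation rel := (graph_algebraP O).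

(** By (o6) both [P u] and [P v] are sums of ranges of edges. The [z e] match the summands, and [w]
    is the sum of the elements [S e * z e * (S (ge e))^#]. *)
Lemma emitter_isometry (u v : vertex E) (ge : edge E -> edge E) :
  ~ infinite_emitters E u -> ~ infinite_emitters E v ->
  set_bij (out_edges u) (out_edges v) ge ->
  (forall e, origin e = u -> exists z : ucs O,
     z^# * z = P (terminus (ge e)) /\ z * z^# = P (terminus e)) ->
  exists w : ucs O, w^# * w = P v /\ w * w^# = P u.
Proof.
move=> Du Dv bij hz; have [_ ge_inj _] := bij.
have /choice[z hz'] : forall e, exists z : ucs O, origin e = u ->
    z^# * z = P (terminus (ge e)) /\ z * z^# = P (terminus e).
  move=> e; have [eu|eu] := pselect (origin e = u); last by exists 0.
  by have [z h] := hz e eu; exists z.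
have [l ul hl] := finite_emitter_seq Du.
have lu e : e \in l -> origin e = u by move=> el; have : out_edges u e by rewrite hl.
have z_src e : e \in l -> (z e)^# * z e = P (terminus (ge e)) by move=> /lu/hz'[].
have z_rng e : e \in l -> z e * (z e)^# = P (terminus e) by move=> /lu/hz'[].
have [ul' hl'] := set_bij_seq bij ul hl.
pose x e := S e * z e; pose w := \sum_(e <- l) x e * (S (ge e))^#.
have zP e : e \in l -> z e * P (terminus (ge e)) = z e.
  by move=> el; exact: piso_mul (vel_proj rel _) (z_src e el).
have Pz e : e \in l -> P (terminus e) * z e = z e.
  by move=> el; exact: range_mul (vel_proj rel _) (z_src e el) (z_rng e el).
have xx e e' : e \in l -> e' \in l -> (x e)^# * x e' = if e == e' then P (terminus (ge e)) else 0.
  move=> el e'l; rewrite /x csM !mulrA; case: eqP => [<-|ee'].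
    by rewrite (mulKeq (eel_source rel e)) -(mulrA _ (P _)) Pz// z_src.
  by rewrite (mulKeq (eel_orth rel ee')) mulr0 mul0r.
have gg e e' : e \in l -> e' \in l -> e <> e' -> (S (ge e))^# * S (ge e') = 0.
  move=> el e'l ee'; apply: (eel_orth rel) => h; apply: ee'.
  by apply: ge_inj h; rewrite inE hl.
exists w; split.
  rewrite {2}/w mulr_sumr -(vel_sum rel Dv ul' hl') big_map [LHS]big_seq [RHS]big_seq.
  apply: eq_bigr => e el; rewrite /w cs_sum mulr_suml (bigD1_seq e)//=.
  rewrite csM cstarK -mulrA (mulrA (x e)^#) xx// eqxx.
  rewrite [X in _ + X]big_seq_cond big1 ?addr0; last first.
    move=> e' /andP[e'l e'e]; rewrite csM cstarK -mulrA (mulrA (x e')^#) xx// (negbTE e'e).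
    by rewrite mul0r mulr0.
  by rewrite mulrA (eel_vel rel).
have ws e : e \in l -> w * S (ge e) = x e.
  move=> el; rewrite /w mulr_suml (bigD1_seq e)//= -mulrA (eel_source rel).
  rewrite big_seq_cond big1 ?addr0 => [|e' /andP[e'l /eqP e'e]].
    by rewrite /x -mulrA zP.
  by rewrite -mulrA gg// mulr0.
rewrite {2}/w cs_sum mulr_sumr -(vel_sum rel Du ul hl) [LHS]big_seq [RHS]big_seq.
apply: eq_bigr => e el; rewrite csM cstarK mulrA ws// /x csM !mulrA.
by rewrite -(mulrA _ (z e)) z_rng// (eel_vel rel).
Qed.

End EmitterIsometry.

Theorem theorem3p1 (R : realType) (E : digraph) (O : graph_algebra R E)
    (F : nat -> subgraph E)
    (E_infinite : infinite_digraph E)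
    (F_finite : forall n, is_finite (F n))
    (F_incr : forall n, is_sub (F n) (F n.+1))
    (F_verts : \bigcup_n verts (F n) = [set: vertex E])
    (F_edges : \bigcup_n edges (F n) = [set: edge E])
    (a1 : infinite_emitters E `<=` verts (F 0))
    (a2 : forall n, irreducible (F n) /\ ~ is_cycle (F n))
    (a3 : forall n e, verts (F n) (origin e) -> verts (F n) (terminus e) ->
       edges (F n) e)
    (a4 : forall n e, (verts (F n) `\` infinite_emitters E) (origin e) ->
       edges (F n) e)
    (a5 : forall n e, verts (F n) (terminus e) -> edges (F n.+1) e)
    (b1 : zmod_finitely_generated (K0 O) /\ group_finitely_generated (K1 O))
    (b2 : forall u, ~ infinite_emitters E u ->
       exists v, (verts (F 0) `\` infinite_emitters E) v /\
       exists gv ge, is_graph_iso (out_subgraph u) (out_subgraph v) gv ge /\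
         forall e, out_edges u e ->
           vertex_class O (terminus e) = vertex_class O (terminus (ge e))) :
  semiprojective O.
Proof.
pose P := vel (vertex_elt O); pose S := eel (edge_elt O); pose D := infinite_emitters E.
have rel := graph_algebraP O; have hv u : proj_elt (P u) := vel_proj rel u.
pose C x y := vertex_class O x = vertex_class O y.
have irr n : irreducible (F n) by have [] := a2 n.
have b2' u : ~ D u -> exists v, (verts (F 0) `\` D) v /\
    exists ge, set_bij (out_edges u) (out_edges v) ge /\
    forall e, out_edges u e -> C (terminus e) (terminus (ge e)).
  move=> /b2[v [hv' [gv [ge [[_ bij _ _] h]]]]].
  by exists v; split=> //; exists ge.
have SC u v : exists2 es, es <> [::] & gwalk u es v := strongly_connected F_incr F_verts irr u v.
have loops := incomparable_loops E_infinite F_finite F_incr F_verts irr a4 b2'.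
have [d0 Dd0] := emitter_ex E_infinite F_finite F_incr F_verts irr a4 b2'.
have [m m_inj] := vertex_enumerated F_finite F_verts.
have [me me_inj] := edge_enumerated F_finite F_edges.
have [V0 [uV0 DV tV V0_inf b2V]] := base_vertices F_finite F_incr F_verts a1 a4 b2'.
have walks u : exists mu : vertex E -> seq (edge E), forall x, gwalk u (mu x) x.
  have /choice[mu hmu] : forall x, exists es, gwalk u es x.
    by move=> x; have [es _ h] := SC u x; exists es.
  by exists mu.
have mvC x y : C x y -> exists w : ucs O, w^# * w = P x /\ w * w^# = P y.
  move=> xy; have [la [lb [gla glb clab]]] := loops x; have [mu gmu] := walks x.
  have [nu _ gnu] := SC y x.
  exact: (vertex_class_equiv gla glb clab m_inj gmu xy gla glb clab gla gnu).
have /choice[ks hks] : forall v, exists ks : seq (ucs O),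
    (forall k, k \in ks -> corner_unitary (P v) k) /\
    forall Y, corner_unitary (P v) Y -> unitary_gen (P v) ks Y.
  move=> v; have [la [lb [gla glb clab]]] := loops v; have [mu gmu] := walks v.
  exact: (corner_unitary_generated gla glb clab m_inj gmu b1.2).
pose o := d0; have oV : o \in V0 := DV _ Dd0.
(* On the base the pair has to be trivial, so that [wt] can extend [pb]; elsewhere
   [emitter_isometry] supplies the second component. *)
have /choice[vw hvw] : forall u, exists p : vertex E * ucs O,
    [/\ p.1 \in V0, p.2^# * p.2 = P p.1, p.2 * p.2^# = P u, u \in V0 -> p = (u, P u) &
      u \notin V0 -> ~ D p.1 /\ exists ge, set_bij (out_edges u) (out_edges p.1) ge /\
        forall e, out_edges u e -> C (terminus e) (terminus (ge e))].
  move=> u; have [uV|uV] := boolP (u \in V0).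
    by exists (u, P u) => /=; have [h1 h2] := hv u; rewrite h1 h2.
  have Du : ~ D u by move=> /DV; rewrite (negbTE uV).
  have [v [vV Dv [ge [bij hC]]]] := b2V u Du.
  have [|w [w1 w2]] := @emitter_isometry R E O u v ge Du Dv bij.
    by move=> e eu; apply: mvC; exact/esym/hC.
  by exists (v, w); split=> //= _; split=> //; exists ge.
pose vv u := (vw u).1; pose w u : ucs O := (vw u).2.
have vvV u : vv u \in V0 by have [] := hvw u.
have w_src u : (w u)^# * w u = P (vv u) by have [] := hvw u.
have w_rng u : w u * (w u)^# = P u by have [] := hvw u.
have P_w u : P u * w u = w u := range_mul (hv _) (w_src u) (w_rng u).
have vv0 : {in V0, forall v, vv v = v} by move=> v vV; rewrite /vv; have [_ _ _ ->] := hvw v.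
have w0 : {in V0, forall v, w v = P v} by move=> v vV; rewrite /w; have [_ _ _ ->] := hvw v.
(* A path from [vv u] back to [o] puts a copy of [P o] into the base corner; this is the room
   occupied by the reserve in [sequence_lift]. *)
have /choice[ka hka] : forall u, exists x : ucs O, x^# * x = P o /\ P (vv u) * x = x.
  move=> u; have [es _ g] := SC (vv u) o; exists (pel (vertex_elt O) (edge_elt O) (vv u) es).
  by rewrite (pel_source rel g) (vel_pel rel g).
have [la [lb [gla glb clab]]] := loops o; have [mu gmu] := walks o.
(* Paths beginning with the incomparable loops [lb] and [la] split a reserve into the part that is
   kept and the part spent on the next partial isometry. *)
pose bO : ucs O := pel (vertex_elt O) (edge_elt O) o lb.
pose aO v : ucs O := pel (vertex_elt O) (edge_elt O) o (la ++ mu v).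
have gla' v : gwalk o (la ++ mu v) v := gwalk_cat gla (gmu v).
have /choice[ee hee] : forall d, exists ee : nat -> edge E, D d ->
    [/\ injective ee, forall n, origin (ee n) = d & forall e, origin e = d -> exists n, ee n = e].
  move=> d; have [Dd|Dd] := pselect (D d); last first.
    (* The default off [D] needs some edge; a nonempty closed path at [d] has one. *)
    have [e0 _] : exists e : edge E, True.
      by have [es es0 _] := SC d d; case: es es0 => // e0; exists e0.
    by exists (fun=> e0).
  by have [en [h1 h2 h3]] := infinite_enum me_inj Dd; exists en.
pose rO d : ucs O := S (ee d 0) * w (terminus (ee d 0)) * ka (terminus (ee d 0)).
(* The list has at most one element, and none if all vertices belong to the base and no outer
   reserve is required. *)
have [xs [xs_iso hxs]] : exists xs : seq (ucs O),
    {in xs, forall x : ucs O, x^# * x = P o /\ {in V0, forall v, P v * x = 0}} /\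
    ((forall u, u \in V0) \/ exists en : nat -> vertex E, [/\ injective en,
      forall n, en n \notin V0, forall u, u \notin V0 -> exists n, en n = u &
      w (en 0) * ka (en 0) \in xs]).
  case: V0_inf => [allV|inf]; first by exists [::]; split=> //; left.
  have [en [h1 h2 h3]] := infinite_enum m_inj inf.
  exists [:: w (en 0) * ka (en 0)]; split; last by right; exists en; rewrite inE eqxx.
  move=> x; rewrite inE => /eqP->; have [k1 k2] := hka (en 0); split.
    by rewrite csM mulrA -(mulrA _ (w _)^#) w_src -mulrA k2.
  move=> v vV; rewrite mulrA -P_w mulrA (velM rel) ?mul0r// => e.
  by have := h2 0; rewrite /= -e vV.
move=> B L hL dirL q hq.
have [[J0 LJ0] _] := dirL; pose i0 : stage L := exist _ J0 LJ0.
have qhom : is_star_hom q by case: hq.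
have le_refl (i : stage L) : stage_le i i by [].
have le_trans (i j k : stage L) : stage_le i j -> stage_le j k -> stage_le i k.
  by move=> ij jk b /ij /jk.
have fe_hom i := unital_uhom (stage_factor_hom hL hq i).
have bO_iso : bO^# * bO = P o := pel_source rel glb.
have o_bO : P o * bO = bO := vel_pel rel glb.
have aO_iso v : (aO v)^# * aO v = P v := pel_source rel (gla' v).
have o_aO v : P o * aO v = aO v := vel_pel rel (gla' v).
have bO_aO v : bO^# * aO v = 0.
  apply: (pel_orth rel glb (gla' v)); rewrite comp_sym; apply: contra clab.
  by rewrite -{1}[lb]cats0; exact: comp_cat.
have rO_iso d : D d -> (rO d)^# * rO d = P o.
  move=> Dd; set e := ee d 0; set t := terminus e; have [k1 k2] := hka t.
  rewrite /rO -/e -/t !csM !mulrA (mulKeq (eel_source rel e)) -/t -(mulrA _ (vel _ t)) P_w.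
  by rewrite (mulKeq (w_src t)) -(mulrA _ (P _)) k2.
have d_rO d : D d -> P d * rO d = rO d.
  by move=> /hee[_ h _]; rewrite /rO !mulrA -{1}(h 0%N) (vel_eel rel).
have [j [pb [al [be [sb [[pp po fpb] [be1 be2 al1 al2 al3] [sb1 sb2 sb3 sb4] [yb ul] [rd rx]]]]]]] :=
  lift_data (le := @stage_le _ _ L) (qe := stage_map hL) (qh := uhom q)
   (fe := fun i => uhom (@stage_factor _ _ _ L q hL i)) le_refl le_trans
   (stage_map_hom hL) (unital_uhom qhom) fe_hom (stage_factor_map hL hq)
   (fun i => @stage_map_surj _ _ L hL i) (uhom_surj hq)
   (@stage_map_mono _ _ L hL) (stage_map_small hL dirL hq) uV0 DV tV oV
   bO_iso o_bO aO_iso o_aO bO_aO rO_iso d_rO xs_iso (fun v => (hks v).1) (fun v => (hks v).2) i0.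
set f := uhom _ in fpb sb3 ul rd rx.
have uf : unital_hom f := fe_hom j.
have fsurj x : exists y, f y = x.
  have [y <-] := uhom_surj hq x; exists (stage_map hL j y); exact: (stage_factor_map hL hq).
have ka_iso u : (ka u)^# * ka u = P o := (hka u).1.
have vka u : P (vv u) * ka u = ka u := (hka u).2.
have [wt [wt_src wt_orth wt0 fwt]] : exists wt : vertex E -> ucs (stage_quo hL j),
    [/\ forall u, (wt u)^# * wt u = pb (vv u), forall u u', u <> u' -> (wt u)^# * wt u' = 0,
        {in V0, forall v, wt v = pb v} & forall u, f (wt u) = w u].
  case: hxs => [allV|[en [h1 h2 h3 h4]]].
    exists pb; split=> // [u|u u' uu'|u]; have [h _] := pp _ (allV u).
    - by rewrite h (pp _ (allV u)).2 vv0.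
    - by rewrite h po.
    by rewrite fpb// w0.
  have [r [r1 r2 r3]] := rx _ h4.
  have [wt' hwt'] := outer_isometries uf fsurj uV0 vvV oV w_src w_rng ka_iso vka pp po fpb
    be1 be2 al1 al2 al3 h1 h2 h3 r1 r2 r3.
  exists (fun u => if u \in V0 then pb u else wt' u); split.
  - move=> u; case: ifPn => [uV|/hwt'[]//]; have [k1 k2] := pp _ uV.
    by rewrite k1 k2 vv0.
  - move=> u u' uu'; case: ifPn => uV; case: ifPn => u'V.
    + by rewrite (pp _ uV).1 po.
    + by rewrite (pp _ uV).1; have [_ h _ _] := hwt' u' u'V; exact: h.
    + have [_ h _ _] := hwt' u uV.
      by rewrite -[LHS]cstarK csM cstarK (pp _ u'V).1 h// cstar0.
    by have [_ _ _ h] := hwt' u uV; exact: h.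
  - by move=> v ->.
  by move=> u; case: ifPn => [uV|/hwt'[]//]; rewrite fpb// w0.
have outer u : u \notin V0 -> ~ D (vv u) /\ exists ge, set_bij (out_edges u) (out_edges (vv u)) ge /\
    forall e, origin e = u -> exists x : ucs O,
      x^# * x = P (vv (terminus e)) /\ x * x^# = P (terminus (ge e)).
  move=> uV; have [_ _ _ _ /(_ uV)[Dv [ge [bij hC]]]] := hvw u.
  split=> //; exists ge; split=> // e eu; have [z [z1 z2]] := mvC _ _ (hC e eu).
  have zP := piso_mul (hv _) z1; set t := terminus e in z1 zP *.
  exists (z * w t); rewrite !csM !mulrA; split.
    by rewrite (mulKeq z1) -(mulrA _ (P t)) P_w w_src.
  by rewrite (mulKeq (w_rng t)) zP z2.
have inner d : D d -> exists (ee : nat -> edge E) (r : ucs (stage_quo hL j)), [/\ injective ee,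
    forall n, origin (ee n) = d, forall e, origin e = d -> exists n, ee n = e &
    [/\ r^# * r = pb o, pb d * r = r & f r = S (ee 0) * w (terminus (ee 0)) * ka (terminus (ee 0))]].
  by move=> Dd; have [h1 h2 h3] := hee d Dd; have [r hr] := rd d Dd; exists (ee d), r.
have [st [s1 s2 s3 s4 s5]] := graph_lift uf fsurj vvV oV w_src w_rng ka_iso vka pp fpb
  be1 be2 al1 al2 al3 wt_src wt0 fwt tV sb1 sb2 sb3 sb4 yb ul DV outer inner.
have [psi [psih psiE]] := section_of_lift (stage_factor_hom hL hq j) (fpt uf w_rng fwt) s2
  (pt_proj vvV pp wt_src) (fun u u' => @pt_orth _ _ _ _ wt_orth u u') s1 s3 s4 s5.
exists (sval j); split; first exact: (svalP j).
exists (stage_quo hL j), (qpi (stage_ideal hL j)), (@stage_factor _ _ _ L q hL j), psi; split=> //.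
- exact: qpi_quotient.
- by split; [exact: stage_factor_hom | exact: stage_factorE].
Qed.
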